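(* The point-symmetry pseudogroup $G_{1.3}$ of the equation $w_{122}+w_{22}w_{222}=0$ for $w=w(z_1,z_2)$ is constituted by the point transformations of the form \[ \tilde z_1=\frac{c_1z_1+c_2}{c_3z_1+c_4},\quad \tilde z_2=\frac{z_2+c_5z_1+c_6}{c_3z_1+c_4}, \] \[ \tilde w=\frac{w}{\Delta(c_3z_1+c_4)} -\frac{c_3}{\Delta(c_3z_1+c_4)^2}\frac{z_2^3}6-\frac{c_3c_6-c_4c_5}{\Delta(c_3z_1+c_4)^2}\frac{z_2^2}2 +W^1(z_1)z_2+W^0(z_1), \] where $c_1,\dots,c_6$ are arbitrary constants with $\Delta:=c_1c_4-c_2c_3\ne0$, and $W^0$ and $W^1$ are arbitrary smooth functions of $z_1$.
   Context: Subscripts $1$ and $2$ of $w$ denote differentiation with respect to $z_1$ and $z_2$, respectively. The point-symmetry pseudogroup of a differential equation is the pseudogroup of all local point transformations (local diffeomorphisms) of the space with coordinates $(z_1,z_2,w)$ that map the solution set of the equation to itself. *)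

(* Defs.v *)
From Stdlib Require Import Reals List.
From Coquelicot Require Import Coquelicot.
Open Scope R_scope.

(** Coordinates: z1, z2 on R^2; (z1, z2, w) on R^3.  Functions are curried. *)
Inductive var2 := v1 | v2.
Inductive var3 := u1 | u2 | u3.

Definition open2 (O : R -> R -> Prop) : Prop :=
  forall x y, O x y -> exists d, 0 < d /\
    forall x' y', Rabs (x' - x) < d -> Rabs (y' - y) < d -> O x' y'.

Definition open3 (U : R -> R -> R -> Prop) : Prop :=
  forall x y z, U x y z -> exists d, 0 < d /\
    forall x' y' z', Rabs (x' - x) < d -> Rabs (y' - y) < d ->
      Rabs (z' - z) < d -> U x' y' z'.

Definition pd2 (i : var2) (f : R -> R -> R) : R -> R -> R :=
  fun x y => match i with
             | v1 => Derive (fun t => f t y) x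
             | v2 => Derive (fun t => f x t) y
             end.

Definition exd2 (i : var2) (f : R -> R -> R) (x y : R) : Prop :=
  match i with
  | v1 => ex_derive (fun t => f t y) x
  | v2 => ex_derive (fun t => f x t) y
  end.

Definition pd3 (i : var3) (f : R -> R -> R -> R) : R -> R -> R -> R :=
  fun x y z => match i with
               | u1 => Derive (fun t => f t y z) x
               | u2 => Derive (fun t => f x t z) y
               | u3 => Derive (fun t => f x y t) z
               end.

Definition exd3 (i : var3) (f : R -> R -> R -> R) (x y z : R) : Prop :=
  match i with
  | u1 => ex_derive (fun t => f t y z) x
  | u2 => ex_derive (fun t => f x t z) y
  | u3 => ex_derive (fun t => f x y t) z
  end.

Definition pds2 (l : list var2) (f : R -> R -> R) : R -> R -> R :=
  fold_right pd2 f l.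
Definition pds3 (l : list var3) (f : R -> R -> R -> R) : R -> R -> R -> R :=
  fold_right pd3 f l.

Definition smooth2 (O : R -> R -> Prop) (f : R -> R -> R) : Prop :=
  forall (l : list var2) x y, O x y ->
    continuous (fun p : R * R => pds2 l f (fst p) (snd p)) (x, y) /\
    (forall i, exd2 i (pds2 l f) x y).

Definition smooth3 (U : R -> R -> R -> Prop) (f : R -> R -> R -> R) : Prop :=
  forall (l : list var3) x y z, U x y z ->
    continuous (fun p : R * R * R => pds3 l f (fst (fst p)) (snd (fst p)) (snd p))
      (x, y, z) /\
    (forall i, exd3 i (pds3 l f) x y z).

Definition smooth1 (a b : R) (f : R -> R) : Prop :=
  forall (n : nat) x, a < x < b -> ex_derive (Derive_n f n) x.

Definition is_solution (O : R -> R -> Prop) (w : R -> R -> R) : Prop :=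
  open2 O /\ smooth2 O w /\
  forall x y, O x y ->
    pds2 (v1 :: v2 :: v2 :: nil) w x y
    + pds2 (v2 :: v2 :: nil) w x y * pds2 (v2 :: v2 :: v2 :: nil) w x y = 0.

(** A point transformation (local diffeomorphism) Phi = (F1, F2, F3) of the
    (z1, z2, w)-space defined on an open set U: smooth, injective on U, with
    nowhere vanishing Jacobian determinant on U (hence a diffeomorphism of U
    onto an open set, by the inverse function theorem). *)
Definition jac3 (F1 F2 F3 : R -> R -> R -> R) (x y z : R) : R :=
  let a i j := pd3 j (match i with u1 => F1 | u2 => F2 | u3 => F3 end) x y z in
  a u1 u1 * (a u2 u2 * a u3 u3 - a u2 u3 * a u3 u2)
  - a u1 u2 * (a u2 u1 * a u3 u3 - a u2 u3 * a u3 u1)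
  + a u1 u3 * (a u2 u1 * a u3 u2 - a u2 u2 * a u3 u1).

Definition is_point_transformation (U : R -> R -> R -> Prop)
    (F1 F2 F3 : R -> R -> R -> R) : Prop :=
  open3 U /\ smooth3 U F1 /\ smooth3 U F2 /\ smooth3 U F3 /\
  (forall x y z x' y' z', U x y z -> U x' y' z' ->
     F1 x y z = F1 x' y' z' -> F2 x y z = F2 x' y' z' -> F3 x y z = F3 x' y' z' ->
     x = x' /\ y = y' /\ z = z') /\
  (forall x y z, U x y z -> jac3 F1 F2 F3 x y z <> 0).

(** Phi maps the solution set to itself: whenever w is a solution on O whose
    graph lies in U, every smooth function wt on an open set Ot whose graph is
    contained in the image under Phi of the graph of w is again a solution. *)
Definition preserves_solutions (U : R -> R -> R -> Prop)
    (F1 F2 F3 : R -> R -> R -> R) : Prop :=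
  forall (O : R -> R -> Prop) (w : R -> R -> R),
    is_solution O w -> (forall x y, O x y -> U x y (w x y)) ->
    forall (Ot : R -> R -> Prop) (wt : R -> R -> R),
      open2 Ot -> smooth2 Ot wt ->
      (forall xt yt, Ot xt yt -> exists x y, O x y /\
          F1 x y (w x y) = xt /\ F2 x y (w x y) = yt /\ F3 x y (w x y) = wt xt yt) ->
      is_solution Ot wt.

Definition is_point_symmetry (U : R -> R -> R -> Prop)
    (F1 F2 F3 : R -> R -> R -> R) : Prop :=
  is_point_transformation U F1 F2 F3 /\ preserves_solutions U F1 F2 F3.

Definition G13_form (c1 c2 c3 c4 c5 c6 : R) (W0 W1 : R -> R)
    (F1 F2 F3 : R -> R -> R -> R) (x y z : R) : Prop :=
  let D := c1 * c4 - c2 * c3 in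
  let q := c3 * x + c4 in
  q <> 0 /\
  F1 x y z = (c1 * x + c2) / q /\
  F2 x y z = (y + c5 * x + c6) / q /\
  F3 x y z = z / (D * q)
             - c3 / (D * q ^ 2) * (y ^ 3 / 6)
             - (c3 * c6 - c4 * c5) / (D * q ^ 2) * (y ^ 2 / 2)
             + W1 x * y + W0 x.

Definition locally_G13_form (U : R -> R -> R -> Prop)
    (F1 F2 F3 : R -> R -> R -> R) : Prop :=
  forall x y z, U x y z ->
    exists d, 0 < d /\
    exists c1 c2 c3 c4 c5 c6 : R, c1 * c4 - c2 * c3 <> 0 /\
    exists W0 W1 : R -> R, smooth1 (x - d) (x + d) W0 /\ smooth1 (x - d) (x + d) W1 /\
    forall x' y' z', U x' y' z' ->
      Rabs (x' - x) < d -> Rabs (y' - y) < d -> Rabs (z' - z) < d ->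
      G13_form c1 c2 c3 c4 c5 c6 W0 W1 F1 F2 F3 x' y' z'.

(* Main.v *)
Require Import Defs.
From Stdlib Require Import Reals.
From Coquelicot Require Import Coquelicot.
From Stdlib Require Import Lra List ssreflect ClassicalEpsilon.
Open Scope R_scope.

(* Idea. Along a solution w put X = F1(x,y,w), Y = F2(x,y,w), Z = F3(x,y,w). Where the Jacobian
   of (X, Y) does not vanish, the inverse function theorem turns Z into a function of (X, Y), so
   a symmetry forces the equation for Z with respect to the derivations d/dX, d/dY.

   This condition is affine in the third derivatives of w. Comparing two solutions with the same
   2-jet at a point shows that d/dy must kill X (the double characteristic dx = 0 is preserved),
   hence F1 = F1(x), and that d^2 Z/dY^2 = (Y_x + w_22 Y_y) / X_x (the simple characteristic is
   preserved). Varying the jet of w in the latter identity gives F2 = a(x) y + b(x) and F3 up to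
   two functions of x; the equation itself then gives ordinary differential equations for F1, a
   and b whose solutions are the Moebius form. The solutions needed have w_22 linear in y.

   Conversely, the stated maps have an explicit inverse, and the equation for the image is
   checked by direct differentiation. *)

(** * Smooth functions of two variables *)

(** With [v = w_22] the equation is the inviscid Burgers equation [v_x + v v_y = 0], and [w] is
    recovered from [v] up to a term affine in [y] whose coefficients are arbitrary functions of [x].
    This is the origin of [W0] and [W1], and it supplies explicit test solutions with the required
    data at a point. The principal symbol [xi_2^2 (xi_1 + w_22 xi_2)] shows the double and the
    simple characteristic. The symmetry hypothesis speaks only of functions whose graph lies in the
    image of a given graph. Such a function must be constructed, with all its derivatives, before
    the hypothesis can be used; hence an inverse function theorem in the plane, in which smoothness
    of the inverse is bootstrapped from a Lipschitz bound. Partial derivatives are iterated in a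
    definite order, and the symmetry of mixed derivatives is proved for functions on the
    three-dimensional space only; jets of solutions are therefore compared for every order of
    differentiation. *)

Definition is_pd2 (i : var2) (f : R -> R -> R) (x y l : R) : Prop :=
  match i with
  | v1 => is_derive (fun t => f t y) x l
  | v2 => is_derive (fun t => f x t) y l
  end.

Lemma is_pd2_unique i f x y l : is_pd2 i f x y l -> pd2 i f x y = l.
Proof. destruct i; apply is_derive_unique. Qed.

Lemma exd2_is_pd2 i f x y : exd2 i f x y -> is_pd2 i f x y (pd2 i f x y).
Proof. destruct i; apply Derive_correct. Qed.

Lemma is_pd2_exd2 i f x y l : is_pd2 i f x y l -> exd2 i f x y.
Proof. intros H; destruct i; exists l; exact H. Qed.

Lemma is_pd2_eq i f x y l l' : is_pd2 i f x y l -> l = l' -> is_pd2 i f x y l'.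
Proof. now intros H <-. Qed.

Lemma locally_Rabs (P : R -> Prop) x d :
  0 < d -> (forall t, Rabs (t - x) < d -> P t) -> locally x P.
Proof. intros Hd H. exists (mkposreal d Hd). intros t Ht. now apply H. Qed.

Lemma open2_locally O x y :
  open2 O -> O x y -> locally (x, y) (fun p => O (fst p) (snd p)).
Proof.
  intros HO H. destruct (HO x y H) as [d [Hd Hb]].
  exists (mkposreal d Hd). intros [a b] [H1 H2]. now apply Hb.
Qed.

Lemma open2_locally_l O x y : open2 O -> O x y -> locally x (fun t => O t y).
Proof.
  intros HO H. destruct (HO x y H) as [d [Hd Hb]].
  apply (locally_Rabs _ _ d Hd). intros t Ht. apply Hb; trivial.
  now rewrite Rminus_diag Rabs_R0.
Qed.

Lemma open2_locally_r O x y : open2 O -> O x y -> locally y (fun t => O x t).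
Proof.
  intros HO H. destruct (HO x y H) as [d [Hd Hb]].
  apply (locally_Rabs _ _ d Hd). intros t Ht. apply Hb; trivial.
  now rewrite Rminus_diag Rabs_R0.
Qed.

Lemma is_pd2_ext O i f g x y l :
  open2 O -> O x y -> (forall x y, O x y -> f x y = g x y) ->
  is_pd2 i f x y l -> is_pd2 i g x y l.
Proof.
  intros HO H E; destruct i; apply is_derive_ext_loc.
  - generalize (open2_locally_l O x y HO H). apply filter_imp. intros t Ht. now apply E.
  - generalize (open2_locally_r O x y HO H). apply filter_imp. intros t Ht. now apply E.
Qed.

Lemma pd2_ext O i f g x y :
  open2 O -> O x y -> (forall x y, O x y -> f x y = g x y) ->
  pd2 i f x y = pd2 i g x y.
Proof.
  intros HO H E; destruct i; apply Derive_ext_loc.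
  - generalize (open2_locally_l O x y HO H). apply filter_imp. intros t Ht. now apply E.
  - generalize (open2_locally_r O x y HO H). apply filter_imp. intros t Ht. now apply E.
Qed.

Lemma is_pd2_const i c x y : is_pd2 i (fun _ _ => c) x y 0.
Proof. destruct i; apply: is_derive_const. Qed.

Lemma is_pd2_plus i f g x y a b :
  is_pd2 i f x y a -> is_pd2 i g x y b ->
  is_pd2 i (fun x y => f x y + g x y) x y (a + b).
Proof. intros Hf Hg; destruct i; apply: is_derive_plus; assumption. Qed.

Lemma is_pd2_opp i f x y a :
  is_pd2 i f x y a -> is_pd2 i (fun x y => - f x y) x y (- a).
Proof. intros Hf; destruct i; apply: is_derive_opp; assumption. Qed.

Lemma is_pd2_mult i f g x y a b :
  is_pd2 i f x y a -> is_pd2 i g x y b ->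
  is_pd2 i (fun x y => f x y * g x y) x y (a * g x y + f x y * b).
Proof.
  intros Hf Hg; destruct i;
  apply: is_derive_mult; try assumption; intros; apply Rmult_comm.
Qed.

Lemma is_pd2_inv i f x y a :
  is_pd2 i f x y a -> f x y <> 0 ->
  is_pd2 i (fun x y => / f x y) x y (- a / f x y ^ 2).
Proof.
  intros Hf Hn; destruct i; [apply (is_derive_inv (fun t => f t y)) |
    apply (is_derive_inv (fun t => f x t))]; assumption.
Qed.

Lemma smooth2_pds2 O l f : smooth2 O f -> smooth2 O (pds2 l f).
Proof.
  intros H l' x y Hx. unfold pds2. rewrite <- fold_right_app.
  exact (H (l' ++ l)%list x y Hx).
Qed.

Lemma smooth2_pd2 O i f : smooth2 O f -> smooth2 O (pd2 i f).
Proof. apply (smooth2_pds2 O (i :: nil)). Qed.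

Lemma smooth2_continuous O f x y :
  smooth2 O f -> O x y -> continuous (fun p : R * R => f (fst p) (snd p)) (x, y).
Proof. intros H Hx. apply (H nil x y Hx). Qed.

Lemma smooth2_is_pd2 O f i x y :
  smooth2 O f -> O x y -> is_pd2 i f x y (pd2 i f x y).
Proof. intros H Hx. apply exd2_is_pd2, (H nil x y Hx). Qed.

Lemma smooth2_subset O O' f :
  (forall x y, O' x y -> O x y) -> smooth2 O f -> smooth2 O' f.
Proof. intros S H l x y Hx. apply H, S, Hx. Qed.

Lemma smooth3_pd3 U i f : smooth3 U f -> smooth3 U (pd3 i f).
Proof.
  intros H l x y z Hx. change (pd3 i f) with (pds3 (i :: nil) f).
  unfold pds3. rewrite <- fold_right_app. exact (H (l ++ i :: nil)%list x y z Hx).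
Qed.

Lemma smooth3_continuous U f x y z :
  smooth3 U f -> U x y z ->
  continuous (fun p : R * R * R => f (fst (fst p)) (snd (fst p)) (snd p)) (x, y, z).
Proof. intros H Hx. apply (H nil x y z Hx). Qed.

Lemma smooth3_exd3 U f i x y z : smooth3 U f -> U x y z -> exd3 i f x y z.
Proof. intros H Hx. apply (H nil x y z Hx). Qed.

(* Smoothness by coinduction: a class of functions closed under partial
   derivatives consists of smooth functions. *)
Lemma smooth2_class (O : R -> R -> Prop) (S : (R -> R -> R) -> Prop) :
  open2 O ->
  (forall f, S f ->
     (forall x y, O x y -> continuous (fun p : R * R => f (fst p) (snd p)) (x, y)) /\
     forall i, exists g, S g /\ forall x y, O x y -> is_pd2 i f x y (g x y)) ->
  forall f, S f -> smooth2 O f.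
Proof.
  intros HO HS f Sf.
  assert (E : forall l, exists g, S g /\ forall x y, O x y -> pds2 l f x y = g x y).
  { induction l as [|i l [g [Sg Eg]]]; [now exists f|].
    destruct (HS g Sg) as [_ H]. destruct (H i) as [h [Sh Dh]].
    exists h; split; trivial. intros x y Hx. simpl.
    transitivity (pd2 i g x y); [now apply (pd2_ext O)|]. now apply is_pd2_unique, Dh. }
  intros l x y Hx. destruct (E l) as [g [Sg Eg]]. destruct (HS g Sg) as [C D]. split.
  - apply continuous_ext_loc with (fun p : R * R => g (fst p) (snd p)); [|now apply C].
    generalize (open2_locally O x y HO Hx). apply filter_imp. intros p Hp. symmetry. now apply Eg.
  - intros i. destruct (D i) as [h [_ Dh]]. apply (is_pd2_exd2 i _ x y (h x y)).
    apply (is_pd2_ext O i g); trivial; [intros; symmetry|]; auto.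
Qed.

(** * Chain rule along a graph, and a class of expressions closed under differentiation *)

Lemma is_derive_comp_2 (f f1 : R -> R -> R) f2 (a b : R -> R) t la lb :
  locally (a t, b t)
    (fun u => is_derive (fun z => f z (snd u)) (fst u) (f1 (fst u) (snd u))) ->
  is_derive (fun z => f (a t) z) (b t) f2 ->
  continuous (fun u : R * R => f1 (fst u) (snd u)) (a t, b t) ->
  is_derive a t la -> is_derive b t lb ->
  is_derive (fun s => f (a s) (b s)) t (f1 (a t) (b t) * la + f2 * lb).
Proof.
  intros H1 H2 H3 Ha Hb.
  apply is_derive_Reals, derivable_pt_lim_comp_2d; try now apply is_derive_Reals.
  apply filterdiff_differentiable_pt_lim, is_derive_filterdiff; assumption.
Qed.

Lemma filterlim_locally_pair {T : Type} {U V : UniformSpace} (F : (T -> Prop) -> Prop)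
    {FF : Filter F} (f : T -> U) (g : T -> V) a b :
  filterlim f F (locally a) -> filterlim g F (locally b) ->
  filterlim (fun t => (f t, g t)) F (locally (a, b)).
Proof.
  intros Hf Hg P [e He].
  assert (L := filter_and (F := F) (fun t => ball a e (f t)) (fun t => ball b e (g t))
    (Hf _ (locally_ball a e)) (Hg _ (locally_ball b e))).
  unfold filtermap. revert L. apply filter_imp. intros t [H1 H2]. now apply He.
Qed.

Definition emb (i : var2) : var3 := match i with v1 => u1 | v2 => u2 end.

Lemma open3_locally U x y z :
  open3 U -> U x y z ->
  locally (x, y, z) (fun p => U (fst (fst p)) (snd (fst p)) (snd p)).
Proof.
  intros HU H. destruct (HU x y z H) as [d [Hd Hb]].
  exists (mkposreal d Hd). intros [[a b] c] [[H1 H2] H3]. now apply Hb.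
Qed.

Lemma is_pd2_comp U F O w i x y :
  open3 U -> smooth3 U F -> smooth2 O w ->
  O x y -> U x y (w x y) ->
  is_pd2 i (fun x y => F x y (w x y)) x y
    (pd3 (emb i) F x y (w x y) + pd3 u3 F x y (w x y) * pd2 i w x y).
Proof.
  intros HU HF Hw Hx HUx.
  assert (L := open3_locally U x y (w x y) HU HUx).
  assert (Dw := smooth2_is_pd2 O w i x y Hw Hx).
  assert (C := smooth3_continuous U (pd3 (emb i) F) _ _ _ (smooth3_pd3 U (emb i) F HF) HUx).
  assert (D3 : is_derive (fun t => F x y t) (w x y) (pd3 u3 F x y (w x y))).
  { apply Derive_correct, (smooth3_exd3 U F u3 x y (w x y) HF HUx). }
  destruct i; simpl in *.
  (* The factor 1 is the derivative of the coordinate curve [t => t]; it gives the goal the shape of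
     the chain rule. *)
  - rewrite -(Rmult_1_r (Derive _ _)).
    apply (is_derive_comp_2 (fun a c => F a y c) (fun a c => pd3 u1 F a y c)
        (pd3 u3 F x y (w x y)) (fun t => t) (fun t => w t y) x 1); try eassumption.
    + assert (P : filterlim (fun u : R * R => (fst u, y, snd u)) (locally (x, w x y))
                      (locally (x, y, w x y))).
        { apply: filterlim_locally_pair; [apply: filterlim_locally_pair|].
          - apply: continuous_fst. - apply filterlim_const. - apply: continuous_snd. }
        specialize (P _ L). unfold filtermap in P. revert P. apply filter_imp. intros u Hu.
        apply Derive_correct, (smooth3_exd3 U F u1 _ _ _ HF Hu).
    + apply (continuous_comp (fun u : R * R => (fst u, y, snd u))
          (fun p : R * R * R => pd3 u1 F (fst (fst p)) (snd (fst p)) (snd p))); trivial.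
        apply: filterlim_locally_pair; [apply: filterlim_locally_pair|].
        -- apply: continuous_fst. -- apply filterlim_const. -- apply: continuous_snd.
    + apply: is_derive_id.
  - rewrite -(Rmult_1_r (Derive _ _)).
    apply (is_derive_comp_2 (fun b c => F x b c) (fun b c => pd3 u2 F x b c)
        (pd3 u3 F x y (w x y)) (fun t => t) (fun t => w x t) y 1); try eassumption.
    + assert (P : filterlim (fun u : R * R => (x, fst u, snd u)) (locally (y, w x y))
                      (locally (x, y, w x y))).
        { apply: filterlim_locally_pair; [apply: filterlim_locally_pair|].
          - apply filterlim_const. - apply: continuous_fst. - apply: continuous_snd. }
        specialize (P _ L). unfold filtermap in P. revert P. apply filter_imp. intros u Hu.
        apply Derive_correct, (smooth3_exd3 U F u2 _ _ _ HF Hu).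
    + apply (continuous_comp (fun u : R * R => (x, fst u, snd u))
          (fun p : R * R * R => pd3 u2 F (fst (fst p)) (snd (fst p)) (snd p))); trivial.
        apply: filterlim_locally_pair; [apply: filterlim_locally_pair|].
        -- apply filterlim_const. -- apply: continuous_fst. -- apply: continuous_snd.
    + apply: is_derive_id.
Qed.

(** A grammar for the expressions that occur, so that smoothness of a concrete formula is read off
    from its shape. [alg_comp] substitutes only graphs [(x, y, w x y)]; this is stable, because by
    the chain rule the derivative of [F x y (w x y)] is built by sums and products from terms of the
    same kinds. *)
Inductive alg (O : R -> R -> Prop) : (R -> R -> R) -> Prop :=
| alg_const c : alg O (fun _ _ => c)
| alg_fst : alg O (fun x _ => x)
| alg_snd : alg O (fun _ y => y)
| alg_smooth f : smooth2 O f -> alg O f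
| alg_comp U F w : open3 U -> smooth3 U F -> smooth2 O w ->
    (forall x y, O x y -> U x y (w x y)) -> alg O (fun x y => F x y (w x y))
| alg_plus f g : alg O f -> alg O g -> alg O (fun x y => f x y + g x y)
| alg_opp f : alg O f -> alg O (fun x y => - f x y)
| alg_mult f g : alg O f -> alg O g -> alg O (fun x y => f x y * g x y)
| alg_inv f : alg O f -> (forall x y, O x y -> f x y <> 0) ->
    alg O (fun x y => / f x y).

Lemma alg_pd2 O i f :
  alg O f -> exists g, alg O g /\ forall x y, O x y -> is_pd2 i f x y (g x y).
Proof.
  induction 1 as [c| | |f Hf|U F w HU HF Hw G|f g Hf IHf Hg IHg|f Hf IHf|f g Hf IHf Hg IHg
    |f Hf IHf N].
  - exists (fun _ _ => 0); split; [apply alg_const|]. intros; apply is_pd2_const.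
  - exists (fun _ _ => match i with v1 => 1 | v2 => 0 end); split; [apply alg_const|].
    intros; destruct i; [apply: is_derive_id | apply: is_derive_const].
  - exists (fun _ _ => match i with v1 => 0 | v2 => 1 end); split; [apply alg_const|].
    intros; destruct i; [apply: is_derive_const | apply: is_derive_id].
  - exists (pd2 i f); split; [now apply alg_smooth, smooth2_pd2|].
    intros; now apply (smooth2_is_pd2 O).
  - exists (fun x y => pd3 (emb i) F x y (w x y) + pd3 u3 F x y (w x y) * pd2 i w x y).
    split.
    + apply alg_plus; [|apply alg_mult]; [| |now apply alg_smooth, smooth2_pd2];
      apply (alg_comp O U); trivial; now apply smooth3_pd3.
    + intros x y Hx. apply (is_pd2_comp U F O); auto.
  - destruct IHf as [f' [Af Df]], IHg as [g' [Ag Dg]].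
    exists (fun x y => f' x y + g' x y); split; [now apply alg_plus|].
    intros; apply is_pd2_plus; auto.
  - destruct IHf as [f' [Af Df]].
    exists (fun x y => - f' x y); split; [now apply alg_opp|].
    intros; apply is_pd2_opp; auto.
  - destruct IHf as [f' [Af Df]], IHg as [g' [Ag Dg]].
    exists (fun x y => f' x y * g x y + f x y * g' x y); split.
    + apply alg_plus; now apply alg_mult.
    + intros; apply is_pd2_mult; auto.
  - destruct IHf as [f' [Af Df]].
    (* The derivative of the inverse is written with products of inverses to stay inside the
       grammar. *)
    exists (fun x y => (-1 * f' x y) * (/ f x y * / f x y)); split.
    + apply alg_mult; apply alg_mult; trivial; try now apply alg_inv. apply alg_const.
    + intros x y Hx. eapply is_pd2_eq; [apply is_pd2_inv; auto|]. field. auto.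
Qed.

Lemma alg_continuous O f x y :
  alg O f -> O x y -> continuous (fun p : R * R => f (fst p) (snd p)) (x, y).
Proof.
  intros H Hx.
  induction H as [c| | |f Hf|U F w HU HF Hw G|f g Hf IHf Hg IHg|f Hf IHf|f g Hf IHf Hg IHg
    |f Hf IHf N].
  - apply continuous_const.
  - apply continuous_fst.
  - apply continuous_snd.
  - now apply (smooth2_continuous O).
  - apply (continuous_comp (fun p : R * R => (fst p, snd p, w (fst p) (snd p)))
      (fun p : R * R * R => F (fst (fst p)) (snd (fst p)) (snd p))).
    + apply: filterlim_locally_pair; [apply: filterlim_locally_pair|].
    + apply continuous_fst. * apply continuous_snd.
    + now apply (smooth2_continuous O).
    + apply (smooth3_continuous U); auto.
  - apply (continuous_plus (fun p : R * R => f (fst p) (snd p))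
      (fun p : R * R => g (fst p) (snd p))); assumption.
  - apply (continuous_opp (fun p : R * R => f (fst p) (snd p))); assumption.
  - apply (continuous_mult (fun p : R * R => f (fst p) (snd p))
      (fun p : R * R => g (fst p) (snd p))); assumption.
  - apply (continuous_comp (fun p : R * R => f (fst p) (snd p)) Rinv); trivial.
    apply continuous_Rinv; simpl; auto.
Qed.

Lemma smooth2_alg O f : open2 O -> alg O f -> smooth2 O f.
Proof.
  intros HO. apply (smooth2_class O (alg O) HO). intros g Hg. split.
  - intros; now apply (alg_continuous O).
  - intros i; now apply alg_pd2.
Qed.

Lemma smooth2_differentiable O f x y :
  open2 O -> smooth2 O f -> O x y ->
  differentiable_pt_lim f x y (pd2 v1 f x y) (pd2 v2 f x y).
Proof.
  intros HO Hf Hx. apply filterdiff_differentiable_pt_lim.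
  apply (is_derive_filterdiff f x y (pd2 v1 f)).
  - generalize (open2_locally O x y HO Hx). apply filter_imp. intros u Hu.
    exact (smooth2_is_pd2 O f v1 _ _ Hf Hu).
  - exact (smooth2_is_pd2 O f v2 x y Hf Hx).
  - now apply (smooth2_continuous O); [apply smooth2_pd2|].
Qed.

(** * Differentiability of curves whose image under [(X, Y)] is a straight line *)

Lemma is_derive_intro (f : R -> R) x l :
  (forall eps, 0 < eps ->
     locally x (fun t => Rabs (f t - f x - l * (t - x)) <= eps * Rabs (t - x))) ->
  is_derive f x l.
Proof.
  intros H. apply is_derive_Reals. intros eps He.
  (* Halving [eps] turns the non-strict estimate of the hypothesis into the strict one required. *)
  destruct (H (eps / 2)) as [d Hd]; [lra|]. exists d. intros h Hh Hhd.
  assert (B : ball x d (x + h)).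
  { change (Rabs (x + h - x) < d). now replace (x + h - x) with h by ring. }
  specialize (Hd _ B). replace (x + h - x) with h in Hd by ring.
  replace ((f (x + h) - f x) / h - l) with ((f (x + h) - f x - l * h) / h) by (field; trivial).
  unfold Rdiv. rewrite Rabs_mult Rabs_inv.
  assert (P := Rabs_pos_lt h Hh).
  apply Rle_lt_trans with (eps / 2 * Rabs h * / Rabs h).
  - apply Rmult_le_compat_r; trivial. left; now apply Rinv_0_lt_compat.
  - field_simplify; lra.
Qed.

Lemma Rabs_lin_le a b u v e :
  Rabs u <= e -> Rabs v <= e -> Rabs (a * u + b * v) <= (Rabs a + Rabs b) * e.
Proof.
  intros Hu Hv. eapply Rle_trans; [apply Rabs_triang|]. rewrite !Rabs_mult Rmult_plus_distr_r.
  apply Rplus_le_compat; apply Rmult_le_compat_l; trivial; apply Rabs_pos.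
Qed.

(** The curve [(a, b)] is sent by [(X, Y)] to a line traversed with velocity [(al, be)], and
    otherwise only a Lipschitz bound at [t0] is known. That bound turns the linearisation errors of
    [X] and [Y], small against the displacement of the point, into errors small against [t - t0];
    Cramer's rule then gives both derivatives. *)
Lemma is_derive_inverse_curve X Y x y X1 X2 Y1 Y2 (a b : R -> R) t0 al be C :
  a t0 = x -> b t0 = y ->
  differentiable_pt_lim X x y X1 X2 -> differentiable_pt_lim Y x y Y1 Y2 ->
  X1 * Y2 - X2 * Y1 <> 0 ->
  locally t0 (fun t => X (a t) (b t) = X x y + al * (t - t0) /\
                       Y (a t) (b t) = Y x y + be * (t - t0) /\
                       Rabs (a t - x) + Rabs (b t - y) <= C * Rabs (t - t0)) ->
  is_derive a t0 ((Y2 * al - X2 * be) / (X1 * Y2 - X2 * Y1)) /\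
  is_derive b t0 ((X1 * be - Y1 * al) / (X1 * Y2 - X2 * Y1)).
Proof.
  intros Ea Eb HX HY HJ L. set (J := X1 * Y2 - X2 * Y1) in *.
  assert (PJ := Rabs_pos_lt J HJ).
  assert (K : forall eps, 0 < eps -> locally t0 (fun t =>
      Rabs (al * (t - t0) - (X1 * (a t - x) + X2 * (b t - y))) <= eps * Rabs (t - t0) /\
      Rabs (be * (t - t0) - (Y1 * (a t - x) + Y2 * (b t - y))) <= eps * Rabs (t - t0))).
  (* [C'] is at least 1, so dividing by it is legitimate whatever the sign of [C]. *)
  { intros eps He. pose (C' := Rmax C 1).
    assert (HC : 1 <= C') by apply Rmax_r.
    assert (HCC : C <= C') by apply Rmax_l.
    assert (Pe : 0 < eps / C') by (apply Rdiv_lt_0_compat; lra).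
    destruct (HX (mkposreal _ Pe)) as [d1 H1].
    destruct (HY (mkposreal _ Pe)) as [d2 H2]. simpl in H1, H2.
    assert (Pd : 0 < Rmin d1 d2 / C').
    { apply Rdiv_lt_0_compat; [|lra]. apply Rmin_pos; apply cond_pos. }
    assert (Ld := locally_ball t0 (mkposreal _ Pd)).
    generalize (filter_and _ _ L Ld). apply filter_imp.
    intros t [[EX [EY Lip]] Bt]. change (Rabs (t - t0) < Rmin d1 d2 / C') in Bt.
    assert (Bt' : C' * Rabs (t - t0) < Rmin d1 d2).
    { apply Rmult_lt_compat_l with (r := C') in Bt; [|lra].
      replace (C' * (Rmin d1 d2 / C')) with (Rmin d1 d2) in Bt by (field; lra). exact Bt. }
    assert (P0 := Rabs_pos (t - t0)).
    assert (CC : C * Rabs (t - t0) <= C' * Rabs (t - t0)) by (apply Rmult_le_compat_r; lra).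
    assert (Pa := Rabs_pos (a t - x)). assert (Pb := Rabs_pos (b t - y)).
    assert (M1 := Rmin_l d1 d2). assert (M2 := Rmin_r d1 d2).
    assert (Mx : eps / C' * Rmax (Rabs (a t - x)) (Rabs (b t - y)) <= eps * Rabs (t - t0)).
    { apply Rle_trans with (eps / C' * (C' * Rabs (t - t0))).
      - apply Rmult_le_compat_l; [lra|]. apply Rmax_lub; lra.
      - right. field. lra. }
    specialize (H1 (a t) (b t)). specialize (H2 (a t) (b t)).
    rewrite EX in H1. rewrite EY in H2. split.
    - eapply Rle_trans; [|apply Mx]. eapply Rle_trans; [|apply H1; lra].
      right. f_equal. ring.
    - eapply Rle_trans; [|apply Mx]. eapply Rle_trans; [|apply H2; lra].
      right. f_equal. ring. }
  (* [J] times the linearisation error of [a] or [b] is a combination of the two remainders bounded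
     in [K]; the coefficients [p], [q] are, up to sign, a row of the adjugate matrix. *)
  assert (G : forall p q (f : R -> R) l,
     (forall t, J * (f t - f t0 - l * (t - t0)) =
        p * (al * (t - t0) - (X1 * (a t - x) + X2 * (b t - y))) +
        q * (be * (t - t0) - (Y1 * (a t - x) + Y2 * (b t - y)))) ->
     is_derive f t0 l).
  { intros p q f l E. apply is_derive_intro. intros eps He.
    pose (S := Rabs p + Rabs q + 1).
    assert (PS : 0 < S) by (unfold S; generalize (Rabs_pos p) (Rabs_pos q); lra).
    assert (Pe : 0 < eps * Rabs J / S) by (apply Rdiv_lt_0_compat; [apply Rmult_lt_0_compat|]; lra).
    generalize (K _ Pe). apply filter_imp. intros t [H1 H2].
    assert (B := Rabs_lin_le p q _ _ _ H1 H2). rewrite <- E, Rabs_mult in B.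
    apply Rmult_le_reg_l with (Rabs J); [lra|]. eapply Rle_trans; [apply B|].
    apply Rle_trans with (S * (eps * Rabs J / S * Rabs (t - t0))).
    - apply Rmult_le_compat_r; [|unfold S; lra].
      apply Rmult_le_pos; [lra|apply Rabs_pos].
    - right. field. lra. }
  split.
  - apply (G (- Y2) X2). intros t. rewrite Ea. unfold J. field. exact HJ.
  - apply (G Y1 (- X1)). intros t. rewrite Eb. unfold J. field. exact HJ.
Qed.

(** * Contraction principle and mean value estimates in the plane *)

Lemma ex_lim_geometric (u : nat -> R) C :
  (forall n, Rabs (u (S n) - u n) <= C * (/ 2) ^ n) -> exists l : R, is_lim_seq u l.
Proof.
  intros H.
  assert (E : ex_series (fun n => u (S n) - u n)).
  { apply: (ex_series_le (fun n => u (S n) - u n) (fun n => C * (/ 2) ^ n)); [exact H|].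
    apply: ex_series_scal_l. exists (/ (1 - / 2)). apply is_series_geom.
    rewrite Rabs_right; lra. }
  destruct E as [s Hs]. exists (s + u O).
  apply is_lim_seq_incr_1.
  apply is_lim_seq_ext with (fun n => sum_n (fun k => u (S k) - u k) n + u O).
  - intros n. induction n as [|n IH]; [rewrite sum_O; ring|].
    rewrite sum_Sn. change plus with Rplus. rewrite <- IH. ring.
  - apply: is_lim_seq_plus'; [exact Hs|apply is_lim_seq_const].
Qed.

(** Banach's principle for the sum norm with factor one half. As the centre moves by at most
    [r / 2], no iterate leaves the ball: a point within [r] of the centre goes to distance at most
    [r / 2 + r / 2]. *)
Lemma planar_fixed_point (N1 N2 : R -> R -> R) x0 y0 r :
  0 <= r ->
  (forall x y x' y', Rabs (x - x0) + Rabs (y - y0) <= r ->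
     Rabs (x' - x0) + Rabs (y' - y0) <= r ->
     Rabs (N1 x y - N1 x' y') + Rabs (N2 x y - N2 x' y')
       <= / 2 * (Rabs (x - x') + Rabs (y - y'))) ->
  Rabs (N1 x0 y0 - x0) + Rabs (N2 x0 y0 - y0) <= r / 2 ->
  exists x y, Rabs (x - x0) + Rabs (y - y0) <= r /\ N1 x y = x /\ N2 x y = y.
Proof.
  intros Hr Hc H0.
  pose (u := fix u n := match n with O => (x0, y0)
             | S n => (N1 (fst (u n)) (snd (u n)), N2 (fst (u n)) (snd (u n))) end).
  assert (Z : Rabs (x0 - x0) + Rabs (y0 - y0) <= r) by (rewrite !Rminus_diag Rabs_R0; lra).
  assert (In : forall n, Rabs (fst (u n) - x0) + Rabs (snd (u n) - y0) <= r).
  { induction n as [|n IH]; [exact Z|]. simpl.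
    assert (A := Hc _ _ _ _ IH Z).
    assert (T1 := Rabs_triang (N1 (fst (u n)) (snd (u n)) - N1 x0 y0) (N1 x0 y0 - x0)).
    assert (T2 := Rabs_triang (N2 (fst (u n)) (snd (u n)) - N2 x0 y0) (N2 x0 y0 - y0)).
    replace (N1 (fst (u n)) (snd (u n)) - N1 x0 y0 + (N1 x0 y0 - x0))
      with (N1 (fst (u n)) (snd (u n)) - x0) in T1 by ring.
    replace (N2 (fst (u n)) (snd (u n)) - N2 x0 y0 + (N2 x0 y0 - y0))
      with (N2 (fst (u n)) (snd (u n)) - y0) in T2 by ring. lra. }
  assert (St : forall n, Rabs (fst (u (S n)) - fst (u n)) + Rabs (snd (u (S n)) - snd (u n))
                <= r / 2 * (/ 2) ^ n).
  { induction n as [|n IH]; [simpl; lra|].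
    assert (A := Hc _ _ _ _ (In (S n)) (In n)). simpl pow.
    change (fst (u (S (S n)))) with (N1 (fst (u (S n))) (snd (u (S n)))).
    change (snd (u (S (S n)))) with (N2 (fst (u (S n))) (snd (u (S n)))).
    change (fst (u (S n))) with (N1 (fst (u n)) (snd (u n))) at 2.
    change (snd (u (S n))) with (N2 (fst (u n)) (snd (u n))) at 3. lra. }
  destruct (ex_lim_geometric (fun n => fst (u n)) (r / 2)) as [x Hx].
  { intros n. generalize (St n) (Rabs_pos (snd (u (S n)) - snd (u n))). lra. }
  destruct (ex_lim_geometric (fun n => snd (u n)) (r / 2)) as [y Hy].
  { intros n. generalize (St n) (Rabs_pos (fst (u (S n)) - fst (u n))). lra. }
  assert (LA : forall (v : nat -> R) (l c : R), is_lim_seq v l ->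
             is_lim_seq (fun n => Rabs (v n - c)) (Rabs (l - c))).
  { intros v l c Hv. apply (is_lim_seq_abs (fun n => v n - c) (l - c)).
    apply: is_lim_seq_minus'; [exact Hv|apply is_lim_seq_const]. }
  assert (Ixy : Rabs (x - x0) + Rabs (y - y0) <= r).
  { apply (is_lim_seq_le (fun n => Rabs (fst (u n) - x0) + Rabs (snd (u n) - y0))
      (fun _ => r) (Rabs (x - x0) + Rabs (y - y0)) r In); [|apply is_lim_seq_const].
    apply is_lim_seq_plus'; now apply LA. }
  (* For every [n] this sequence dominates the defect of the limit [(x, y)]: the distance from its
     image to [u (S n)] is at most half the distance from [(x, y)] to [u n], and [u (S n)] tends to
     [(x, y)]. *)
  assert (B : is_lim_seq (fun n => / 2 * (Rabs (fst (u n) - x) + Rabs (snd (u n) - y))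
      + Rabs (fst (u (S n)) - x) + Rabs (snd (u (S n)) - y)) 0).
  { replace (Finite 0) with (Finite (/ 2 * (Rabs (x - x) + Rabs (y - y))
      + Rabs (x - x) + Rabs (y - y))) by (rewrite !Rminus_diag Rabs_R0; f_equal; ring).
    apply is_lim_seq_plus'; [apply is_lim_seq_plus'|].
    - apply (is_lim_seq_scal_l (fun n => Rabs (fst (u n) - x) + Rabs (snd (u n) - y)) (/ 2)
        (Rabs (x - x) + Rabs (y - y))). apply is_lim_seq_plus'; now apply LA.
    - apply (LA (fun n => fst (u (S n)))). now apply (is_lim_seq_incr_1 (fun n => fst (u n))).
    - apply (LA (fun n => snd (u (S n)))). now apply (is_lim_seq_incr_1 (fun n => snd (u n))). }
  assert (F : Rabs (N1 x y - x) + Rabs (N2 x y - y) <= 0).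
  { apply (is_lim_seq_le (fun _ => Rabs (N1 x y - x) + Rabs (N2 x y - y)) _
      (Rabs (N1 x y - x) + Rabs (N2 x y - y)) 0) with (3 := B); [|apply is_lim_seq_const].
    intros n. assert (A := Hc _ _ _ _ (In n) Ixy). simpl.
    set (p := fst (u n)) in *. set (q := snd (u n)) in *.
    assert (T1 := Rabs_triang (N1 x y - N1 p q) (N1 p q - x)).
    assert (T2 := Rabs_triang (N2 x y - N2 p q) (N2 p q - y)).
    replace (N1 x y - N1 p q + (N1 p q - x)) with (N1 x y - x) in T1 by ring.
    replace (N2 x y - N2 p q + (N2 p q - y)) with (N2 x y - y) in T2 by ring.
    rewrite (Rabs_minus_sym (N1 x y) (N1 p q)) in T1.
    rewrite (Rabs_minus_sym (N2 x y) (N2 p q)) in T2. lra. }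
  exists x, y. split; [exact Ixy|].
  assert (P1 := Rabs_pos (N1 x y - x)). assert (P2 := Rabs_pos (N2 x y - y)).
  assert (Q : forall z, Rabs z = 0 -> z = 0).
  { intros z Hz. destruct (Req_dec z 0) as [|n]; trivial. now apply Rabs_no_R0 in n. }
  split; apply Rminus_diag_uniq, Q; lra.
Qed.

Lemma increment_bound (f df : R -> R) a b c :
  (forall t, Rmin a b <= t <= Rmax a b -> is_derive f t (df t) /\ Rabs (df t) <= c) ->
  Rabs (f b - f a) <= c * Rabs (b - a).
Proof.
  intros H. destruct (MVT_gen f a b df) as [t [Ht E]].
  - intros t Ht. apply H. lra.
  - intros t Ht. apply continuity_pt_filterlim, (ex_derive_continuous f).
    exists (df t). now apply H.
  - rewrite E Rabs_mult. apply Rmult_le_compat_r; [apply Rabs_pos|]. now apply H.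
Qed.

(** The mean value theorem along two axis-parallel segments with corner [(x', y)], both inside the
    square. *)
Lemma planar_increment_bound f x0 y0 d c :
  (forall x y, Rabs (x - x0) < d -> Rabs (y - y0) < d ->
     forall i, exd2 i f x y /\ Rabs (pd2 i f x y) <= c) ->
  forall x y x' y', Rabs (x - x0) < d -> Rabs (y - y0) < d ->
    Rabs (x' - x0) < d -> Rabs (y' - y0) < d ->
    Rabs (f x y - f x' y') <= c * (Rabs (x - x') + Rabs (y - y')).
Proof.
  intros H x y x' y' Hx Hy Hx' Hy'.
  assert (B : forall a b z t, Rabs (a - z) < d -> Rabs (b - z) < d ->
            Rmin a b <= t <= Rmax a b -> Rabs (t - z) < d).
  { intros a b z t Ha Hb Ht. apply Rabs_lt_between' in Ha. apply Rabs_lt_between' in Hb.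
    apply Rabs_lt_between'. revert Ht. unfold Rmin, Rmax.
    destruct (Rle_dec a b); lra. }
  assert (E1 : Rabs (f x y - f x' y) <= c * Rabs (x - x')).
  { apply (increment_bound (fun t => f t y) (fun t => pd2 v1 f t y)). intros t Ht.
    destruct (H t y (B _ _ _ _ Hx' Hx Ht) Hy v1) as [H1 H2]. split; trivial.
    exact (exd2_is_pd2 v1 f t y H1). }
  assert (E2 : Rabs (f x' y - f x' y') <= c * Rabs (y - y')).
  { apply (increment_bound (fun t => f x' t) (fun t => pd2 v2 f x' t)). intros t Ht.
    destruct (H x' t Hx' (B _ _ _ _ Hy' Hy Ht) v2) as [H1 H2]. split; trivial.
    exact (exd2_is_pd2 v2 f x' t H1). }
  assert (T := Rabs_triang (f x y - f x' y) (f x' y - f x' y')).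
  replace (f x y - f x' y + (f x' y - f x' y')) with (f x y - f x' y') in T by ring. lra.
Qed.

(** * Local inverses in the plane *)

Definition jac2 (X Y : R -> R -> R) (x y : R) : R :=
  pd2 v1 X x y * pd2 v2 Y x y - pd2 v2 X x y * pd2 v1 Y x y.

Lemma locally_box (P : R * R -> Prop) x y :
  locally (x, y) P ->
  exists d, 0 < d /\ forall a b, Rabs (a - x) < d -> Rabs (b - y) < d -> P (a, b).
Proof.
  intros [d Hd]. exists d. split; [apply cond_pos|]. intros a b Ha Hb. apply Hd. now split.
Qed.

Lemma open2_box x0 y0 d : open2 (fun x y => Rabs (x - x0) < d /\ Rabs (y - y0) < d).
Proof.
  intros x y [Hx Hy].
  exists (Rmin (d - Rabs (x - x0)) (d - Rabs (y - y0))). split; [apply Rmin_pos; lra|].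
  intros a b Ha Hb.
  assert (M1 := Rmin_l (d - Rabs (x - x0)) (d - Rabs (y - y0))).
  assert (M2 := Rmin_r (d - Rabs (x - x0)) (d - Rabs (y - y0))).
  assert (T1 := Rabs_triang (a - x) (x - x0)). assert (T2 := Rabs_triang (b - y) (y - y0)).
  replace (a - x + (x - x0)) with (a - x0) in T1 by ring.
  replace (b - y + (y - y0)) with (b - y0) in T2 by ring. lra.
Qed.

(** Serves the simplified Newton map, whose differential vanishes at the base point by construction:
    small partial derivatives nearby make it a contraction. *)
Lemma smooth2_small_gradient O M x0 y0 c :
  open2 O -> smooth2 O M -> O x0 y0 -> (forall i, pd2 i M x0 y0 = 0) -> 0 < c ->
  exists d, 0 < d /\ forall x y, Rabs (x - x0) < d -> Rabs (y - y0) < d ->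
    O x y /\ forall i, exd2 i M x y /\ Rabs (pd2 i M x y) <= c.
Proof.
  intros HO HM H0 Z Hc.
  assert (L : forall i, locally (x0, y0)
            (fun p : R * R => Rabs (pd2 i M (fst p) (snd p)) <= c)).
  { intros i. assert (C := smooth2_continuous O _ _ _ (smooth2_pd2 O i M HM) H0).
    assert (B := locally_ball (pd2 i M x0 y0) (mkposreal c Hc)).
    specialize (C _ B). unfold filtermap in C. revert C. apply filter_imp.
    intros p Hp. change (Rabs (pd2 i M (fst p) (snd p) - pd2 i M x0 y0) < c) in Hp.
    rewrite Z Rminus_0_r in Hp. left. exact Hp. }
  destruct (locally_box _ _ _ (filter_and _ _ (open2_locally O x0 y0 HO H0)
    (filter_and _ _ (L v1) (L v2)))) as [d [Hd B]].
  exists d. split; trivial. intros x y Hx Hy. destruct (B x y Hx Hy) as [B1 [B2 B3]].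
  split; trivial. intros i. split; [|destruct i; assumption].
  exact (is_pd2_exd2 _ _ _ _ _ (smooth2_is_pd2 O M i x y HM B1)).
Qed.

(* The inverse is found by iterating the simplified Newton map
   p |-> p - L^-1 (G p - q), where L is the differential of G = (X, Y) at (x0, y0). *)
Lemma planar_inverse O X Y x0 y0 :
  open2 O -> smooth2 O X -> smooth2 O Y -> O x0 y0 -> jac2 X Y x0 y0 <> 0 ->
  exists (Ot : R -> R -> Prop) (H1 H2 : R -> R -> R) C,
    open2 Ot /\ Ot (X x0 y0) (Y x0 y0) /\
    H1 (X x0 y0) (Y x0 y0) = x0 /\ H2 (X x0 y0) (Y x0 y0) = y0 /\
    (forall s t, Ot s t -> O (H1 s t) (H2 s t) /\
       X (H1 s t) (H2 s t) = s /\ Y (H1 s t) (H2 s t) = t) /\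
    (forall s t s' t', Ot s t -> Ot s' t' ->
       Rabs (H1 s t - H1 s' t') + Rabs (H2 s t - H2 s' t')
         <= C * (Rabs (s - s') + Rabs (t - t'))).
Proof.
  intros HO HX HY H0. unfold jac2.
  set (X1 := pd2 v1 X x0 y0). set (X2 := pd2 v2 X x0 y0).
  set (Y1 := pd2 v1 Y x0 y0). set (Y2 := pd2 v2 Y x0 y0).
  set (J := X1 * Y2 - X2 * Y1). intros HJ.
  (* [M1] and [M2] are the components of [p - L^-1 (G p)]; the target [q] enters later as the added
     constant [L^-1 q]. *)
  pose (M1 := fun x y => x + (- (Y2 / J) * X x y + X2 / J * Y x y)).
  pose (M2 := fun x y => y + (Y1 / J * X x y + - (X1 / J) * Y x y)).
  assert (SM1 : smooth2 O M1).
  { apply smooth2_alg; trivial. apply alg_plus; [apply alg_fst|].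
    apply alg_plus; apply alg_mult; try apply alg_const; now apply alg_smooth. }
  assert (SM2 : smooth2 O M2).
  { apply smooth2_alg; trivial. apply alg_plus; [apply alg_snd|].
    apply alg_plus; apply alg_mult; try apply alg_const; now apply alg_smooth. }
  assert (D : forall (m : R -> R -> R) p q i l, is_pd2 i m x0 y0 l ->
     pd2 i (fun x y => m x y + (p * X x y + q * Y x y)) x0 y0 =
     l + (p * pd2 i X x0 y0 + q * pd2 i Y x0 y0)).
  { intros m p q i l Hm. apply is_pd2_unique. eapply is_pd2_eq.
    - apply is_pd2_plus; [exact Hm|]. apply is_pd2_plus; apply is_pd2_mult.
      + apply is_pd2_const. + now apply (smooth2_is_pd2 O).
      + apply is_pd2_const. + now apply (smooth2_is_pd2 O).
    - simpl. ring. }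
  (* One quarter for each component adds up to the contraction factor one half in the sum norm. *)
  destruct (smooth2_small_gradient O M1 x0 y0 (/ 4) HO SM1 H0) as [d1 [Hd1 B1]]; [|lra|].
  { intros i. unfold M1. rewrite (D _ _ _ _ (match i with v1 => 1 | v2 => 0 end)).
    - destruct i; fold X1 X2 Y1 Y2; unfold J; field; exact HJ.
    - destruct i; (apply: is_derive_id || apply: is_derive_const). }
  destruct (smooth2_small_gradient O M2 x0 y0 (/ 4) HO SM2 H0) as [d2 [Hd2 B2]]; [|lra|].
  { intros i. unfold M2. rewrite (D _ _ _ _ (match i with v1 => 0 | v2 => 1 end)).
    - destruct i; fold X1 X2 Y1 Y2; unfold J; field; exact HJ.
    - destruct i; (apply: is_derive_id || apply: is_derive_const). }
  pose (r := Rmin d1 d2 / 2).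
  assert (Hr : 0 < r) by (generalize (Rmin_pos d1 d2 Hd1 Hd2); unfold r; lra).
  assert (Hr1 : r < d1) by (unfold r; generalize (Rmin_l d1 d2); unfold r in Hr; lra).
  assert (Hr2 : r < d2) by (unfold r; generalize (Rmin_r d1 d2); unfold r in Hr; lra).
  pose (In := fun x y => Rabs (x - x0) + Rabs (y - y0) <= r).
  assert (InB : forall x y, In x y -> Rabs (x - x0) <= r /\ Rabs (y - y0) <= r).
  { intros x y H. unfold In in H. generalize (Rabs_pos (x - x0)) (Rabs_pos (y - y0)). lra. }
  assert (Con : forall x y x' y', In x y -> In x' y' ->
     Rabs (M1 x y - M1 x' y') + Rabs (M2 x y - M2 x' y')
       <= / 2 * (Rabs (x - x') + Rabs (y - y'))).
  { intros x y x' y' H H'. destruct (InB _ _ H) as [I1 I2]. destruct (InB _ _ H') as [I3 I4].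
    assert (E1 := planar_increment_bound M1 x0 y0 d1 (/ 4)
       (fun x y Hx Hy => proj2 (B1 x y Hx Hy)) x y x' y').
    assert (E2 := planar_increment_bound M2 x0 y0 d2 (/ 4)
       (fun x y Hx Hy => proj2 (B2 x y Hx Hy)) x y x' y').
    lra. }
  pose (C := (Rabs (Y2 / J) + Rabs (- (X2 / J))) + (Rabs (- (Y1 / J)) + Rabs (X1 / J)) + 1).
  assert (HC : 1 <= C).
  { unfold C. generalize (Rabs_pos (Y2 / J)) (Rabs_pos (- (X2 / J)))
      (Rabs_pos (- (Y1 / J))) (Rabs_pos (X1 / J)). lra. }
  (* [(s1, s2)] is the linear map [L^-1], and [C] bounds its norm. *)
  pose (s1 := fun s t => Y2 / J * s + - (X2 / J) * t).
  pose (s2 := fun s t => - (Y1 / J) * s + X1 / J * t).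
  assert (LB : forall s t, Rabs (s1 s t) + Rabs (s2 s t) <= C * (Rabs s + Rabs t)).
  { intros s t. unfold s1, s2, C.
    assert (P1 := Rabs_pos s). assert (P2 := Rabs_pos t).
    assert (Q1 := Rabs_lin_le (Y2 / J) (- (X2 / J)) s t (Rabs s + Rabs t)).
    assert (Q2 := Rabs_lin_le (- (Y1 / J)) (X1 / J) s t (Rabs s + Rabs t)). lra. }
  assert (M1s : forall x y, x - M1 x y = s1 (X x y) (Y x y)) by (intros; unfold M1, s1; ring).
  assert (M2s : forall x y, y - M2 x y = s2 (X x y) (Y x y)) by (intros; unfold M2, s2; ring).
  assert (Inj : forall s t s' t', s1 s t = s1 s' t' -> s2 s t = s2 s' t' -> s = s' /\ t = t').
  { intros s t s' t' E1 E2.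
    assert (A1 : X1 * s1 s t + X2 * s2 s t = s) by (unfold s1, s2, J; field; exact HJ).
    assert (A2 : Y1 * s1 s t + Y2 * s2 s t = t) by (unfold s1, s2, J; field; exact HJ).
    assert (A3 : X1 * s1 s' t' + X2 * s2 s' t' = s') by (unfold s1, s2, J; field; exact HJ).
    assert (A4 : Y1 * s1 s' t' + Y2 * s2 s' t' = t') by (unfold s1, s2, J; field; exact HJ).
    rewrite E1 E2 in A1, A2. split; congruence. }
  (* Since [p = M p + L^-1 (G p)] and [M] halves distances, two points are at most twice as far
     apart as their images under [L^-1 G]. This gives injectivity of [G] on the ball and the
     Lipschitz constant [2 * C] of the inverse. *)
  assert (Lip : forall x y x' y', In x y -> In x' y' ->
     Rabs (x - x') + Rabs (y - y')
       <= 2 * C * (Rabs (X x y - X x' y') + Rabs (Y x y - Y x' y'))).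
  { intros x y x' y' H H'. assert (Cn := Con _ _ _ _ H H').
    assert (B := LB (X x y - X x' y') (Y x y - Y x' y')).
    replace (s1 (X x y - X x' y') (Y x y - Y x' y'))
      with (s1 (X x y) (Y x y) - s1 (X x' y') (Y x' y')) in B by (unfold s1; ring).
    replace (s2 (X x y - X x' y') (Y x y - Y x' y'))
      with (s2 (X x y) (Y x y) - s2 (X x' y') (Y x' y')) in B by (unfold s2; ring).
    rewrite -!M1s -!M2s in B.
    assert (T1 := Rabs_triang (x - M1 x y - (x' - M1 x' y')) (M1 x y - M1 x' y')).
    assert (T2 := Rabs_triang (y - M2 x y - (y' - M2 x' y')) (M2 x y - M2 x' y')).
    replace (x - M1 x y - (x' - M1 x' y') + (M1 x y - M1 x' y')) with (x - x') in T1 by ring.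
    replace (y - M2 x y - (y' - M2 x' y') + (M2 x y - M2 x' y')) with (y - y') in T2 by ring.
    lra. }
  (* With this radius the Newton step from the centre has length at most [2 * C * rho = r / 2], as
     [planar_fixed_point] demands. *)
  pose (rho := r / (4 * C)).
  assert (Hrho : 0 < rho) by (apply Rdiv_lt_0_compat; lra).
  assert (Crho : 2 * C * rho = r / 2) by (unfold rho; field; lra).
  pose (Ot := fun s t => Rabs (s - X x0 y0) < rho /\ Rabs (t - Y x0 y0) < rho).
  assert (Ex : forall s t, Ot s t -> exists p : R * R, In (fst p) (snd p) /\
             X (fst p) (snd p) = s /\ Y (fst p) (snd p) = t).
  { intros s t [Hs Ht].
    destruct (planar_fixed_point (fun x y => M1 x y + s1 s t) (fun x y => M2 x y + s2 s t)
      x0 y0 r) as [x [y [Ixy [E1 E2]]]]; [lra| | |].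
    - intros x y x' y' H H'. eapply Rle_trans; [|apply (Con x y x' y' H H')].
      right. f_equal; f_equal; ring.
    - replace (M1 x0 y0 + s1 s t - x0) with (s1 (s - X x0 y0) (t - Y x0 y0)).
      2: { transitivity (s1 s t - s1 (X x0 y0) (Y x0 y0)); [unfold s1; ring|].
           rewrite -M1s. ring. }
      replace (M2 x0 y0 + s2 s t - y0) with (s2 (s - X x0 y0) (t - Y x0 y0)).
      2: { transitivity (s2 s t - s2 (X x0 y0) (Y x0 y0)); [unfold s2; ring|].
           rewrite -M2s. ring. }
      eapply Rle_trans; [apply LB|]. rewrite -Crho.
      apply Rle_trans with (C * (rho + rho)); [|right; ring].
      apply Rmult_le_compat_l; lra.
    - exists (x, y). split; [exact Ixy|]. simpl.
      apply Inj; [rewrite -M1s|rewrite -M2s]; lra. }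
  (* Existence of preimages is only propositional, so a function is selected with [epsilon]; its
     values are meaningful on [Ot] alone. *)
  pose (H := fun s t => epsilon (inhabits (x0, y0)) (fun p : R * R => In (fst p) (snd p) /\
             X (fst p) (snd p) = s /\ Y (fst p) (snd p) = t)).
  assert (HH : forall s t, Ot s t -> In (fst (H s t)) (snd (H s t)) /\
     X (fst (H s t)) (snd (H s t)) = s /\ Y (fst (H s t)) (snd (H s t)) = t).
  { intros s t Hst. exact (epsilon_spec (inhabits (x0, y0)) _ (Ex s t Hst)). }
  assert (Ot0 : Ot (X x0 y0) (Y x0 y0)) by (split; rewrite Rminus_diag Rabs_R0; exact Hrho).
  assert (LipH : forall s t s' t', Ot s t -> Ot s' t' ->
     Rabs (fst (H s t) - fst (H s' t')) + Rabs (snd (H s t) - snd (H s' t'))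
       <= 2 * C * (Rabs (s - s') + Rabs (t - t'))).
  { intros s t s' t' Hs Hs'. destruct (HH s t Hs) as [I [EX EY]].
    destruct (HH s' t' Hs') as [I' [EX' EY']].
    assert (A := Lip _ _ _ _ I I'). now rewrite EX EY EX' EY' in A. }
  exists Ot, (fun s t => fst (H s t)), (fun s t => snd (H s t)), (2 * C).
  assert (E0 : Rabs (fst (H (X x0 y0) (Y x0 y0)) - x0)
             + Rabs (snd (H (X x0 y0) (Y x0 y0)) - y0) <= 0).
  { destruct (HH _ _ Ot0) as [I [EX EY]].
    assert (I0 : In x0 y0) by (unfold In; rewrite !Rminus_diag Rabs_R0; lra).
    assert (A := Lip _ _ _ _ I I0). rewrite EX EY !Rminus_diag Rabs_R0 in A. lra. }
  assert (Q : forall a b, Rabs (a - b) <= 0 -> a = b).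
  { intros a b Hab. apply Rminus_diag_uniq.
    destruct (Req_dec (a - b) 0) as [|n]; trivial. apply Rabs_pos_lt in n. lra. }
  split; [apply open2_box|]. split; [exact Ot0|].
  assert (P1 := Rabs_pos (fst (H (X x0 y0) (Y x0 y0)) - x0)).
  assert (P2 := Rabs_pos (snd (H (X x0 y0) (Y x0 y0)) - y0)).
  split; [apply Q; lra|]. split; [apply Q; lra|]. split; [|exact LipH].
  intros s t Hst. destruct (HH s t Hst) as [I [EX EY]]. split; [|now split].
  destruct (InB _ _ I). apply B1; lra.
Qed.

(** * The equation in the transformed coordinates *)

(* The derivatives with respect to the coordinates (X, Y). *)
Definition TD (i : var2) (X Y P : R -> R -> R) : R -> R -> R := fun x y =>
  match i with
  | v1 => (pd2 v2 Y x y * pd2 v1 P x y - pd2 v1 Y x y * pd2 v2 P x y) / jac2 X Y x y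
  | v2 => (pd2 v1 X x y * pd2 v2 P x y - pd2 v2 X x y * pd2 v1 P x y) / jac2 X Y x y
  end.

Lemma alg_minus O f g : alg O f -> alg O g -> alg O (fun x y => f x y - g x y).
Proof. intros Hf Hg. apply alg_plus; [|apply alg_opp]; assumption. Qed.

Lemma alg_div O f g :
  alg O f -> alg O g -> (forall x y, O x y -> g x y <> 0) ->
  alg O (fun x y => f x y / g x y).
Proof. intros Hf Hg N. apply alg_mult; [|apply alg_inv]; assumption. Qed.

Lemma alg_partial O i f : smooth2 O f -> alg O (fun x y => pd2 i f x y).
Proof. intros H. now apply alg_smooth, smooth2_pd2. Qed.

Lemma alg_jac2 O X Y : smooth2 O X -> smooth2 O Y -> alg O (jac2 X Y).
Proof. intros HX HY. apply alg_minus; apply alg_mult; now apply alg_partial. Qed.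

Lemma smooth2_TD O i X Y P :
  open2 O -> smooth2 O X -> smooth2 O Y -> smooth2 O P ->
  (forall x y, O x y -> jac2 X Y x y <> 0) -> smooth2 O (TD i X Y P).
Proof.
  intros HO HX HY HP HJ. apply smooth2_alg; trivial.
  destruct i; apply alg_div; trivial; try (now apply alg_jac2);
  apply alg_minus; apply alg_mult; now apply alg_partial.
Qed.

Lemma smooth2_along O U F w :
  open2 O -> open3 U -> smooth3 U F -> smooth2 O w ->
  (forall x y, O x y -> U x y (w x y)) -> smooth2 O (fun x y => F x y (w x y)).
Proof. intros HO HU HF Hw G. apply smooth2_alg; trivial. now apply (alg_comp O U). Qed.

Lemma smooth2_is_derive_curve O f (a b : R -> R) t la lb :
  open2 O -> smooth2 O f -> O (a t) (b t) -> is_derive a t la -> is_derive b t lb ->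
  is_derive (fun s => f (a s) (b s)) t
    (pd2 v1 f (a t) (b t) * la + pd2 v2 f (a t) (b t) * lb).
Proof.
  intros HO Hf Ht Ha Hb. apply is_derive_Reals, derivable_pt_lim_comp_2d;
  try now apply is_derive_Reals. now apply (smooth2_differentiable O).
Qed.

Lemma open2_nonzero O f :
  open2 O -> smooth2 O f -> open2 (fun x y => O x y /\ f x y <> 0).
Proof.
  intros HO Hf x y [Hx N].
  assert (C := smooth2_continuous O f x y Hf Hx).
  specialize (C _ (locally_ball (f x y) (mkposreal _ (Rabs_pos_lt _ N)))).
  destruct (locally_box _ _ _ (filter_and _ _ (open2_locally O x y HO Hx) C)) as [d [Hd B]].
  exists d; split; trivial. intros x' y' H1 H2. destruct (B x' y' H1 H2) as [B1 B2].
  split; [exact B1|]. intros Z. unfold filtermap in B2. simpl in B2.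
  change (Rabs (f x' y' - f x y) < Rabs (f x y)) in B2.
  rewrite Z Rminus_0_l Rabs_Ropp in B2. lra.
Qed.

(** A right inverse with a Lipschitz bound. Derivatives of [H1] and [H2] are left out on purpose:
    they follow from these two properties, by [is_pd2_inverse]. *)
Definition is_local_inverse (O Ot : R -> R -> Prop) (X Y H1 H2 : R -> R -> R) C : Prop :=
  (forall s t, Ot s t -> O (H1 s t) (H2 s t) /\
     X (H1 s t) (H2 s t) = s /\ Y (H1 s t) (H2 s t) = t) /\
  (forall s t s' t', Ot s t -> Ot s' t' ->
     Rabs (H1 s t - H1 s' t') + Rabs (H2 s t - H2 s' t')
       <= C * (Rabs (s - s') + Rabs (t - t'))).

(** A coordinate line of the [(s, t)]-plane is pulled back to a curve to which
    [is_derive_inverse_curve] applies, with velocity [(1, 0)] or [(0, 1)]; the chain rule for [P]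
    then yields the operator [TD]. *)
Lemma is_pd2_inverse O Ot X Y H1 H2 C P i s t :
  open2 O -> open2 Ot -> smooth2 O X -> smooth2 O Y -> smooth2 O P ->
  (forall x y, O x y -> jac2 X Y x y <> 0) ->
  is_local_inverse O Ot X Y H1 H2 C -> Ot s t ->
  is_pd2 i (fun s t => P (H1 s t) (H2 s t)) s t (TD i X Y P (H1 s t) (H2 s t)).
Proof.
  intros HO HOt HX HY HP HJ [HI HL] Hst. destruct (HI s t Hst) as [Hp [EX EY]].
  assert (DX := smooth2_differentiable O X _ _ HO HX Hp).
  assert (DY := smooth2_differentiable O Y _ _ HO HY Hp).
  assert (NJ := HJ _ _ Hp). unfold jac2 in NJ.
  destruct i.
  - destruct (is_derive_inverse_curve X Y (H1 s t) (H2 s t) _ _ _ _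
      (fun u => H1 u t) (fun u => H2 u t) s 1 0 C eq_refl eq_refl DX DY NJ) as [D1 D2].
    + generalize (open2_locally_l Ot s t HOt Hst). apply filter_imp. intros u Hu.
      destruct (HI u t Hu) as [_ [-> ->]]. rewrite EX EY.
      split; [|split]; [apply Rminus_diag_uniq; ring|apply Rminus_diag_uniq; ring|].
      generalize (HL u t s t Hu Hst). now rewrite (Rminus_diag t) Rabs_R0 Rplus_0_r.
    + eapply is_pd2_eq.
      * exact (smooth2_is_derive_curve O P (fun u => H1 u t) (fun u => H2 u t) s _ _
          HO HP Hp D1 D2).
      * simpl. unfold jac2. simpl. simpl in NJ. field. exact NJ.
  - destruct (is_derive_inverse_curve X Y (H1 s t) (H2 s t) _ _ _ _
      (fun u => H1 s u) (fun u => H2 s u) t 0 1 C eq_refl eq_refl DX DY NJ) as [D1 D2].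
    + generalize (open2_locally_r Ot s t HOt Hst). apply filter_imp. intros u Hu.
      destruct (HI s u Hu) as [_ [-> ->]]. rewrite EX EY.
      split; [|split]; [apply Rminus_diag_uniq; ring|apply Rminus_diag_uniq; ring|].
      generalize (HL s u s t Hu Hst). now rewrite (Rminus_diag s) Rabs_R0 Rplus_0_l.
    + eapply is_pd2_eq.
      * exact (smooth2_is_derive_curve O P (fun u => H1 s u) (fun u => H2 s u) t _ _
          HO HP Hp D1 D2).
      * simpl. unfold jac2. simpl. simpl in NJ. field. exact NJ.
Qed.

Lemma lipschitz_continuous (Ot : R -> R -> Prop) (H : R -> R -> R) C s t :
  open2 Ot -> Ot s t ->
  (forall s' t', Ot s' t' ->
     Rabs (H s' t' - H s t) <= C * (Rabs (s' - s) + Rabs (t' - t))) ->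
  continuous (fun p : R * R => H (fst p) (snd p)) (s, t).
Proof.
  intros HO Hst HL P [e He].
  pose (C' := Rmax C 1). assert (HC : 1 <= C') by apply Rmax_r.
  assert (HCC : C <= C') by apply Rmax_l. assert (Pe := cond_pos e).
  assert (Pd : 0 < e / (2 * C')) by (apply Rdiv_lt_0_compat; lra).
  unfold filtermap.
  generalize (filter_and _ _ (open2_locally Ot s t HO Hst)
    (locally_ball (s, t) (mkposreal _ Pd))).
  apply filter_imp. intros [s' t'] [Ht [B1 B2]]. apply He.
  change (Rabs (s' - s) < e / (2 * C')) in B1. change (Rabs (t' - t) < e / (2 * C')) in B2.
  simpl in Ht. change (Rabs (H s' t' - H s t) < e).
  eapply Rle_lt_trans; [now apply HL|].
  apply Rle_lt_trans with (C' * (Rabs (s' - s) + Rabs (t' - t))).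
  - apply Rmult_le_compat_r; trivial.
    generalize (Rabs_pos (s' - s)) (Rabs_pos (t' - t)); lra.
  - replace (pos e) with (C' * (e / (2 * C') + e / (2 * C'))) by (field; lra).
    apply Rmult_lt_compat_l; lra.
Qed.

(** Bootstrapping: the smooth functions on [O] composed with the inverse form a class closed under
    differentiation, since the derivative of [P] composed with the inverse is [TD i X Y P] composed
    with the inverse. *)
Lemma smooth2_inverse O Ot X Y H1 H2 C P :
  open2 O -> open2 Ot -> smooth2 O X -> smooth2 O Y -> smooth2 O P ->
  (forall x y, O x y -> jac2 X Y x y <> 0) ->
  is_local_inverse O Ot X Y H1 H2 C ->
  smooth2 Ot (fun s t => P (H1 s t) (H2 s t)).
Proof.
  intros HO HOt HX HY HP HJ HI.
  apply (smooth2_class Ot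
    (fun f => exists P, smooth2 O P /\ f = fun s t => P (H1 s t) (H2 s t))); trivial.
  - intros f [Q [HQ ->]]. split.
    + intros s t Hst. destruct HI as [HI HL]. destruct (HI s t Hst) as [Hp _].
      apply (continuous_comp (fun p : R * R => (H1 (fst p) (snd p), H2 (fst p) (snd p)))
        (fun p : R * R => Q (fst p) (snd p))).
      * apply: filterlim_locally_pair.
        -- apply: (lipschitz_continuous Ot H1 C s t HOt Hst). intros s' t' Hs'.
           generalize (HL s' t' s t Hs' Hst) (Rabs_pos (H2 s' t' - H2 s t)). lra.
        -- apply: (lipschitz_continuous Ot H2 C s t HOt Hst). intros s' t' Hs'.
           generalize (HL s' t' s t Hs' Hst) (Rabs_pos (H1 s' t' - H1 s t)). lra.
      * exact (smooth2_continuous O Q _ _ HQ Hp).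
    + intros i. exists (fun s t => TD i X Y Q (H1 s t) (H2 s t)). split.
      * exists (TD i X Y Q). split; trivial. now apply smooth2_TD.
      * intros s t Hst. now apply (is_pd2_inverse O Ot X Y H1 H2 C).
  - now exists P.
Qed.

Lemma is_solution_subset (O O' : R -> R -> Prop) w :
  open2 O' -> (forall x y, O' x y -> O x y) -> is_solution O w -> is_solution O' w.
Proof.
  intros HO' S [HO [Hw E]]. split; [|split]; trivial.
  - now apply (smooth2_subset O).
  - intros x y Hx. now apply E, S.
Qed.

(** Near the point the image of the graph of [w] is the graph of [Z] composed with the local inverse
    of [(X, Y)]. The symmetry makes this function a solution, and its partial derivatives are
    obtained by applying [TD] to [Z]. *)
Lemma transformed_equation U F1 F2 F3 O w x y :
  open3 U -> smooth3 U F1 -> smooth3 U F2 -> smooth3 U F3 ->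
  preserves_solutions U F1 F2 F3 ->
  is_solution O w -> (forall x y, O x y -> U x y (w x y)) -> O x y ->
  let X := fun x y => F1 x y (w x y) in
  let Y := fun x y => F2 x y (w x y) in
  let Z := fun x y => F3 x y (w x y) in
  jac2 X Y x y <> 0 ->
  TD v1 X Y (TD v2 X Y (TD v2 X Y Z)) x y
  + TD v2 X Y (TD v2 X Y Z) x y * TD v2 X Y (TD v2 X Y (TD v2 X Y Z)) x y = 0.
Proof.
  intros HU S1 S2 S3 HP HS G Hx X Y Z NJ.
  destruct HS as [HO [Hw Ew]].
  assert (SX : smooth2 O X) by now apply (smooth2_along O U).
  assert (SY : smooth2 O Y) by now apply (smooth2_along O U).
  assert (SZ : smooth2 O Z) by now apply (smooth2_along O U).
  (* On the locus of nonzero Jacobian [TD] maps smooth functions to smooth functions. *)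
  pose (O' := fun x y => O x y /\ jac2 X Y x y <> 0).
  assert (HO' : open2 O') by (apply open2_nonzero; trivial; apply smooth2_alg; trivial;
    now apply alg_jac2).
  assert (Sub : forall x y, O' x y -> O x y) by now intros ? ? [].
  assert (HJ : forall x y, O' x y -> jac2 X Y x y <> 0) by now intros ? ? [].
  apply (smooth2_subset _ _ _ Sub) in SX, SY, SZ.
  destruct (planar_inverse O' X Y x y HO' SX SY (conj Hx NJ) NJ)
    as [Ot [H1 [H2 [C [HOt [Ot0 [E1 [E2 [HI HL]]]]]]]]].
  assert (LI : is_local_inverse O' Ot X Y H1 H2 C) by now split.
  assert (Sol : is_solution Ot (fun s t => Z (H1 s t) (H2 s t))).
  { apply (HP O' w); trivial.
    - now apply (is_solution_subset O).
    - intros a b Hab. now apply G, Sub.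
    - now apply (smooth2_inverse O' Ot X Y H1 H2 C).
    - intros s t Hst. destruct (HI s t Hst) as [Hp [EX EY]].
      exists (H1 s t), (H2 s t). exact (conj Hp (conj EX (conj EY eq_refl))). }
  destruct Sol as [_ [_ E]]. specialize (E _ _ Ot0).
  assert (D : forall i P, smooth2 O' P -> forall s t, Ot s t ->
     pd2 i (fun s t => P (H1 s t) (H2 s t)) s t = TD i X Y P (H1 s t) (H2 s t)).
  { intros i P SP s t Hst. now apply is_pd2_unique, (is_pd2_inverse O' Ot X Y H1 H2 C). }
  assert (ST2 : smooth2 O' (TD v2 X Y Z)) by now apply smooth2_TD.
  assert (ST22 : smooth2 O' (TD v2 X Y (TD v2 X Y Z))) by now apply smooth2_TD.
  assert (E22 : forall s t, Ot s t ->
     pd2 v2 (pd2 v2 (fun s t => Z (H1 s t) (H2 s t))) s t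
       = TD v2 X Y (TD v2 X Y Z) (H1 s t) (H2 s t)).
  { intros s t Hst. rewrite (pd2_ext Ot v2 _ _ s t HOt Hst (D v2 Z SZ)). now apply D. }
  pose (W := fun s t => Z (H1 s t) (H2 s t)).
  change (pd2 v1 (pd2 v2 (pd2 v2 W)) (X x y) (Y x y) + pd2 v2 (pd2 v2 W) (X x y) (Y x y) *
    pd2 v2 (pd2 v2 (pd2 v2 W)) (X x y) (Y x y) = 0) in E. unfold W in E.
  rewrite (pd2_ext Ot v1 _ _ _ _ HOt Ot0 E22) in E.
  rewrite (pd2_ext Ot v2 _ _ _ _ HOt Ot0 E22) in E.
  rewrite (E22 _ _ Ot0) !(D _ _ ST22 _ _ Ot0) E1 E2 in E. exact E.
Qed.

(** * Comparison of solutions with the same 2-jet *)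

Lemma smooth2_mult O f g :
  open2 O -> smooth2 O f -> smooth2 O g -> smooth2 O (fun x y => f x y * g x y).
Proof. intros; apply smooth2_alg, alg_mult; trivial; now apply alg_smooth. Qed.

Lemma pd2_plus O f g i x y :
  smooth2 O f -> smooth2 O g -> O x y ->
  pd2 i (fun x y => f x y + g x y) x y = pd2 i f x y + pd2 i g x y.
Proof. intros Hf Hg Hx. apply is_pd2_unique, is_pd2_plus; now apply (smooth2_is_pd2 O). Qed.

Lemma pd2_mult O f g i x y :
  smooth2 O f -> smooth2 O g -> O x y ->
  pd2 i (fun x y => f x y * g x y) x y = pd2 i f x y * g x y + f x y * pd2 i g x y.
Proof. intros Hf Hg Hx. apply is_pd2_unique, is_pd2_mult; now apply (smooth2_is_pd2 O). Qed.

Lemma pd2_pd2_plus O f g i j x y :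
  open2 O -> smooth2 O f -> smooth2 O g -> O x y ->
  pd2 j (pd2 i (fun x y => f x y + g x y)) x y = pd2 j (pd2 i f) x y + pd2 j (pd2 i g) x y.
Proof.
  intros HO Hf Hg Hx.
  rewrite (pd2_ext O j _ (fun x y => pd2 i f x y + pd2 i g x y) x y HO Hx).
  - now apply (pd2_plus O); try apply smooth2_pd2.
  - intros a b Hab. now apply (pd2_plus O).
Qed.

Lemma pd2_pd2_mult O f g i j x y :
  open2 O -> smooth2 O f -> smooth2 O g -> O x y ->
  pd2 j (pd2 i (fun x y => f x y * g x y)) x y =
    pd2 j (pd2 i f) x y * g x y + pd2 i f x y * pd2 j g x y
    + pd2 j f x y * pd2 i g x y + f x y * pd2 j (pd2 i g) x y.
Proof.
  intros HO Hf Hg Hx.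
  assert (Hf' := smooth2_pd2 O i f Hf). assert (Hg' := smooth2_pd2 O i g Hg).
  rewrite (pd2_ext O j _ (fun x y => pd2 i f x y * g x y + f x y * pd2 i g x y) x y HO Hx).
  - rewrite (pd2_plus O (fun x y => pd2 i f x y * g x y) (fun x y => f x y * pd2 i g x y));
      trivial; try now apply smooth2_mult.
    rewrite (pd2_mult O (pd2 i f) g) // (pd2_mult O f (pd2 i g)) //. ring.
  - intros a b Hab. now apply (pd2_mult O).
Qed.

Definition same_jet1 (f f' : R -> R -> R) (x y : R) : Prop :=
  f x y = f' x y /\ forall i, pd2 i f x y = pd2 i f' x y.

(** All ordered pairs of indices are recorded, so a mixed derivative can be rewritten in whichever
    order a computation produces it. *)
Definition same_jet2 (f f' : R -> R -> R) (x y : R) : Prop :=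
  same_jet1 f f' x y /\ forall i j, pd2 j (pd2 i f) x y = pd2 j (pd2 i f') x y.

Definition graph_in (U : R -> R -> R -> Prop) (O : R -> R -> Prop) (w : R -> R -> R) : Prop :=
  open2 O /\ open3 U /\ smooth2 O w /\ forall x y, O x y -> U x y (w x y).

Lemma pd2_along U F O w i x y :
  graph_in U O w -> smooth3 U F -> O x y ->
  pd2 i (fun x y => F x y (w x y)) x y =
    pd3 (emb i) F x y (w x y) + pd3 u3 F x y (w x y) * pd2 i w x y.
Proof.
  intros [HO [HU [Hw G]]] HF Hx. apply is_pd2_unique, (is_pd2_comp U F O); auto.
Qed.

Lemma smooth2_graph U F O w :
  graph_in U O w -> smooth3 U F -> smooth2 O (fun x y => F x y (w x y)).
Proof. intros [HO [HU [Hw G]]] HF. now apply (smooth2_along O U). Qed.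

Lemma same_jet1_along U F O w w' x y :
  graph_in U O w -> graph_in U O w' -> smooth3 U F -> O x y ->
  same_jet1 w w' x y ->
  same_jet1 (fun x y => F x y (w x y)) (fun x y => F x y (w' x y)) x y.
Proof.
  intros Hw Hw' HF Hx [E0 E1]. split; [now rewrite E0|]. intros i.
  rewrite (pd2_along U F O w) // (pd2_along U F O w') // E0 E1 //.
Qed.

Lemma pd2_pd2_along U F O w i j x y :
  graph_in U O w -> smooth3 U F -> O x y ->
  pd2 j (pd2 i (fun x y => F x y (w x y))) x y =
    pd2 j (fun x y => pd3 (emb i) F x y (w x y)) x y
    + pd2 j (fun x y => pd3 u3 F x y (w x y)) x y * pd2 i w x y
    + pd3 u3 F x y (w x y) * pd2 j (pd2 i w) x y.
Proof.
  intros Hw HF Hx. assert (HO := proj1 Hw).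
  assert (SA := smooth2_graph U _ O w Hw (smooth3_pd3 U (emb i) F HF)).
  assert (SB := smooth2_graph U _ O w Hw (smooth3_pd3 U u3 F HF)).
  assert (SC : smooth2 O (pd2 i w)) by (apply smooth2_pd2; apply Hw).
  rewrite (pd2_ext O j _ _ x y HO Hx (fun a b H => pd2_along U F O w i a b Hw HF H)).
  rewrite (pd2_plus O (fun x y => pd3 (emb i) F x y (w x y))
    (fun x y => pd3 u3 F x y (w x y) * pd2 i w x y)) //; [|now apply smooth2_mult].
  rewrite (pd2_mult O (fun x y => pd3 u3 F x y (w x y)) (pd2 i w)) //. ring.
Qed.

Lemma same_jet2_along U F O w w' x y :
  graph_in U O w -> graph_in U O w' -> smooth3 U F -> O x y ->
  same_jet2 w w' x y ->
  same_jet2 (fun x y => F x y (w x y)) (fun x y => F x y (w' x y)) x y.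
Proof.
  intros Hw Hw' HF Hx [E1 E2]. split; [now apply (same_jet1_along U F O)|].
  intros i j. rewrite (pd2_pd2_along U F O w) // (pd2_pd2_along U F O w') // E2.
  destruct E1 as [E0 E1].
  destruct (same_jet1_along U _ O w w' x y Hw Hw' (smooth3_pd3 U (emb i) F HF) Hx) as [_ A];
    [now split|].
  destruct (same_jet1_along U _ O w w' x y Hw Hw' (smooth3_pd3 U u3 F HF) Hx) as [_ B];
    [now split|].
  rewrite A B E0 E1 //.
Qed.

Definition delta3 (f f' : R -> R -> R) (l j i : var2) (x y : R) : R :=
  pd2 l (pd2 j (pd2 i f')) x y - pd2 l (pd2 j (pd2 i f)) x y.

(** A third derivative of [F x y (w x y)] contains third derivatives of [w] only in the term with
    factor [F_w]; everything else is determined by the 2-jet and cancels in the difference. *)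
Lemma delta3_along U F O w w' l j i x y :
  graph_in U O w -> graph_in U O w' -> smooth3 U F -> O x y ->
  same_jet2 w w' x y ->
  delta3 (fun x y => F x y (w x y)) (fun x y => F x y (w' x y)) l j i x y =
    pd3 u3 F x y (w x y) * delta3 w w' l j i x y.
Proof.
  intros Hw Hw' HF Hx E. assert (HO := proj1 Hw).
  assert (D : forall v, graph_in U O v ->
    pd2 l (pd2 j (pd2 i (fun x y => F x y (v x y)))) x y =
    pd2 l (pd2 j (fun x y => pd3 (emb i) F x y (v x y))) x y
    + (pd2 l (pd2 j (fun x y => pd3 u3 F x y (v x y))) x y * pd2 i v x y
       + pd2 j (fun x y => pd3 u3 F x y (v x y)) x y * pd2 l (pd2 i v) x y
       + pd2 l (fun x y => pd3 u3 F x y (v x y)) x y * pd2 j (pd2 i v) x y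
       + pd3 u3 F x y (v x y) * pd2 l (pd2 j (pd2 i v)) x y)).
  { intros v Hv.
    assert (SA := smooth2_graph U _ O v Hv (smooth3_pd3 U (emb i) F HF)).
    assert (SB := smooth2_graph U _ O v Hv (smooth3_pd3 U u3 F HF)).
    assert (SC : smooth2 O (pd2 i v)) by (apply smooth2_pd2; apply Hv).
    transitivity (pd2 l (pd2 j (fun x y => pd3 (emb i) F x y (v x y)
      + pd3 u3 F x y (v x y) * pd2 i v x y)) x y).
    - apply (pd2_ext O); trivial. intros a b Hab. apply (pd2_ext O); trivial.
      intros c d Hcd. now apply (pd2_along U F O v).
    - rewrite (pd2_pd2_plus O (fun x y => pd3 (emb i) F x y (v x y))
        (fun x y => pd3 u3 F x y (v x y) * pd2 i v x y)) //; [|now apply smooth2_mult].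
      rewrite (pd2_pd2_mult O (fun x y => pd3 u3 F x y (v x y)) (pd2 i v)) //. }
  unfold delta3. rewrite (D w Hw) (D w' Hw').
  destruct (same_jet2_along U _ O w w' x y Hw Hw' (smooth3_pd3 U (emb i) F HF) Hx E)
    as [[_ A1] A2].
  destruct (same_jet2_along U _ O w w' x y Hw Hw' (smooth3_pd3 U u3 F HF) Hx E)
    as [[_ B1] B2].
  destruct E as [[E0 E1] E2]. rewrite A2 B2 !B1 E0 !E1 !E2. ring.
Qed.

(** * Jets in the coordinates [(X, Y)] and the jump of the transformed equation *)

Definition nondegenerate (O : R -> R -> Prop) (X Y : R -> R -> R) : Prop :=
  open2 O /\ smooth2 O X /\ smooth2 O Y /\ forall x y, O x y -> jac2 X Y x y <> 0.

(** The identity [dP = P_X dX + P_Y dY], that is, the definition of [TD] solved for the original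
    derivatives. In this form it can be differentiated again without quotients. *)
Lemma pd2_TD O X Y P i x y :
  nondegenerate O X Y -> O x y ->
  pd2 i P x y = TD v1 X Y P x y * pd2 i X x y + TD v2 X Y P x y * pd2 i Y x y.
Proof.
  intros [_ [_ [_ N]]] Hx. specialize (N x y Hx). unfold TD, jac2 in *.
  destruct i; field; exact N.
Qed.

Lemma smooth2_nondegenerate_TD O X Y P i :
  nondegenerate O X Y -> smooth2 O P -> smooth2 O (TD i X Y P).
Proof. intros [HO [HX [HY N]]] HP. now apply smooth2_TD. Qed.

Lemma pd2_pd2_TD O X Y P i j x y :
  nondegenerate O X Y -> smooth2 O P -> O x y ->
  let k := TD v1 X Y P in let h := TD v2 X Y P in
  pd2 j (pd2 i P) x y =
    pd2 j k x y * pd2 i X x y + k x y * pd2 j (pd2 i X) x y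
    + (pd2 j h x y * pd2 i Y x y + h x y * pd2 j (pd2 i Y) x y).
Proof.
  intros N HP Hx k h.
  assert (Sk : smooth2 O k) by now apply smooth2_nondegenerate_TD.
  assert (Sh : smooth2 O h) by now apply smooth2_nondegenerate_TD.
  assert (E := fun a b H => pd2_TD O X Y P i a b N H).
  destruct N as [HO [HX [HY _]]].
  apply (smooth2_pd2 O i) in HX. apply (smooth2_pd2 O i) in HY.
  rewrite (pd2_ext O j _ _ x y HO Hx E).
  rewrite (pd2_plus O (fun x y => k x y * pd2 i X x y) (fun x y => h x y * pd2 i Y x y)) //;
    try now apply smooth2_mult.
  rewrite (pd2_mult O k (pd2 i X)) // (pd2_mult O h (pd2 i Y)) //.
Qed.

Lemma pd2_pd2_pd2_TD O X Y P i j l x y :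
  nondegenerate O X Y -> smooth2 O P -> O x y ->
  let k := TD v1 X Y P in let h := TD v2 X Y P in
  pd2 l (pd2 j (pd2 i P)) x y =
    pd2 l (pd2 j k) x y * pd2 i X x y + pd2 j k x y * pd2 l (pd2 i X) x y
    + pd2 l k x y * pd2 j (pd2 i X) x y + k x y * pd2 l (pd2 j (pd2 i X)) x y
    + (pd2 l (pd2 j h) x y * pd2 i Y x y + pd2 j h x y * pd2 l (pd2 i Y) x y
    + pd2 l h x y * pd2 j (pd2 i Y) x y + h x y * pd2 l (pd2 j (pd2 i Y)) x y).
Proof.
  intros N HP Hx k h.
  assert (Sk : smooth2 O k) by now apply smooth2_nondegenerate_TD.
  assert (Sh : smooth2 O h) by now apply smooth2_nondegenerate_TD.
  assert (E := fun a b H => pd2_TD O X Y P i a b N H).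
  destruct N as [HO [HX [HY _]]].
  apply (smooth2_pd2 O i) in HX. apply (smooth2_pd2 O i) in HY.
  transitivity (pd2 l (pd2 j (fun x y => k x y * pd2 i X x y + h x y * pd2 i Y x y)) x y).
  - apply (pd2_ext O); trivial. intros a b Hab. now apply (pd2_ext O).
  - rewrite (pd2_pd2_plus O (fun x y => k x y * pd2 i X x y) (fun x y => h x y * pd2 i Y x y)) //;
      try now apply smooth2_mult.
    rewrite (pd2_pd2_mult O k (pd2 i X)) // (pd2_pd2_mult O h (pd2 i Y)) //.
Qed.

Lemma solve_2x2 a b c d p q :
  a * d - b * c <> 0 -> p * a + q * c = 0 -> p * b + q * d = 0 -> p = 0 /\ q = 0.
Proof.
  intros H E1 E2.
  assert (P : (a * d - b * c) * p = 0).
  { transitivity (d * (p * a + q * c) - c * (p * b + q * d)); [ring|]. rewrite E1 E2; ring. }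
  assert (Q : (a * d - b * c) * q = 0).
  { transitivity (a * (p * b + q * d) - b * (p * a + q * c)); [ring|]. rewrite E1 E2; ring. }
  apply Rmult_integral in P. apply Rmult_integral in Q. tauto.
Qed.

(** Differentiating [P_i = k X_i + h Y_i] in direction [j] gives two linear equations for the
    derivatives of [k] and [h], with determinant [jac2] and data from the 2-jets; both sides of the
    comparison solve the same system. *)
Lemma same_jet1_TD O X Y P X' Y' P' x y :
  nondegenerate O X Y -> nondegenerate O X' Y' -> smooth2 O P -> smooth2 O P' -> O x y ->
  same_jet2 X X' x y -> same_jet2 Y Y' x y -> same_jet2 P P' x y ->
  forall i, same_jet1 (TD i X Y P) (TD i X' Y' P') x y.
Proof.
  intros N N' HP HP' Hx [[_ X1] X2] [[_ Y1] Y2] [[_ P1] P2].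
  assert (V : forall i, TD i X Y P x y = TD i X' Y' P' x y).
  { intros i. unfold TD, jac2. now rewrite !X1 !Y1 !P1. }
  assert (D : forall j,
     pd2 j (TD v1 X Y P) x y = pd2 j (TD v1 X' Y' P') x y /\
     pd2 j (TD v2 X Y P) x y = pd2 j (TD v2 X' Y' P') x y).
  { intros j.
    assert (E : forall i, (pd2 j (TD v1 X Y P) x y - pd2 j (TD v1 X' Y' P') x y) * pd2 i X x y
      + (pd2 j (TD v2 X Y P) x y - pd2 j (TD v2 X' Y' P') x y) * pd2 i Y x y = 0).
    { intros i. assert (A := pd2_pd2_TD O X Y P i j x y N HP Hx).
      assert (A' := pd2_pd2_TD O X' Y' P' i j x y N' HP' Hx). cbv zeta in A, A'.
      rewrite -P2 -X1 -Y1 -X2 -Y2 -!V in A'. lra. }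
    destruct (solve_2x2 _ _ _ _ _ _ (proj2 (proj2 (proj2 N)) x y Hx) (E v1) (E v2)).
    split; lra. }
  intros i. split; trivial. intros j. destruct i; apply D.
Qed.

(** The identity [P_i = k X_i + h Y_i] differentiated twice. By [same_jet1_TD] the lower terms
    agree, so only jumps of third derivatives of [P], [X], [Y] and of second derivatives of [k], [h]
    survive. *)
Lemma delta3_TD O X Y P X' Y' P' l j i x y :
  nondegenerate O X Y -> nondegenerate O X' Y' -> smooth2 O P -> smooth2 O P' -> O x y ->
  same_jet2 X X' x y -> same_jet2 Y Y' x y -> same_jet2 P P' x y ->
  delta3 P P' l j i x y - TD v1 X Y P x y * delta3 X X' l j i x y
    - TD v2 X Y P x y * delta3 Y Y' l j i x y =
  (pd2 l (pd2 j (TD v1 X' Y' P')) x y - pd2 l (pd2 j (TD v1 X Y P)) x y) * pd2 i X x y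
  + (pd2 l (pd2 j (TD v2 X' Y' P')) x y - pd2 l (pd2 j (TD v2 X Y P)) x y) * pd2 i Y x y.
Proof.
  intros N N' HP HP' Hx EX EY EP.
  assert (T := same_jet1_TD O X Y P X' Y' P' x y N N' HP HP' Hx EX EY EP).
  destruct (T v1) as [K0 K1], (T v2) as [H0 H1].
  destruct EX as [[_ X1] X2], EY as [[_ Y1] Y2], EP as [[_ P1] P2].
  assert (A := pd2_pd2_pd2_TD O X Y P i j l x y N HP Hx).
  assert (A' := pd2_pd2_pd2_TD O X' Y' P' i j l x y N' HP' Hx). cbv zeta in A, A'.
  rewrite -X1 -Y1 -!X2 -!Y2 -!K1 -!H1 -K0 -H0 in A'. unfold delta3. rewrite A A'. ring.
Qed.

(** One order below [delta3_TD], for use with [P = TD v2 X Y Z], of which only the 1-jet is known to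
    be shared. *)
Lemma delta2_TD O X Y P X' Y' P' j i x y :
  nondegenerate O X Y -> nondegenerate O X' Y' -> smooth2 O P -> smooth2 O P' -> O x y ->
  same_jet2 X X' x y -> same_jet2 Y Y' x y -> same_jet1 P P' x y ->
  pd2 j (pd2 i P') x y - pd2 j (pd2 i P) x y =
  (pd2 j (TD v1 X' Y' P') x y - pd2 j (TD v1 X Y P) x y) * pd2 i X x y
  + (pd2 j (TD v2 X' Y' P') x y - pd2 j (TD v2 X Y P) x y) * pd2 i Y x y.
Proof.
  intros N N' HP HP' Hx [[_ X1] X2] [[_ Y1] Y2] [_ P1].
  assert (V : forall i, TD i X Y P x y = TD i X' Y' P' x y).
  { intros a. unfold TD, jac2. now rewrite !X1 !Y1 !P1. }
  assert (A := pd2_pd2_TD O X Y P i j x y N HP Hx).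
  assert (A' := pd2_pd2_TD O X' Y' P' i j x y N' HP' Hx). cbv zeta in A, A'.
  rewrite -X1 -Y1 -!X2 -!Y2 -!V in A'. rewrite A A'. ring.
Qed.

(** Column operations turn the first two columns of the Jacobian matrix into total derivatives along
    the graph; subtracting [Z_X] and [Z_Y] times the first two rows from the third then leaves a
    single entry there. For a point transformation that entry is nonzero; it is the factor [nu] by
    which jumps are multiplied below. *)
Lemma jac3_along U F1 F2 F3 O w x y :
  graph_in U O w -> smooth3 U F1 -> smooth3 U F2 -> smooth3 U F3 -> O x y ->
  let X := fun x y => F1 x y (w x y) in
  let Y := fun x y => F2 x y (w x y) in
  let Z := fun x y => F3 x y (w x y) in
  jac2 X Y x y <> 0 ->
  jac3 F1 F2 F3 x y (w x y) = jac2 X Y x y *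
    (pd3 u3 F3 x y (w x y) - TD v1 X Y Z x y * pd3 u3 F1 x y (w x y)
     - TD v2 X Y Z x y * pd3 u3 F2 x y (w x y)).
Proof.
  intros Hw S1 S2 S3 Hx X Y Z NJ.
  assert (EX := fun i => pd2_along U F1 O w i x y Hw S1 Hx). fold X in EX.
  assert (EY := fun i => pd2_along U F2 O w i x y Hw S2 Hx). fold Y in EY.
  assert (EZ := fun i => pd2_along U F3 O w i x y Hw S3 Hx). fold Z in EZ.
  unfold jac3, TD. unfold jac2 in *. rewrite !EX !EY in NJ. rewrite !EX !EY !EZ.
  cbv [emb] in *. field. exact NJ.
Qed.

(** The operator [d/dX + g d/dY] equals [((Y2 - g X2) d/dx + (g X1 - Y1) d/dy) / J] with
    [J = jac2 X Y x y]. The jump of the [j]-th derivative of [Z_YY] is [nu * Q j / J^2], since each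
    [d/dY] contributes [(X1 d/dy - X2 d/dx) / J]. The claim is the difference of the two transformed
    equations. *)
Lemma third_order_comparison U F1 F2 F3 O w w' x y :
  open3 U -> smooth3 U F1 -> smooth3 U F2 -> smooth3 U F3 ->
  preserves_solutions U F1 F2 F3 -> jac3 F1 F2 F3 x y (w x y) <> 0 ->
  is_solution O w -> (forall x y, O x y -> U x y (w x y)) ->
  is_solution O w' -> (forall x y, O x y -> U x y (w' x y)) ->
  O x y -> same_jet2 w w' x y ->
  let X := fun x y => F1 x y (w x y) in
  let Y := fun x y => F2 x y (w x y) in
  let Z := fun x y => F3 x y (w x y) in
  jac2 X Y x y <> 0 ->
  let X1 := pd2 v1 X x y in let X2 := pd2 v2 X x y in
  let Y1 := pd2 v1 Y x y in let Y2 := pd2 v2 Y x y in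
  let g := TD v2 X Y (TD v2 X Y Z) x y in
  let e := fun l j i => delta3 w w' l j i x y in
  let Q := fun j => X1 * (X1 * e j v2 v2 - X2 * e j v2 v1)
                    - X2 * (X1 * e j v1 v2 - X2 * e j v1 v1) in
  (Y2 - g * X2) * Q v1 + (g * X1 - Y1) * Q v2 = 0.
Proof.
  intros HU S1 S2 S3 HP N3 HS G HS' G' Hx Ew X Y Z NJ X1 X2 Y1 Y2 g e Q.
  pose (X' := fun x y => F1 x y (w' x y)).
  pose (Y' := fun x y => F2 x y (w' x y)).
  pose (Z' := fun x y => F3 x y (w' x y)).
  assert (Hw : graph_in U O w) by (split; [|split; [|split]]; trivial; apply HS).
  assert (Hw' : graph_in U O w') by (split; [|split; [|split]]; trivial; apply HS').
  assert (EX : same_jet2 X X' x y) by now apply (same_jet2_along U F1 O).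
  assert (EY : same_jet2 Y Y' x y) by now apply (same_jet2_along U F2 O).
  assert (EZ : same_jet2 Z Z' x y) by now apply (same_jet2_along U F3 O).
  assert (NJ' : jac2 X' Y' x y <> 0).
  { unfold jac2 in *. destruct EX as [[_ A] _], EY as [[_ B] _]. now rewrite -!A -!B. }
  assert (T := transformed_equation U F1 F2 F3 O w x y HU S1 S2 S3 HP HS G Hx NJ).
  assert (T' := transformed_equation U F1 F2 F3 O w' x y HU S1 S2 S3 HP HS' G' Hx NJ').
  cbv zeta in T, T'. fold X Y Z in T. fold X' Y' Z' in T'.
  assert (HO := proj1 Hw).
  assert (SX := smooth2_graph U F1 O w Hw S1). assert (SY := smooth2_graph U F2 O w Hw S2).
  assert (SX' := smooth2_graph U F1 O w' Hw' S1). assert (SY' := smooth2_graph U F2 O w' Hw' S2).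
  assert (SZ := smooth2_graph U F3 O w Hw S3). assert (SZ' := smooth2_graph U F3 O w' Hw' S3).
  fold X in SX. fold Y in SY. fold Z in SZ. fold X' in SX'. fold Y' in SY'. fold Z' in SZ'.
  pose (V := fun x y => (O x y /\ jac2 X Y x y <> 0) /\ jac2 X' Y' x y <> 0).
  assert (SV : forall x y, V x y -> O x y) by now intros ? ? [[]].
  assert (HV : open2 V).
  { apply open2_nonzero.
    - apply open2_nonzero; trivial. apply smooth2_alg; trivial. now apply alg_jac2.
    - apply (smooth2_subset O); [now intros ? ? []|].
      apply smooth2_alg; trivial. now apply alg_jac2. }
  assert (Vx : V x y) by now split.
  assert (N : nondegenerate V X Y).
  { split; [exact HV|split; [|split]]; try now apply (smooth2_subset O). now intros ? ? [[]]. }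
  assert (N' : nondegenerate V X' Y').
  { split; [exact HV|split; [|split]]; try now apply (smooth2_subset O). now intros ? ? []. }
  apply (smooth2_subset _ _ _ SV) in SZ, SZ'.
  assert (Sh := smooth2_nondegenerate_TD V X Y Z v2 N SZ).
  assert (Sh' := smooth2_nondegenerate_TD V X' Y' Z' v2 N' SZ').
  assert (Eh := same_jet1_TD V X Y Z X' Y' Z' x y N N' SZ SZ' Vx EX EY EZ v2).
  assert (Eg : TD v2 X' Y' (TD v2 X' Y' Z') x y = g).
  { unfold g. destruct Eh as [_ A]. unfold TD at 1 3, jac2.
    destruct EX as [[_ B] _], EY as [[_ C] _]. now rewrite !A !B !C. }
  assert (D3 := fun l j i => delta3_TD V X Y Z X' Y' Z' l j i x y N N' SZ SZ' Vx EX EY EZ).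
  assert (D2 := fun j i => delta2_TD V X Y _ X' Y' _ j i x y N N' Sh Sh' Vx EX EY Eh).
  assert (K := jac3_along U F1 F2 F3 O w x y Hw S1 S2 S3 Hx NJ).
  cbv zeta in K. fold X Y Z in K. rewrite K in N3.
  set (nu := pd3 u3 F3 x y (w x y) - TD v1 X Y Z x y * pd3 u3 F1 x y (w x y)
     - TD v2 X Y Z x y * pd3 u3 F2 x y (w x y)) in *.
  assert (Nnu : nu <> 0) by (intros Z0; apply N3; rewrite Z0; ring).
  (* The jumps of [Z], [X], [Y] are [e] times [F3_w], [F1_w], [F2_w]; in the combination of
     [delta3_TD] they add up to [nu * e]. *)
  assert (D3' : forall l j i, nu * e l j i =
    (pd2 l (pd2 j (TD v1 X' Y' Z')) x y - pd2 l (pd2 j (TD v1 X Y Z)) x y) * pd2 i X x y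
    + (pd2 l (pd2 j (TD v2 X' Y' Z')) x y - pd2 l (pd2 j (TD v2 X Y Z)) x y) * pd2 i Y x y).
  { intros l j i. rewrite -D3. unfold X, Y, Z, X', Y', Z'.
    rewrite !(delta3_along U _ O w w') //. unfold nu, e, X, Y, Z. ring. }
  assert (J0 : jac2 X Y x y = X1 * Y2 - X2 * Y1) by reflexivity.
  assert (Hh : forall l j, jac2 X Y x y *
     (pd2 l (pd2 j (TD v2 X' Y' Z')) x y - pd2 l (pd2 j (TD v2 X Y Z)) x y) =
     nu * (X1 * e l j v2 - X2 * e l j v1)).
  { intros l j. assert (A1 := D3' l j v1). assert (A2 := D3' l j v2).
    fold X1 Y1 in A1. fold X2 Y2 in A2. rewrite J0.
    transitivity (X1 * (nu * e l j v2) - X2 * (nu * e l j v1)); [rewrite A1 A2|]; ring. }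
  pose (dg := fun j => pd2 j (TD v2 X' Y' (TD v2 X' Y' Z')) x y
                       - pd2 j (TD v2 X Y (TD v2 X Y Z)) x y).
  assert (Hg : forall j, jac2 X Y x y ^ 2 * dg j = nu * Q j).
  { intros j. assert (A1 := D2 j v1). assert (A2 := D2 j v2).
    fold X1 Y1 (dg j) in A1. fold X2 Y2 (dg j) in A2.
    transitivity (X1 * (jac2 X Y x y * (pd2 j (pd2 v2 (TD v2 X' Y' Z')) x y
                                        - pd2 j (pd2 v2 (TD v2 X Y Z)) x y))
                  - X2 * (jac2 X Y x y * (pd2 j (pd2 v1 (TD v2 X' Y' Z')) x y
                                        - pd2 j (pd2 v1 (TD v2 X Y Z)) x y))).
    - rewrite A1 A2 J0. ring.
    - rewrite !Hh. unfold Q. ring. }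
  assert (R : (Y2 - g * X2) * dg v1 + (g * X1 - Y1) * dg v2 = 0).
  { fold g in T. rewrite Eg in T'.
    assert (A : forall P, jac2 X Y x y * (TD v1 X Y P x y + g * TD v2 X Y P x y) =
      (Y2 - g * X2) * pd2 v1 P x y + (g * X1 - Y1) * pd2 v2 P x y).
    { intros P. unfold TD. fold X1 X2 Y1 Y2. field. exact NJ. }
    assert (A' : forall P, jac2 X' Y' x y * (TD v1 X' Y' P x y + g * TD v2 X' Y' P x y) =
      (Y2 - g * X2) * pd2 v1 P x y + (g * X1 - Y1) * pd2 v2 P x y).
    { intros P. unfold TD, X1, X2, Y1, Y2. destruct EX as [[_ B] _], EY as [[_ C] _].
      rewrite !B !C. field. exact NJ'. }
    assert (B := A (TD v2 X Y (TD v2 X Y Z))).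
    assert (B' := A' (TD v2 X' Y' (TD v2 X' Y' Z'))).
    rewrite T in B. rewrite T' in B'. unfold dg. lra. }
  apply Rmult_eq_reg_l with nu; trivial.
  transitivity ((Y2 - g * X2) * (nu * Q v1) + (g * X1 - Y1) * (nu * Q v2)); [ring|].
  rewrite -!Hg. transitivity (jac2 X Y x y ^ 2 * ((Y2 - g * X2) * dg v1 + (g * X1 - Y1) * dg v2));
    [ring|]. rewrite R. ring.
Qed.

(* These solutions have w_22 = (k (y - y0) + u) / (1 + k (x - x0)); the other parameters
   prescribe the remaining partial derivatives at (x0, y0) that are needed. *)
Definition probe (x0 y0 z0 a b u k r s : R) (x y : R) : R :=
  (k * (y - y0) ^ 3 / 6 + u * (y - y0) ^ 2 / 2) / (1 + k * (x - x0))
  + b * (y - y0) + r * (x - x0) ^ 2 * (y - y0) / 2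
  + z0 + a * (x - x0) + s * (x - x0) ^ 3 / 6.

(** The conjunct [True] stands for the whole plane, so that openness is an instance of
    [open2_nonzero]. *)
Definition probe_dom (x0 k x y : R) : Prop := True /\ 1 + k * (x - x0) <> 0.

Lemma open2_probe_dom x0 k : open2 (probe_dom x0 k).
Proof.
  assert (HT : open2 (fun _ _ => True)) by (intros x y _; exists 1; split; [lra|trivial]).
  apply (open2_nonzero (fun _ _ => True) (fun x _ => 1 + k * (x - x0))); trivial.
  apply smooth2_alg; trivial. apply alg_plus; [apply alg_const|].
  apply alg_mult; [apply alg_const|]. apply alg_minus; [apply alg_fst|apply alg_const].
Qed.

Lemma smooth2_probe x0 y0 z0 a b u k r s :
  smooth2 (probe_dom x0 k) (probe x0 y0 z0 a b u k r s).
Proof.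
  apply smooth2_alg; [apply open2_probe_dom|]. unfold probe.
  repeat (apply alg_plus || apply alg_div || apply alg_mult || apply alg_minus);
  try apply alg_const; try apply alg_fst; try apply alg_snd; try (intros; lra).
  now intros ? ? [].
Qed.

Lemma pd2_probe x0 y0 z0 a b u k r s i x y :
  probe_dom x0 k x y ->
  pd2 i (probe x0 y0 z0 a b u k r s) x y =
  match i with
  | v1 => - k * (k * (y - y0) ^ 3 / 6 + u * (y - y0) ^ 2 / 2) / (1 + k * (x - x0)) ^ 2
          + r * (x - x0) * (y - y0) + a + s * (x - x0) ^ 2 / 2
  | v2 => (k * (y - y0) ^ 2 / 2 + u * (y - y0)) / (1 + k * (x - x0))
          + b + r * (x - x0) ^ 2 / 2
  end.
Proof.
  intros [_ N]. unfold probe. apply is_pd2_unique. destruct i; simpl; auto_derive; trivial;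
  field; trivial.
Qed.

Lemma pd2_pd2_probe x0 y0 z0 a b u k r s i j x y :
  probe_dom x0 k x y ->
  pd2 j (pd2 i (probe x0 y0 z0 a b u k r s)) x y =
  match i, j with
  | v1, v1 => 2 * k ^ 2 * (k * (y - y0) ^ 3 / 6 + u * (y - y0) ^ 2 / 2)
                / (1 + k * (x - x0)) ^ 3 + r * (y - y0) + s * (x - x0)
  | v2, v2 => (k * (y - y0) + u) / (1 + k * (x - x0))
  | _, _ => - k * (k * (y - y0) ^ 2 / 2 + u * (y - y0)) / (1 + k * (x - x0)) ^ 2
            + r * (x - x0)
  end.
Proof.
  intros Hx. rewrite (pd2_ext (probe_dom x0 k) j _ _ x y (open2_probe_dom x0 k) Hx
    (fun a' b' H => pd2_probe x0 y0 z0 a b u k r s i a' b' H)).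
  destruct Hx as [_ N]. apply is_pd2_unique. destruct i, j; simpl; auto_derive;
  repeat split; trivial; try (apply Rmult_integral_contrapositive_currified; trivial; lra);
  field; trivial.
Qed.

Lemma pd2_pd2_pd2_probe x0 y0 z0 a b u k r s i j l x y :
  probe_dom x0 k x y ->
  pd2 l (pd2 j (pd2 i (probe x0 y0 z0 a b u k r s))) x y =
  match i, j, l with
  | v1, v1, v1 => - 6 * k ^ 3 * (k * (y - y0) ^ 3 / 6 + u * (y - y0) ^ 2 / 2)
                  / (1 + k * (x - x0)) ^ 4 + s
  | v2, v2, v2 => k / (1 + k * (x - x0))
  | v2, v2, v1 | v2, v1, v2 | v1, v2, v2 =>
      - k * (k * (y - y0) + u) / (1 + k * (x - x0)) ^ 2
  | _, _, _ => 2 * k ^ 2 * (k * (y - y0) ^ 2 / 2 + u * (y - y0))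
                / (1 + k * (x - x0)) ^ 3 + r
  end.
Proof.
  intros Hx. rewrite (pd2_ext (probe_dom x0 k) l _ _ x y (open2_probe_dom x0 k) Hx
    (fun a' b' H => pd2_pd2_probe x0 y0 z0 a b u k r s i j a' b' H)).
  destruct Hx as [_ N]. apply is_pd2_unique. destruct i, j, l; simpl; auto_derive;
  repeat split; trivial; repeat (apply Rmult_integral_contrapositive_currified; trivial);
  try lra; field; trivial.
Qed.

(** Here [w_22] is a simple wave of the Burgers equation, affine in [y] with slope
    [k / (1 + k * (x - x0))]. *)
Lemma probe_is_solution x0 y0 z0 a b u k r s :
  is_solution (probe_dom x0 k) (probe x0 y0 z0 a b u k r s).
Proof.
  split; [apply open2_probe_dom|]. split; [apply smooth2_probe|]. intros x y Hx.
  change (pd2 v1 (pd2 v2 (pd2 v2 (probe x0 y0 z0 a b u k r s))) x y +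
    pd2 v2 (pd2 v2 (probe x0 y0 z0 a b u k r s)) x y
    * pd2 v2 (pd2 v2 (pd2 v2 (probe x0 y0 z0 a b u k r s))) x y = 0).
  rewrite !pd2_pd2_pd2_probe // pd2_pd2_probe //. destruct Hx as [_ N]. field. exact N.
Qed.

(** At the base point [k], [r], [s] are [w_222], [w_112], [w_111], and the equation forces
    [w_122 = - k * u]. These parameters leave the 2-jet unchanged, as the comparison requires. *)
Lemma probe_jets x0 y0 z0 a b u k r s :
  let w := probe x0 y0 z0 a b u k r s in
  w x0 y0 = z0 /\ pd2 v1 w x0 y0 = a /\ pd2 v2 w x0 y0 = b /\
  (forall i j, pd2 j (pd2 i w) x0 y0 = match i, j with v2, v2 => u | _, _ => 0 end) /\
  (forall i j l, pd2 l (pd2 j (pd2 i w)) x0 y0 =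
     match i, j, l with
     | v1, v1, v1 => s | v2, v2, v2 => k
     | v2, v2, v1 | v2, v1, v2 | v1, v2, v2 => - k * u
     | _, _, _ => r end).
Proof.
  intros w. assert (D : probe_dom x0 k x0 y0) by (split; trivial; rewrite Rminus_diag; lra).
  unfold w. split; [|split; [|split; [|split]]].
  - unfold probe. rewrite !Rminus_diag. field.
  - rewrite pd2_probe // !Rminus_diag. field.
  - rewrite pd2_probe // !Rminus_diag. field.
  - intros i j. rewrite pd2_pd2_probe // !Rminus_diag. destruct i, j; field.
  - intros i j l. rewrite pd2_pd2_pd2_probe // !Rminus_diag. destruct i, j, l; field.
Qed.

Lemma same_jet2_probe x0 y0 z0 a b u k r s k' r' s' :
  same_jet2 (probe x0 y0 z0 a b u k r s) (probe x0 y0 z0 a b u k' r' s') x0 y0.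
Proof.
  destruct (probe_jets x0 y0 z0 a b u k r s) as [V [D1 [D2 [E _]]]].
  destruct (probe_jets x0 y0 z0 a b u k' r' s') as [V' [D1' [D2' [E' _]]]].
  split; [split|].
  - now rewrite V V'.
  - intros []; [now rewrite D1 D1'|now rewrite D2 D2'].
  - intros i j. now rewrite E E'.
Qed.

Lemma probe_graph U x0 y0 z0 a b u k r s :
  open3 U -> U x0 y0 z0 -> exists d, 0 < d /\
    forall x y, Rabs (x - x0) < d -> Rabs (y - y0) < d ->
      probe_dom x0 k x y /\ U x y (probe x0 y0 z0 a b u k r s x y).
Proof.
  intros HU H0. set (w := probe x0 y0 z0 a b u k r s).
  assert (D : probe_dom x0 k x0 y0) by (split; trivial; rewrite Rminus_diag; lra).
  assert (V : w x0 y0 = z0) by apply (probe_jets x0 y0 z0 a b u k r s).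
  rewrite -V in H0.
  assert (C : filterlim (fun p : R * R => (fst p, snd p, w (fst p) (snd p)))
            (locally (x0, y0)) (locally (x0, y0, w x0 y0))).
  { apply: filterlim_locally_pair; [apply: filterlim_locally_pair|].
    - apply: continuous_fst. - apply: continuous_snd.
    - exact (smooth2_continuous _ _ _ _ (smooth2_probe x0 y0 z0 a b u k r s) D). }
  specialize (C _ (open3_locally U _ _ _ HU H0)).
  destruct (locally_box _ _ _ (filter_and _ _
    (open2_locally _ x0 y0 (open2_probe_dom x0 k) D) C)) as [d [Hd B]].
  exists d. split; [exact Hd|exact B].
Qed.

(** * Determining equations *)

Lemma open3_slices U x y z :
  open3 U -> U x y z ->
  locally x (fun t => U t y z) /\ locally y (fun t => U x t z) /\ locally z (fun t => U x y t).
Proof.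
  intros HU H. destruct (HU x y z H) as [d [Hd B]].
  assert (Z : forall t, Rabs (t - t) < d) by (intros t; now rewrite Rminus_diag Rabs_R0).
  split; [|split]; apply (locally_Rabs _ _ d Hd); intros t Ht; now apply B.
Qed.

Lemma pd3_ext U i f g x y z :
  open3 U -> U x y z -> (forall x y z, U x y z -> f x y z = g x y z) ->
  pd3 i f x y z = pd3 i g x y z.
Proof.
  intros HU H E. destruct (open3_slices U x y z HU H) as [L1 [L2 L3]].
  destruct i; apply Derive_ext_loc.
  - revert L1. apply filter_imp. intros t Ht. now apply E.
  - revert L2. apply filter_imp. intros t Ht. now apply E.
  - revert L3. apply filter_imp. intros t Ht. now apply E.
Qed.

Lemma pd3_zero U i f x y z :
  open3 U -> U x y z -> (forall x y z, U x y z -> f x y z = 0) -> pd3 i f x y z = 0.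
Proof.
  intros HU H E. rewrite (pd3_ext U i f (fun _ _ _ => 0)) //. destruct i; exact (Derive_const 0 _).
Qed.

(** Schwarz's theorem in the three coordinate planes through the point. *)
Lemma pd3_comm U f i j x y z :
  open3 U -> smooth3 U f -> U x y z -> pd3 i (pd3 j f) x y z = pd3 j (pd3 i f) x y z.
Proof.
  intros HU Hf Hx.
  assert (L := open3_locally U x y z HU Hx).
  assert (S1 := fun i => smooth3_pd3 U i f Hf).
  assert (S2 := fun i j => smooth3_pd3 U i _ (S1 j)).
  assert (E : forall g, smooth3 U g -> forall a b c, U a b c -> forall i, exd3 i g a b c)
    by (intros; now apply (smooth3_exd3 U)).
  assert (C := fun i j => smooth3_continuous U _ x y z (S2 i j) Hx).
  assert (A12 : pd3 u1 (pd3 u2 f) x y z = pd3 u2 (pd3 u1 f) x y z).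
  { assert (P : filterlim (fun u : R * R => (fst u, snd u, z)) (locally (x, y))
                  (locally (x, y, z))).
    { apply: filterlim_locally_pair; [apply: filterlim_locally_pair|].
      - apply: continuous_fst. - apply: continuous_snd. - apply filterlim_const. }
    apply (Schwarz (fun a b => f a b z) x y).
    - apply locally_2d_locally. assert (LP := P _ L). unfold filtermap in LP.
      revert LP. apply filter_imp.
      intros u Hu. simpl in Hu. repeat split.
      + exact (E f Hf _ _ _ Hu u1). + exact (E f Hf _ _ _ Hu u2).
      + exact (E _ (S1 u2) _ _ _ Hu u1). + exact (E _ (S1 u1) _ _ _ Hu u2).
    - apply continuity_2d_pt_filterlim.
      exact (filterlim_comp _ _ _ _ _ _ _ _ P (C u1 u2)).
    - apply continuity_2d_pt_filterlim.
      exact (filterlim_comp _ _ _ _ _ _ _ _ P (C u2 u1)). }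
  assert (A13 : pd3 u1 (pd3 u3 f) x y z = pd3 u3 (pd3 u1 f) x y z).
  { assert (P : filterlim (fun u : R * R => (fst u, y, snd u)) (locally (x, z))
                  (locally (x, y, z))).
    { apply: filterlim_locally_pair; [apply: filterlim_locally_pair|].
      - apply: continuous_fst. - apply filterlim_const. - apply: continuous_snd. }
    apply (Schwarz (fun a c => f a y c) x z).
    - apply locally_2d_locally. assert (LP := P _ L). unfold filtermap in LP.
      revert LP. apply filter_imp.
      intros u Hu. simpl in Hu. repeat split.
      + exact (E f Hf _ _ _ Hu u1). + exact (E f Hf _ _ _ Hu u3).
      + exact (E _ (S1 u3) _ _ _ Hu u1). + exact (E _ (S1 u1) _ _ _ Hu u3).
    - apply continuity_2d_pt_filterlim.
      exact (filterlim_comp _ _ _ _ _ _ _ _ P (C u1 u3)).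
    - apply continuity_2d_pt_filterlim.
      exact (filterlim_comp _ _ _ _ _ _ _ _ P (C u3 u1)). }
  assert (A23 : pd3 u2 (pd3 u3 f) x y z = pd3 u3 (pd3 u2 f) x y z).
  { assert (P : filterlim (fun u : R * R => (x, fst u, snd u)) (locally (y, z))
                  (locally (x, y, z))).
    { apply: filterlim_locally_pair; [apply: filterlim_locally_pair|].
      - apply filterlim_const. - apply: continuous_fst. - apply: continuous_snd. }
    apply (Schwarz (fun b c => f x b c) y z).
    - apply locally_2d_locally. assert (LP := P _ L). unfold filtermap in LP.
      revert LP. apply filter_imp.
      intros u Hu. simpl in Hu. repeat split.
      + exact (E f Hf _ _ _ Hu u2). + exact (E f Hf _ _ _ Hu u3).
      + exact (E _ (S1 u3) _ _ _ Hu u2). + exact (E _ (S1 u2) _ _ _ Hu u3).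
    - apply continuity_2d_pt_filterlim.
      exact (filterlim_comp _ _ _ _ _ _ _ _ P (C u2 u3)).
    - apply continuity_2d_pt_filterlim.
      exact (filterlim_comp _ _ _ _ _ _ _ _ P (C u3 u2)). }
  destruct i, j; trivial; symmetry; assumption.
Qed.

Definition box (x0 y0 d x y : R) : Prop := Rabs (x - x0) < d /\ Rabs (y - y0) < d.

(** The third-order jumps allowed by the equation form a three-dimensional space: [w_111], [w_112],
    and [w_222] tied to [w_122 = - u * w_222]. A probe for each direction is compared with the one
    having [k = r = s = 0]. *)
Lemma probe_symbol U F1 F2 F3 x0 y0 z0 a b u :
  is_point_transformation U F1 F2 F3 -> preserves_solutions U F1 F2 F3 -> U x0 y0 z0 ->
  let w := probe x0 y0 z0 a b u 0 0 0 in
  let X := fun x y => F1 x y (w x y) in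
  let Y := fun x y => F2 x y (w x y) in
  let Z := fun x y => F3 x y (w x y) in
  jac2 X Y x0 y0 <> 0 ->
  pd2 v2 X x0 y0 = 0 /\
  TD v2 X Y (TD v2 X Y Z) x0 y0 * pd2 v1 X x0 y0 = pd2 v1 Y x0 y0 + u * pd2 v2 Y x0 y0.
Proof.
  intros [HU [S1 [S2 [S3 [_ NJ3]]]]] HP H0 w X Y Z NJ.
  assert (Cmp : forall k r s,
    let e := fun l j i => delta3 w (probe x0 y0 z0 a b u k r s) l j i x0 y0 in
    let X1 := pd2 v1 X x0 y0 in let X2 := pd2 v2 X x0 y0 in
    let g := TD v2 X Y (TD v2 X Y Z) x0 y0 in
    let Q := fun j => X1 * (X1 * e j v2 v2 - X2 * e j v2 v1)
                      - X2 * (X1 * e j v1 v2 - X2 * e j v1 v1) in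
    (pd2 v2 Y x0 y0 - g * X2) * Q v1 + (g * X1 - pd2 v1 Y x0 y0) * Q v2 = 0).
  { intros k r s.
    destruct (probe_graph U x0 y0 z0 a b u 0 0 0 HU H0) as [d [Hd B]].
    destruct (probe_graph U x0 y0 z0 a b u k r s HU H0) as [d' [Hd' B']].
    pose (dm := Rmin d d'). assert (Hm : 0 < dm) by now apply Rmin_pos.
    assert (I : forall x y, box x0 y0 dm x y ->
      (Rabs (x - x0) < d /\ Rabs (y - y0) < d) /\ (Rabs (x - x0) < d' /\ Rabs (y - y0) < d')).
    { intros x y [Hx Hy]. generalize (Rmin_l d d') (Rmin_r d d'). fold dm. lra. }
    assert (V : w x0 y0 = z0) by apply (probe_jets x0 y0 z0 a b u 0 0 0).
    apply (third_order_comparison U F1 F2 F3 (box x0 y0 dm) w (probe x0 y0 z0 a b u k r s)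
      x0 y0); trivial.
    - rewrite V. now apply NJ3.
    - apply (is_solution_subset (probe_dom x0 0)); [apply open2_box| |apply probe_is_solution].
      intros x y Hxy. now apply B; apply (I x y Hxy).
    - intros x y Hxy. now apply B; apply (I x y Hxy).
    - apply (is_solution_subset (probe_dom x0 k)); [apply open2_box| |apply probe_is_solution].
      intros x y Hxy. now apply B'; apply (I x y Hxy).
    - intros x y Hxy. now apply B'; apply (I x y Hxy).
    - split; rewrite Rminus_diag Rabs_R0; exact Hm.
    - apply same_jet2_probe. }
  set (g := TD v2 X Y (TD v2 X Y Z) x0 y0) in *.
  assert (J3 := proj2 (proj2 (proj2 (proj2 (probe_jets x0 y0 z0 a b u 0 0 0))))). fold w in J3.
  unfold delta3 in Cmp.
  assert (C1 := Cmp 0 0 1). assert (C2 := Cmp 0 1 0). assert (C3 := Cmp 1 0 0). clear Cmp.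
  cbv zeta in C1, C2, C3.
  rewrite !J3 !(proj2 (proj2 (proj2 (proj2 (probe_jets x0 y0 z0 a b u 0 0 1))))) in C1.
  rewrite !J3 !(proj2 (proj2 (proj2 (proj2 (probe_jets x0 y0 z0 a b u 0 1 0))))) in C2.
  rewrite !J3 !(proj2 (proj2 (proj2 (proj2 (probe_jets x0 y0 z0 a b u 1 0 0))))) in C3.
  unfold jac2 in NJ.
  set (X1 := pd2 v1 X x0 y0) in *. set (X2 := pd2 v2 X x0 y0) in *.
  set (Y1 := pd2 v1 Y x0 y0) in *. set (Y2 := pd2 v2 Y x0 y0) in *.
  assert (X20 : X2 = 0).
  (* If [X2] were nonzero, the jump of [w_111] would give [Y2 - g X2 = 0], and that of [w_112] then
     [g X1 - Y1 = 0]; but the Jacobian is a combination of these two coefficients. *)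
  { destruct (Req_dec X2 0) as [|N]; trivial. exfalso.
    assert (E1 : Y2 - g * X2 = 0).
    { apply Rmult_eq_reg_r with (X2 ^ 2); [|now apply pow_nonzero].
      rewrite Rmult_0_l -C1. ring. }
    rewrite E1 in C2.
    assert (E2 : g * X1 - Y1 = 0).
    { apply Rmult_eq_reg_r with (X2 ^ 2); [|now apply pow_nonzero].
      rewrite Rmult_0_l -C2. ring. }
    apply NJ. transitivity (X1 * (Y2 - g * X2) + X2 * (g * X1 - Y1)); [ring|].
    rewrite E1 E2. ring. }
  split; trivial. rewrite X20 in C3 NJ.
  assert (N1 : X1 <> 0) by (intros Z0; apply NJ; rewrite Z0; ring).
  apply Rminus_diag_uniq. apply Rmult_eq_reg_r with (X1 ^ 2); [|now apply pow_nonzero].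
  rewrite Rmult_0_l -C3. ring.
Qed.

(** [X_y = a2 + a3 b] vanishes at every slope where the Jacobian [J a b] does not. As [J] is affine
    in [(a, b)], two such slopes exist unless [J] is identically zero, and in that case all minors
    of the first two rows of the Jacobian matrix vanish. *)
Lemma F1_depends_on_x U F1 F2 F3 x y z :
  is_point_transformation U F1 F2 F3 -> preserves_solutions U F1 F2 F3 -> U x y z ->
  pd3 u2 F1 x y z = 0 /\ pd3 u3 F1 x y z = 0.
Proof.
  intros HT HP H0.
  destruct (HT) as [HU [S1 [S2 [S3 [_ NJ3]]]]]. specialize (NJ3 x y z H0).
  assert (K : forall a b, let a1 := pd3 u1 F1 x y z in let a2 := pd3 u2 F1 x y z in
    let a3 := pd3 u3 F1 x y z in let b1 := pd3 u1 F2 x y z in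
    let b2 := pd3 u2 F2 x y z in let b3 := pd3 u3 F2 x y z in
    (a1 + a3 * a) * (b2 + b3 * b) - (a2 + a3 * b) * (b1 + b3 * a) <> 0 -> a2 + a3 * b = 0).
  { intros a b. pose (w := probe x y z a b 0 0 0 0).
    destruct (probe_jets x y z a b 0 0 0 0) as [V [D1 [D2 _]]]. fold w in V, D1, D2.
    destruct (probe_graph U x y z a b 0 0 0 0 HU H0) as [d [Hd B]].
    assert (Hw : graph_in U (box x y d) w).
    { split; [apply open2_box|split; [exact HU|split]].
      - apply (smooth2_subset (probe_dom x 0)); [|apply smooth2_probe].
        intros x' y' [Hx Hy]. now apply B.
      - intros x' y' [Hx Hy]. now apply B. }
    assert (Hx : box x y d x y) by (split; now rewrite Rminus_diag Rabs_R0).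
    assert (EX := fun i => pd2_along U F1 _ w i x y Hw S1 Hx).
    assert (EY := fun i => pd2_along U F2 _ w i x y Hw S2 Hx).
    assert (P := probe_symbol U F1 F2 F3 x y z a b 0 HT HP H0). cbv zeta in P. fold w in P.
    unfold jac2 in P. rewrite V in EX, EY.
    rewrite !EX !EY D1 D2 in P. cbv [emb] in P. intros a1 a2 a3 b1 b2 b3 N. now apply P. }
  cbv zeta in K. unfold jac3 in NJ3.
  set (a1 := pd3 u1 F1 x y z) in *. set (a2 := pd3 u2 F1 x y z) in *.
  set (a3 := pd3 u3 F1 x y z) in *. set (b1 := pd3 u1 F2 x y z) in *.
  set (b2 := pd3 u2 F2 x y z) in *. set (b3 := pd3 u3 F2 x y z) in *.
  set (J := fun a b => (a1 + a3 * a) * (b2 + b3 * b) - (a2 + a3 * b) * (b1 + b3 * a)).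
  fold (J 0 0) in *.
  assert (Fin : forall a b, J a b <> 0 -> a2 = 0 /\ a3 = 0).
  { intros a b N.
    (* An affine function of [b] vanishing at [b + 1] and [b + 2] vanishes at [b]. *)
    assert (A : J a (b + 1) <> 0 \/ J a (b + 2) <> 0).
    { destruct (Req_dec (J a (b + 1)) 0) as [Z1|]; [|now left].
      destruct (Req_dec (J a (b + 2)) 0) as [Z2|]; [|now right].
      exfalso. apply N. transitivity (2 * J a (b + 1) - J a (b + 2)); [unfold J; ring|lra]. }
    assert (E := K a b N).
    assert (A3 : a3 = 0).
    { destruct A as [A|A]; apply K in A; [replace a3 with (a2 + a3 * (b + 1) - (a2 + a3 * b))
        by ring|replace a3 with ((a2 + a3 * (b + 2) - (a2 + a3 * b)) / 2) by field]; lra. }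
    split; trivial. rewrite A3 in E. lra. }
  destruct (Req_dec (J 0 0) 0) as [Z0|N0]; [|now apply (Fin 0 0)].
  destruct (Req_dec (J 1 0) 0) as [Z1|N1]; [|now apply (Fin 1 0)].
  destruct (Req_dec (J 0 1) 0) as [Z2|N2]; [|now apply (Fin 0 1)].
  exfalso. apply NJ3. unfold J in Z0, Z1, Z2.
  set (c1 := pd3 u1 F3 x y z). set (c2 := pd3 u2 F3 x y z). set (c3 := pd3 u3 F3 x y z).
  assert (E0 : a1 * b2 - a2 * b1 = 0) by lra.
  assert (E1 : a3 * b2 - a2 * b3 = 0) by lra.
  assert (E2 : a1 * b3 - a3 * b1 = 0) by lra.
  transitivity (c3 * (a1 * b2 - a2 * b1) - c2 * (a1 * b3 - a3 * b1) - c1 * (a3 * b2 - a2 * b3));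
    [ring|]. rewrite E0 E1 E2. ring.
Qed.

Lemma probe_local U x0 y0 z0 a b u :
  open3 U -> U x0 y0 z0 -> let w := probe x0 y0 z0 a b u 0 0 0 in
  exists d, box x0 y0 d x0 y0 /\ graph_in U (box x0 y0 d) w /\ is_solution (box x0 y0 d) w.
Proof.
  intros HU H0 w. destruct (probe_graph U x0 y0 z0 a b u 0 0 0 HU H0) as [d [Hd B]].
  exists d. split; [|split].
  - split; now rewrite Rminus_diag Rabs_R0.
  - split; [apply open2_box|split; [exact HU|split]].
    + apply (smooth2_subset (probe_dom x0 0)); [|apply smooth2_probe].
      intros x y [Hx Hy]. now apply B.
    + intros x y [Hx Hy]. now apply B.
  - apply (is_solution_subset (probe_dom x0 0)); [apply open2_box| |apply probe_is_solution].
    intros x y [Hx Hy]. now apply B.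
Qed.

Lemma nondegenerate_locus O X Y :
  open2 O -> smooth2 O X -> smooth2 O Y ->
  nondegenerate (fun x y => O x y /\ jac2 X Y x y <> 0) X Y.
Proof.
  intros HO HX HY. split; [|split; [|split]].
  - apply open2_nonzero; trivial. apply smooth2_alg; trivial. now apply alg_jac2.
  - apply (smooth2_subset O); trivial. now intros ? ? [].
  - apply (smooth2_subset O); trivial. now intros ? ? [].
  - now intros ? ? [].
Qed.

(** With [X_y = 0] the operator [d/dY] is [d/dy] divided by [Y_y], so this is the second derivative
    under a change of one variable, cleared of denominators. *)
Lemma TD2_vertical O X Y P x y :
  nondegenerate O X Y -> smooth2 O P -> (forall x y, O x y -> pd2 v2 X x y = 0) -> O x y ->
  TD v2 X Y (TD v2 X Y P) x y * pd2 v2 Y x y ^ 3 =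
  pd2 v2 (pd2 v2 P) x y * pd2 v2 Y x y - pd2 v2 (pd2 v2 Y) x y * pd2 v2 P x y.
Proof.
  intros N HP HX Hx.
  assert (X22 : pd2 v2 (pd2 v2 X) x y = 0).
  { rewrite (pd2_ext O v2 _ (fun _ _ => 0) x y (proj1 N) Hx HX).
    apply is_pd2_unique, is_pd2_const. }
  rewrite (pd2_pd2_TD O X Y P v2 v2 x y N HP Hx) (pd2_TD O X Y P v2 x y N Hx).
  rewrite (pd2_TD O X Y (TD v2 X Y P) v2 x y N Hx) X22 (HX x y Hx). ring.
Qed.

Lemma pd22_along U F O w x y :
  graph_in U O w -> smooth3 U F -> O x y ->
  pd2 v2 (pd2 v2 (fun x y => F x y (w x y))) x y =
    pd3 u2 (pd3 u2 F) x y (w x y) + 2 * pd3 u2 (pd3 u3 F) x y (w x y) * pd2 v2 w x y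
    + pd3 u3 (pd3 u3 F) x y (w x y) * pd2 v2 w x y ^ 2
    + pd3 u3 F x y (w x y) * pd2 v2 (pd2 v2 w) x y.
Proof.
  intros Hw HF Hx. rewrite (pd2_pd2_along U F O w) //.
  rewrite (pd2_along U (pd3 u2 F) O w) // ?(pd2_along U (pd3 u3 F) O w) //;
    try now apply smooth3_pd3.
  simpl emb. rewrite (pd3_comm U F u3 u2); [ring| | |]; try apply Hw; trivial.
Qed.

Lemma F1_x_neq0 U F1 F2 F3 x y z :
  is_point_transformation U F1 F2 F3 -> preserves_solutions U F1 F2 F3 -> U x y z ->
  pd3 u1 F1 x y z <> 0 /\ (pd3 u2 F2 x y z <> 0 \/ pd3 u3 F2 x y z <> 0).
Proof.
  intros HT HP H0. destruct (F1_depends_on_x U F1 F2 F3 x y z HT HP H0) as [E2 E3].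
  destruct HT as [_ [_ [_ [_ [_ NJ]]]]]. specialize (NJ x y z H0). unfold jac3 in NJ.
  rewrite E2 E3 in NJ. split.
  - intros E. apply NJ. rewrite E. ring.
  - destruct (Req_dec (pd3 u2 F2 x y z) 0) as [E|]; [right|now left].
    intros E'. apply NJ. rewrite E E'. ring.
Qed.

(** The second identity of [probe_symbol] multiplied by [Y_y^3] and written in partial derivatives
    of the components: [G] is [Y_y], and [second F] is the second derivative in [y] along the probe.
    The jet coordinates [a], [b], [u] are free while [G] is nonzero, so the identity can be split by
    their powers. *)
Lemma probe_relation U F1 F2 F3 x y z a b u :
  is_point_transformation U F1 F2 F3 -> preserves_solutions U F1 F2 F3 -> U x y z ->
  let G := pd3 u2 F2 x y z + pd3 u3 F2 x y z * b in
  let second := fun F => pd3 u2 (pd3 u2 F) x y z + 2 * pd3 u2 (pd3 u3 F) x y z * b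
                 + pd3 u3 (pd3 u3 F) x y z * b ^ 2 + pd3 u3 F x y z * u in
  G <> 0 ->
  (pd3 u1 F2 x y z + pd3 u3 F2 x y z * a + u * G) * G ^ 3 =
  pd3 u1 F1 x y z * (second F3 * G - second F2 * (pd3 u2 F3 x y z + pd3 u3 F3 x y z * b)).
Proof.
  intros HT HP H0 G second NG. assert (HT' := HT).
  destruct HT' as [HU [S1 [S2 [S3 _]]]].
  destruct (probe_local U x y z a b u HU H0) as [d [Hx [Hw HS]]].
  destruct (probe_jets x y z a b u 0 0 0) as [V [D1 [D2 [E _]]]].
  assert (PS := probe_symbol U F1 F2 F3 x y z a b u HT HP H0). cbv zeta in PS.
  set (w := probe x y z a b u 0 0 0) in *.
  pose (X := fun x y => F1 x y (w x y)). pose (Y := fun x y => F2 x y (w x y)).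
  pose (Z := fun x y => F3 x y (w x y)). fold X Y Z in PS.
  assert (EX := fun i => pd2_along U F1 _ w i x y Hw S1 Hx). fold X in EX. rewrite V in EX.
  assert (EY := fun i => pd2_along U F2 _ w i x y Hw S2 Hx). fold Y in EY. rewrite V in EY.
  assert (EZ := fun i => pd2_along U F3 _ w i x y Hw S3 Hx). fold Z in EZ. rewrite V in EZ.
  assert (EY2 := pd22_along U F2 _ w x y Hw S2 Hx). fold Y in EY2.
  assert (EZ2 := pd22_along U F3 _ w x y Hw S3 Hx). fold Z in EZ2.
  rewrite V D2 (E v2 v2) in EY2 EZ2.
  fold (second F2) in EY2. fold (second F3) in EZ2.
  destruct (F1_depends_on_x U F1 F2 F3 x y z HT HP H0) as [F12 F13].
  destruct (F1_x_neq0 U F1 F2 F3 x y z HT HP H0) as [F11 _].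
  assert (X1 : pd2 v1 X x y = pd3 u1 F1 x y z) by (rewrite EX F13; simpl emb; ring).
  assert (X2 : pd2 v2 X x y = 0) by (rewrite EX F13; simpl emb; rewrite F12; ring).
  assert (Y2 : pd2 v2 Y x y = G) by (rewrite EY D2; reflexivity).
  assert (NJ : jac2 X Y x y <> 0).
  { unfold jac2. rewrite X1 X2 Y2. rewrite Rmult_0_l Rminus_0_r.
    now apply Rmult_integral_contrapositive_currified. }
  destruct (PS NJ) as [_ Eg].
  pose (O := fun x' y' => box x y d x' y' /\ jac2 X Y x' y' <> 0).
  assert (N : nondegenerate O X Y).
  { apply nondegenerate_locus; [apply open2_box| |]; now apply (smooth2_graph U). }
  assert (T := TD2_vertical O X Y Z x y N).
  rewrite EZ2 EY2 EZ Y2 D2 in T. rewrite -T; clear T.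
  - rewrite X1 Y2 EY D1 in Eg. simpl emb in Eg. rewrite -Eg. ring.
  - apply (smooth2_subset (box x y d)); [now intros ? ? []|]. now apply (smooth2_graph U).
  - intros x' y' [Hb _]. unfold X. rewrite (pd2_along U F1 (box x y d) w) //.
    destruct Hw as [_ [_ [_ Gr]]].
    destruct (F1_depends_on_x U F1 F2 F3 x' y' (w x' y') HT HP (Gr _ _ Hb)) as [A1 A2].
    simpl emb. rewrite A1 A2. ring.
  - now split.
Qed.

(** The parameter [a = w_x] occurs in [probe_relation] only in the term [F2_w * a], so its values 0
    and 1 force [F2_w = 0]. The slope [b] is chosen to keep [G] nonzero. *)
Lemma F2_independent_of_w U F1 F2 F3 x y z :
  is_point_transformation U F1 F2 F3 -> preserves_solutions U F1 F2 F3 -> U x y z ->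
  pd3 u3 F2 x y z = 0 /\ pd3 u2 F2 x y z <> 0.
Proof.
  intros HT HP H0. destruct (F1_x_neq0 U F1 F2 F3 x y z HT HP H0) as [_ N].
  assert (E : exists b, pd3 u2 F2 x y z + pd3 u3 F2 x y z * b <> 0).
  { destruct (Req_dec (pd3 u2 F2 x y z) 0) as [Z|NZ].
    - exists 1. rewrite Z. destruct N as [N|N]; [now elim N|]. lra.
    - exists 0. lra. }
  destruct E as [b Hb].
  assert (R0 := probe_relation U F1 F2 F3 x y z 0 b 0 HT HP H0 Hb).
  assert (R1 := probe_relation U F1 F2 F3 x y z 1 b 0 HT HP H0 Hb).
  cbv zeta in R0, R1. rewrite -R0 in R1.
  apply Rmult_eq_reg_r in R1; [|now apply pow_nonzero].
  assert (Z : pd3 u3 F2 x y z = 0) by lra. split; trivial.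
  now destruct N.
Qed.

Lemma is_derive_pd3 U f i x y z :
  smooth3 U f -> U x y z ->
  match i with
  | u1 => is_derive (fun t => f t y z) x (pd3 u1 f x y z)
  | u2 => is_derive (fun t => f x t z) y (pd3 u2 f x y z)
  | u3 => is_derive (fun t => f x y t) z (pd3 u3 f x y z)
  end.
Proof.
  intros Hf Hx. assert (E := smooth3_exd3 U f i x y z Hf Hx).
  destruct i; now apply Derive_correct.
Qed.

(** With [F2_w = 0], [probe_relation] becomes polynomial in [b] and [u]; its coefficients give
    [h A = G^3], [F3_ww = 0], [2 F3_wy G = G' h] and an equation for [F3_yy]. The derivative in [y]
    of the first, where [A] is constant, is [F3_wy A = 3 G^2 G']; with the third this forces
    [G' = 0]. *)
Lemma determining_equations_1 U F1 F2 F3 x y z :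
  is_point_transformation U F1 F2 F3 -> preserves_solutions U F1 F2 F3 -> U x y z ->
  pd3 u3 F3 x y z * pd3 u1 F1 x y z = pd3 u2 F2 x y z ^ 3 /\
  pd3 u2 (pd3 u2 F2) x y z = 0 /\
  pd3 u3 (pd3 u3 F3) x y z = 0 /\
  pd3 u2 (pd3 u3 F3) x y z = 0 /\
  pd3 u2 (pd3 u2 F3) x y z * pd3 u1 F1 x y z = pd3 u1 F2 x y z * pd3 u2 F2 x y z ^ 2.
Proof.
  intros HT HP H0. assert (HT' := HT). destruct HT' as [HU [S1 [S2 [S3 _]]]].
  assert (I2 := fun x y z => F2_independent_of_w U F1 F2 F3 x y z HT HP).
  assert (Main : forall x y z, U x y z ->
    let A := pd3 u1 F1 x y z in let G := pd3 u2 F2 x y z in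
    let G' := pd3 u2 (pd3 u2 F2) x y z in let h := pd3 u3 F3 x y z in
    h * A = G ^ 3 /\ pd3 u3 (pd3 u3 F3) x y z = 0 /\
    2 * pd3 u2 (pd3 u3 F3) x y z * G = G' * h /\
    (pd3 u2 (pd3 u2 F3) x y z * G - G' * pd3 u2 F3 x y z) * A = pd3 u1 F2 x y z * G ^ 3).
  { clear x y z H0. intros x y z H0 A G G' h.
    destruct (I2 x y z H0) as [E3 NG]. fold G in NG.
    destruct (F1_x_neq0 U F1 F2 F3 x y z HT HP H0) as [NA _]. fold A in NA.
    assert (E23 : pd3 u2 (pd3 u3 F2) x y z = 0) by (apply (pd3_zero U); trivial; apply I2).
    assert (E33 : pd3 u3 (pd3 u3 F2) x y z = 0) by (apply (pd3_zero U); trivial; apply I2).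
    assert (R := fun b u => probe_relation U F1 F2 F3 x y z 0 b u HT HP H0).
    cbv zeta in R. rewrite E3 E23 E33 in R.
    fold G A G' h in R.
    assert (NG' : forall b, G + 0 * b <> 0) by (intros b; now rewrite Rmult_0_l Rplus_0_r).
    (* These four values of [(b, u)] separate the coefficients of [1], [u], [b] and [b^2]. *)
    assert (R00 := R 0 0 (NG' 0)). assert (R01 := R 0 1 (NG' 0)).
    assert (R10 := R 1 0 (NG' 1)). assert (Rm0 := R (-1) 0 (NG' (-1))). clear R.
    set (f22 := pd3 u2 (pd3 u2 F3) x y z) in *. set (f23 := pd3 u2 (pd3 u3 F3) x y z) in *.
    set (f33 := pd3 u3 (pd3 u3 F3) x y z) in *. set (f2 := pd3 u2 F3 x y z) in *.
    set (c := pd3 u1 F2 x y z) in *.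
    assert (NAG : A * G <> 0) by now apply Rmult_integral_contrapositive_currified.
    split; [|split; [|split]].
    - apply Rmult_eq_reg_r with G; trivial. lra.
    - apply Rmult_eq_reg_l with (A * G); trivial. lra.
    - apply Rmult_eq_reg_l with A; trivial. lra.
    - lra. }
  destruct (Main x y z H0) as [M1 [M2 [M3 M4]]]. cbv zeta in M1, M2, M3, M4.
  destruct (I2 x y z H0) as [_ NG].
  destruct (F1_x_neq0 U F1 F2 F3 x y z HT HP H0) as [NA _].
  assert (A2 : pd3 u2 (pd3 u1 F1) x y z = 0).
  { rewrite (pd3_comm U F1 u2 u1) //. apply (pd3_zero U); trivial. intros a b c Habc.
    now apply (F1_depends_on_x U F1 F2 F3). }
  assert (D : pd3 u2 (pd3 u3 F3) x y z * pd3 u1 F1 x y z =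
              3 * pd3 u2 F2 x y z ^ 2 * pd3 u2 (pd3 u2 F2) x y z).
  { assert (D1 := is_derive_pd3 U _ u2 x y z (smooth3_pd3 U u3 F3 S3) H0).
    assert (D2 := is_derive_pd3 U _ u2 x y z (smooth3_pd3 U u1 F1 S1) H0).
    assert (D3 := is_derive_pd3 U _ u2 x y z (smooth3_pd3 U u2 F2 S2) H0).
    cbv beta iota in D1, D2, D3. rewrite A2 in D2.
    assert (L : is_derive (fun t => pd3 u3 F3 x t z * pd3 u1 F1 x t z) y
       (pd3 u2 (pd3 u3 F3) x y z * pd3 u1 F1 x y z + pd3 u3 F3 x y z * 0)).
    { apply: is_derive_mult; trivial. intros; apply Rmult_comm. }
    assert (Rr : is_derive (fun t => pd3 u2 F2 x t z ^ 3) y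
       (INR 3 * pd3 u2 (pd3 u2 F2) x y z * pd3 u2 F2 x y z ^ 2))
      by exact (is_derive_pow (fun t => pd3 u2 F2 x t z) 3 y _ D3).
    apply is_derive_unique in L. apply is_derive_unique in Rr.
    rewrite (Derive_ext_loc _ (fun t => pd3 u2 F2 x t z ^ 3)) in L.
    - rewrite Rr in L. simpl INR in L. lra.
    - destruct (open3_slices U x y z HU H0) as [_ [L2 _]]. revert L2. apply filter_imp.
      intros t Ht. now apply Main. }
  assert (G0 : pd3 u2 (pd3 u2 F2) x y z = 0).
  (* Multiplying [2 F3_wy G = G' h] by [A] and substituting yields [6 G^3 G' = G^3 G'], whence the
     5. *)
  { apply Rmult_eq_reg_l with (5 * pd3 u2 F2 x y z ^ 3).
    2: { apply Rmult_integral_contrapositive_currified; [lra|now apply pow_nonzero]. }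
    transitivity (2 * (3 * pd3 u2 F2 x y z ^ 2 * pd3 u2 (pd3 u2 F2) x y z) * pd3 u2 F2 x y z
      - pd3 u2 (pd3 u2 F2) x y z * pd3 u2 F2 x y z ^ 3); [ring|].
    rewrite -D -M1. transitivity (pd3 u1 F1 x y z * (2 * pd3 u2 (pd3 u3 F3) x y z * pd3 u2 F2 x y z)
      - pd3 u2 (pd3 u2 F2) x y z * (pd3 u3 F3 x y z * pd3 u1 F1 x y z)); [ring|].
    rewrite M3; ring. }
  split; [exact M1|]. split; [exact G0|]. split; [exact M2|]. split.
  - apply Rmult_eq_reg_r with (pd3 u1 F1 x y z); trivial. rewrite D G0. ring.
  - apply Rmult_eq_reg_r with (pd3 u2 F2 x y z); trivial. rewrite G0 in M4.
    transitivity ((pd3 u2 (pd3 u2 F3) x y z * pd3 u2 F2 x y z - 0 * pd3 u2 F3 x y z)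
      * pd3 u1 F1 x y z); [ring|]. rewrite M4. ring.
Qed.

(** Along a solution with constant [w_22 = u], the identity [g A = F2_x + u F2_y] for [g = Z_YY]
    holds on a neighbourhood and may be differentiated. It also turns [d/dX + g d/dY] into
    [(d/dx + u d/dy) / X_x], so the transformed equation reads [g_x + u g_y = 0]. The result is
    affine in [u] and splits at [u = 0] and [u = 1]. *)
Lemma determining_equations_2 U F1 F2 F3 x y z :
  is_point_transformation U F1 F2 F3 -> preserves_solutions U F1 F2 F3 -> U x y z ->
  pd3 u1 F1 x y z * pd3 u1 (pd3 u1 F2) x y z = pd3 u1 (pd3 u1 F1) x y z * pd3 u1 F2 x y z /\
  2 * pd3 u1 F1 x y z * pd3 u2 (pd3 u1 F2) x y z
    = pd3 u1 (pd3 u1 F1) x y z * pd3 u2 F2 x y z.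
Proof.
  intros HT HP H0. assert (HT' := HT). destruct HT' as [HU [S1 [S2 [S3 _]]]].
  assert (Main : forall u,
    pd3 u1 F1 x y z * (pd3 u1 (pd3 u1 F2) x y z + 2 * u * pd3 u2 (pd3 u1 F2) x y z)
    = pd3 u1 (pd3 u1 F1) x y z * (pd3 u1 F2 x y z + u * pd3 u2 F2 x y z)).
  2: { assert (M0 := Main 0). assert (M1 := Main 1). lra. }
  intros u.
  destruct (probe_local U x y z 0 0 u HU H0) as [d [Hx [Hw HS]]].
  destruct (probe_jets x y z 0 0 u 0 0 0) as [V [D1 [D2 _]]].
  assert (W22 : forall x' y', pd2 v2 (pd2 v2 (probe x y z 0 0 u 0 0 0)) x' y' = u).
  { intros x' y'. rewrite pd2_pd2_probe; [|split; trivial; lra]. field. }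
  set (w := probe x y z 0 0 u 0 0 0) in *.
  assert (Gr := proj2 (proj2 (proj2 Hw))).
  pose (X := fun x y => F1 x y (w x y)). pose (Y := fun x y => F2 x y (w x y)).
  pose (Z := fun x y => F3 x y (w x y)).
  assert (X1 : forall x' y', box x y d x' y' -> pd2 v1 X x' y' = pd3 u1 F1 x' y' (w x' y')).
  { intros x' y' Hb. unfold X. rewrite (pd2_along U F1 (box x y d) w) //.
    destruct (F1_depends_on_x U F1 F2 F3 _ _ _ HT HP (Gr _ _ Hb)) as [_ A].
    rewrite A. simpl emb. ring. }
  assert (X2 : forall x' y', box x y d x' y' -> pd2 v2 X x' y' = 0).
  { intros x' y' Hb. unfold X. rewrite (pd2_along U F1 (box x y d) w) //.
    destruct (F1_depends_on_x U F1 F2 F3 _ _ _ HT HP (Gr _ _ Hb)) as [A B].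
    simpl emb. rewrite A B. ring. }
  assert (EY : forall i x' y', box x y d x' y' ->
            pd2 i Y x' y' = pd3 (emb i) F2 x' y' (w x' y')).
  { intros i x' y' Hb. unfold Y. rewrite (pd2_along U F2 (box x y d) w) //.
    destruct (F2_independent_of_w U F1 F2 F3 _ _ _ HT HP (Gr _ _ Hb)) as [A _].
    rewrite A. ring. }
  assert (NJ : forall x' y', box x y d x' y' -> jac2 X Y x' y' <> 0).
  { intros x' y' Hb. unfold jac2. rewrite (X2 _ _ Hb) (X1 _ _ Hb) (EY v2 _ _ Hb).
    rewrite Rmult_0_l Rminus_0_r. apply Rmult_integral_contrapositive_currified.
    - apply (F1_x_neq0 U F1 F2 F3 _ _ _ HT HP (Gr _ _ Hb)).
    - apply (F2_independent_of_w U F1 F2 F3 _ _ _ HT HP (Gr _ _ Hb)). }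
  assert (SX := smooth2_graph U F1 _ w Hw S1). assert (SY := smooth2_graph U F2 _ w Hw S2).
  assert (SZ := smooth2_graph U F3 _ w Hw S3).
  assert (N : nondegenerate (box x y d) X Y)
    by (split; [apply open2_box|split; [exact SX|split; [exact SY|exact NJ]]]).
  pose (g := TD v2 X Y (TD v2 X Y Z)).
  assert (Sg : smooth2 (box x y d) g).
  { apply smooth2_nondegenerate_TD; trivial. now apply smooth2_nondegenerate_TD. }
  (* [probe_symbol] covers the base point only; on the whole box the identity follows from
     [determining_equations_1] and [TD2_vertical]. *)
  assert (Eg : forall x' y', box x y d x' y' ->
    g x' y' * pd3 u1 F1 x' y' (w x' y')
    = pd3 u1 F2 x' y' (w x' y') + u * pd3 u2 F2 x' y' (w x' y')).
  { intros x' y' Hb. assert (T := TD2_vertical _ X Y Z x' y' N SZ X2 Hb). fold g in T.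
    assert (EZ2 := pd22_along U F3 _ w x' y' Hw S3 Hb). fold Z in EZ2.
    assert (EY2 := pd22_along U F2 _ w x' y' Hw S2 Hb). fold Y in EY2.
    assert (HI := F2_independent_of_w U F1 F2 F3 _ _ _ HT HP (Gr _ _ Hb)).
    destruct (determining_equations_1 U F1 F2 F3 _ _ _ HT HP (Gr _ _ Hb))
      as [M1 [M2 [M3 [M4 M5]]]].
    assert (E23 : pd3 u2 (pd3 u3 F2) x' y' (w x' y') = 0).
    { apply (pd3_zero U); auto. intros. now apply (F2_independent_of_w U F1 F2 F3). }
    assert (E33 : pd3 u3 (pd3 u3 F2) x' y' (w x' y') = 0).
    { apply (pd3_zero U); auto. intros. now apply (F2_independent_of_w U F1 F2 F3). }
    rewrite M3 M4 W22 in EZ2. rewrite M2 E23 E33 (proj1 HI) in EY2.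
    rewrite EZ2 EY2 (EY v2 _ _ Hb) in T. simpl emb in T.
    apply Rmult_eq_reg_r with (pd3 u2 F2 x' y' (w x' y') ^ 3); [|apply pow_nonzero, HI].
    transitivity (g x' y' * pd3 u2 F2 x' y' (w x' y') ^ 3 * pd3 u1 F1 x' y' (w x' y'));
      [ring|]. rewrite T.
    transitivity ((pd3 u2 (pd3 u2 F3) x' y' (w x' y') * pd3 u1 F1 x' y' (w x' y')
      + u * (pd3 u3 F3 x' y' (w x' y') * pd3 u1 F1 x' y' (w x' y')))
      * pd3 u2 F2 x' y' (w x' y')); [ring|]. rewrite M5 M1. ring. }
  assert (T := transformed_equation U F1 F2 F3 (box x y d) w x y HU S1 S2 S3 HP HS Gr Hx
    (NJ _ _ Hx)).
  cbv zeta in T. fold X Y Z g in T.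
  assert (SA := smooth2_graph U _ _ w Hw (smooth3_pd3 U u1 F1 S1)).
  assert (SB := smooth2_graph U _ _ w Hw (smooth3_pd3 U u1 F2 S2)).
  assert (SG := smooth2_graph U _ _ w Hw (smooth3_pd3 U u2 F2 S2)).
  (* The probe has [a = b = 0], so at the base point total derivatives reduce to partial ones. *)
  assert (W0 : forall i, pd2 i w x y = 0) by (intros []; assumption).
  assert (DF : forall F i, smooth3 U F ->
            pd2 i (fun x y => F x y (w x y)) x y = pd3 (emb i) F x y z).
  { intros F i HF. rewrite (pd2_along U F (box x y d) w) // W0 V. ring. }
  assert (Dg : forall i, pd2 i g x y * pd3 u1 F1 x y z + g x y * pd3 (emb i) (pd3 u1 F1) x y z
    = pd3 (emb i) (pd3 u1 F2) x y z + u * pd3 (emb i) (pd3 u2 F2) x y z).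
  { intros i.
    assert (L := pd2_mult (box x y d) g (fun x y => pd3 u1 F1 x y (w x y)) i x y Sg SA Hx).
    rewrite (pd2_ext _ i _ _ x y (open2_box x y d) Hx Eg) in L.
    rewrite (pd2_plus (box x y d) (fun x y => pd3 u1 F2 x y (w x y))
      (fun x y => u * pd3 u2 F2 x y (w x y))) in L; trivial.
    - rewrite (pd2_mult (box x y d) (fun _ _ => u) (fun x y => pd3 u2 F2 x y (w x y))) in L;
        trivial.
      + rewrite (is_pd2_unique i _ x y 0 (is_pd2_const i u x y)) in L.
        rewrite !DF in L; try now apply smooth3_pd3. rewrite V in L. lra.
      + apply smooth2_alg; [apply open2_box|apply alg_const].
    - apply smooth2_mult; trivial; [apply open2_box|].
      apply smooth2_alg; [apply open2_box|apply alg_const]. }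
  assert (G0 := Eg x y Hx). rewrite V in G0.
  assert (NA := proj1 (F1_x_neq0 U F1 F2 F3 x y z HT HP H0)).
  assert (HI := F2_independent_of_w U F1 F2 F3 x y z HT HP H0).
  assert (G1 : pd2 v1 g x y + u * pd2 v2 g x y = 0).
  { assert (E : pd3 u2 F2 x y z * (pd2 v1 g x y + u * pd2 v2 g x y) = 0).
    { transitivity (jac2 X Y x y * (TD v1 X Y g x y + g x y * TD v2 X Y g x y));
        [|rewrite T; ring].
      unfold TD. unfold jac2. rewrite (X2 _ _ Hx) (X1 _ _ Hx) !(EY _ _ _ Hx) V. simpl emb.
      transitivity (pd3 u2 F2 x y z * pd2 v1 g x y - pd3 u1 F2 x y z * pd2 v2 g x y
        + g x y * pd3 u1 F1 x y z * pd2 v2 g x y); [rewrite G0; ring|]. field.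
      split; [apply HI|exact NA]. }
    apply Rmult_integral in E. destruct E as [E|E]; [|exact E]. now elim (proj2 HI). }
  assert (A2 : pd3 u2 (pd3 u1 F1) x y z = 0).
  { rewrite (pd3_comm U F1 u2 u1) //. apply (pd3_zero U); trivial. intros a b c Habc.
    now apply (F1_depends_on_x U F1 F2 F3). }
  assert (Q1 := Dg v1). assert (Q2 := Dg v2). simpl emb in Q1, Q2. rewrite A2 in Q2.
  destruct (determining_equations_1 U F1 F2 F3 x y z HT HP H0) as [_ [M2 _]].
  rewrite M2 in Q2. rewrite (pd3_comm U F2 u1 u2) // in Q1.
  transitivity (pd3 u1 F1 x y z * (g x y * pd3 u1 (pd3 u1 F1) x y z)).
  - apply (f_equal (Rmult u)) in Q2. f_equal.
    transitivity (pd3 u1 F1 x y z * (pd2 v1 g x y + u * pd2 v2 g x y)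
      + g x y * pd3 u1 (pd3 u1 F1) x y z); [lra|rewrite G1; ring].
  - rewrite -G0. ring.
Qed.

(** * Integration of the determining equations *)

(** The derivative in [y] of the first identity of [determining_equations_2], where [F1_x] and
    [F1_xx] are constant in [y]. It provides the second-order equation for the coefficient
    [F2_y]. *)
Lemma determining_equations_3 U F1 F2 F3 x y z :
  is_point_transformation U F1 F2 F3 -> preserves_solutions U F1 F2 F3 -> U x y z ->
  pd3 u1 F1 x y z * pd3 u1 (pd3 u1 (pd3 u2 F2)) x y z
    = pd3 u1 (pd3 u1 F1) x y z * pd3 u1 (pd3 u2 F2) x y z.
Proof.
  intros HT HP H0. assert (HT' := HT). destruct HT' as [HU [S1 [S2 [S3 _]]]].
  assert (Z : forall x y z, U x y z -> pd3 u2 (pd3 u1 F1) x y z = 0).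
  { intros a b c H. rewrite (pd3_comm U F1 u2 u1) //. apply (pd3_zero U); trivial.
    intros. now apply (F1_depends_on_x U F1 F2 F3). }
  assert (S11 := smooth3_pd3 U u1 F1 S1). assert (S12 := smooth3_pd3 U u1 F2 S2).
  assert (D1 := is_derive_pd3 U _ u2 x y z S11 H0).
  assert (D2 := is_derive_pd3 U _ u2 x y z (smooth3_pd3 U u1 _ S12) H0).
  assert (D3 := is_derive_pd3 U _ u2 x y z (smooth3_pd3 U u1 _ S11) H0).
  assert (D4 := is_derive_pd3 U _ u2 x y z S12 H0).
  cbv beta iota in D1, D2, D3, D4. rewrite (Z x y z H0) in D1.
  rewrite (pd3_comm U _ u2 u1 x y z HU S11 H0) (pd3_zero U u1 _ x y z HU H0 Z) in D3.
  rewrite (pd3_comm U _ u2 u1 x y z HU S12 H0) in D2.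
  rewrite (pd3_ext U u1 _ (pd3 u1 (pd3 u2 F2)) x y z HU H0) in D2;
    [|intros; now apply (pd3_comm U)].
  rewrite (pd3_comm U _ u2 u1 x y z HU S2 H0) in D4.
  assert (L : is_derive (fun t => pd3 u1 F1 x t z * pd3 u1 (pd3 u1 F2) x t z) y
     (0 * pd3 u1 (pd3 u1 F2) x y z + pd3 u1 F1 x y z * pd3 u1 (pd3 u1 (pd3 u2 F2)) x y z))
    by (apply: is_derive_mult; trivial; intros; apply Rmult_comm).
  assert (M : is_derive (fun t => pd3 u1 (pd3 u1 F1) x t z * pd3 u1 F2 x t z) y
     (0 * pd3 u1 F2 x y z + pd3 u1 (pd3 u1 F1) x y z * pd3 u1 (pd3 u2 F2) x y z))
    by (apply: is_derive_mult; trivial; intros; apply Rmult_comm).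
  apply is_derive_unique in L. apply is_derive_unique in M.
  rewrite (Derive_ext_loc _ (fun t => pd3 u1 (pd3 u1 F1) x t z * pd3 u1 F2 x t z)) in L.
  - rewrite M in L. lra.
  - destruct (open3_slices U x y z HU H0) as [_ [L2 _]]. revert L2. apply filter_imp.
    intros t Ht. now apply (determining_equations_2 U F1 F2 F3).
Qed.

Lemma constant_slope (f : R -> R) t0 d c t :
  (forall s, Rabs (s - t0) < d -> is_derive f s c) -> Rabs (t - t0) < d ->
  f t = f t0 + c * (t - t0).
Proof.
  intros H Ht.
  assert (B : Rabs ((f t - c * t) - (f t0 - c * t0)) <= 0 * Rabs (t - t0)).
  { apply (increment_bound (fun s => f s - c * s) (fun _ => 0)). intros s Hs.
    assert (Hd : Rabs (s - t0) < d).
    { apply Rabs_lt_between' in Ht. apply Rabs_lt_between'.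
      assert (0 < d \/ d <= 0) by lra.
      unfold Rmin, Rmax in Hs. destruct (Rle_dec t0 t); lra. }
    split; [|rewrite Rabs_R0; lra]. specialize (H s Hd).
    auto_derive; [now exists c|]. rewrite (is_derive_unique _ _ _ H). ring. }
  rewrite Rmult_0_l in B. apply Rminus_diag_uniq.
  destruct (Req_dec (f t - (f t0 + c * (t - t0))) 0) as [|N]; trivial.
  apply Rabs_pos_lt in N.
  replace (f t - (f t0 + c * (t - t0))) with (f t - c * t - (f t0 - c * t0)) in N by ring. lra.
Qed.

(* Since [a1/A] is a constant [s] and [(a/A)' = -s], the quotient [r = a/A] is affine; then
   [m = a r] is constant, and [q = r/m] makes [f q] affine. *)
Lemma mobius_integration (f A A1 a a1 a2 b B B1 : R -> R) x0 d :
  0 < d ->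
  (forall x, Rabs (x - x0) < d ->
     is_derive f x (A x) /\ is_derive A x (A1 x) /\ is_derive a x (a1 x) /\
     is_derive a1 x (a2 x) /\ is_derive b x (B x) /\ is_derive B x (B1 x) /\
     A x <> 0 /\ a x <> 0 /\ 2 * A x * a1 x = A1 x * a x /\
     A x * a2 x = A1 x * a1 x /\ A x * B1 x = A1 x * B x) ->
  exists c1 c2 c3 c4 kappa gamma, c1 * c4 - c2 * c3 <> 0 /\
  forall x, Rabs (x - x0) < d -> let q := c3 * x + c4 in
    q <> 0 /\ f x = (c1 * x + c2) / q /\ a x = / q /\ A x = (c1 * c4 - c2 * c3) / q ^ 2 /\
    a1 x = - c3 / q ^ 2 /\ b x = kappa * f x + gamma /\ B x = kappa * A x.
Proof.
  intros Hd H.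
  assert (I0 : Rabs (x0 - x0) < d) by now rewrite Rminus_diag Rabs_R0.
  pose (s := a1 x0 / A x0).
  assert (Es : forall x, Rabs (x - x0) < d -> a1 x = s * A x).
  { intros x Hx. assert (NA : A x <> 0) by apply (H x Hx).
    assert (E := constant_slope (fun x => a1 x / A x) x0 d 0 x). cbv beta in E. fold s in E.
    apply (Rmult_eq_reg_r (/ A x)); [|now apply Rinv_neq_0_compat].
    transitivity s; [|field; exact NA].
    unfold Rdiv in E. rewrite E //; [ring|]. clear x Hx NA E. intros x Hx.
    destruct (H x Hx) as [_ [HA [_ [Ha1 [_ [_ [NA [_ [_ [E2 _]]]]]]]]]].
    auto_derive; [repeat split; trivial; eexists; eassumption|].
    rewrite (is_derive_unique _ _ _ HA) (is_derive_unique _ _ _ Ha1).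
    transitivity ((A x * a2 x - A1 x * a1 x) / A x ^ 2); [field; exact NA|].
    rewrite E2. field. exact NA. }
  pose (r := fun x => a x / A x).
  assert (Dr : forall x, Rabs (x - x0) < d -> is_derive r x (- s)).
  { intros x Hx. assert (E := Es x Hx).
    destruct (H x Hx) as [_ [HA [Ha [_ [_ [_ [NA [_ [E1 _]]]]]]]]]. unfold r.
    auto_derive; [repeat split; trivial; eexists; eassumption|].
    rewrite (is_derive_unique _ _ _ HA) (is_derive_unique _ _ _ Ha).
    transitivity ((a1 x * A x - A1 x * a x) / A x ^ 2); [field; exact NA|].
    rewrite -E1 E. field. exact NA. }
  assert (Er := fun x => constant_slope r x0 d (- s) x Dr).
  pose (m := a x0 * r x0).
  assert (Em : forall x, Rabs (x - x0) < d -> a x * r x = m).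
  { intros x Hx. rewrite (constant_slope (fun x => a x * r x) x0 d 0 x) //; [unfold m; ring|].
    clear x Hx. intros x Hx. assert (E := Es x Hx). assert (D := Dr x Hx).
    destruct (H x Hx) as [_ [_ [Ha [_ [_ [_ [NA _]]]]]]].
    auto_derive; [repeat split; trivial; eexists; eassumption|].
    change (fun x => r x) with r.
    rewrite (is_derive_unique _ _ _ D) (is_derive_unique _ _ _ Ha) E. unfold r. field. exact NA. }
  assert (Nr : forall x, Rabs (x - x0) < d -> r x <> 0).
  { intros x Hx. unfold r, Rdiv. apply Rmult_integral_contrapositive_currified;
    [|apply Rinv_neq_0_compat]; apply (H x Hx). }
  assert (Nm : m <> 0).
  { unfold m. apply Rmult_integral_contrapositive_currified; [apply (H x0 I0)|now apply Nr]. }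
  (* A Moebius map fixes its coefficients only up to a common factor. Dividing by [m] normalises
     them so that [a = / q], the coefficient of [y] in the stated form of [F2]; the determinant
     becomes [/ m]. *)
  pose (c3 := - s / m). pose (c4 := (r x0 + s * x0) / m).
  assert (Eq : forall x, Rabs (x - x0) < d -> c3 * x + c4 = r x / m).
  { intros x Hx. rewrite (Er x Hx). unfold c3, c4. field. exact Nm. }
  assert (Nq : forall x, Rabs (x - x0) < d -> c3 * x + c4 <> 0).
  { intros x Hx. rewrite (Eq x Hx). unfold Rdiv.
    apply Rmult_integral_contrapositive_currified; [now apply Nr|now apply Rinv_neq_0_compat]. }
  assert (Ea : forall x, Rabs (x - x0) < d -> a x = / (c3 * x + c4)).
  { intros x Hx. rewrite (Eq x Hx). assert (N := Nr x Hx).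
    apply (Rmult_eq_reg_r (r x)); trivial. rewrite (Em x Hx). field. now split. }
  assert (EA : forall x, Rabs (x - x0) < d -> A x = / (m * (c3 * x + c4) ^ 2)).
  { intros x Hx. assert (N := Nr x Hx). rewrite (Eq x Hx).
    assert (NA : A x <> 0) by apply (H x Hx).
    apply (Rmult_eq_reg_r (r x)); trivial.
    transitivity (a x); [unfold r; field; exact NA|].
    apply (Rmult_eq_reg_r (r x)); trivial. rewrite (Em x Hx). field. now split. }
  (* The derivative of [f q], which is constant because of [2 A a1 = A1 a]. *)
  pose (c1 := A x0 * (c3 * x0 + c4) + f x0 * c3).
  assert (Ec1 : forall x, Rabs (x - x0) < d -> A x * (c3 * x + c4) + f x * c3 = c1).
  { intros x Hx. rewrite (constant_slope (fun x => A x * (c3 * x + c4) + f x * c3) x0 d 0 x) //;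
      [unfold c1; ring|].
    clear x Hx. intros x Hx. assert (E := Es x Hx). assert (Ax := EA x Hx).
    assert (ax := Ea x Hx). assert (N := Nq x Hx).
    destruct (H x Hx) as [Hf [HA [_ [_ [_ [_ [NA [Na [E1 _]]]]]]]]].
    auto_derive; [repeat split; trivial; eexists; eassumption|].
    rewrite (is_derive_unique _ _ _ Hf) (is_derive_unique _ _ _ HA).
    assert (A1x : A1 x = 2 * A x * (s * A x) / a x) by (rewrite -E E1; field; exact Na).
    rewrite A1x ax Ax. replace s with (- c3 * m) by (unfold c3; field; exact Nm).
    field. now split. }
  pose (c2 := f x0 * (c3 * x0 + c4) - c1 * x0).
  assert (Ef : forall x, Rabs (x - x0) < d -> f x * (c3 * x + c4) = c1 * x + c2).
  { intros x Hx. rewrite (constant_slope (fun x => f x * (c3 * x + c4)) x0 d c1 x) //;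
      [unfold c2; ring|].
    clear x Hx. intros x Hx. assert (E := Ec1 x Hx). destruct (H x Hx) as [Hf _].
    auto_derive; [repeat split; trivial; eexists; eassumption|].
    rewrite (is_derive_unique _ _ _ Hf). lra. }
  assert (ED : c1 * c4 - c2 * c3 = / m).
  { assert (N := Nq x0 I0).
    transitivity (A x0 * (c3 * x0 + c4) ^ 2); [unfold c2, c1; ring|].
    rewrite (EA x0 I0). field. now split. }
  (* [A B1 = A1 B] makes [B / A] constant, so [b] is an affine function of [f]. *)
  pose (kappa := B x0 / A x0).
  assert (EB : forall x, Rabs (x - x0) < d -> B x = kappa * A x).
  { intros x Hx. assert (NA : A x <> 0) by apply (H x Hx).
    assert (E := constant_slope (fun x => B x / A x) x0 d 0 x). cbv beta in E. fold kappa in E.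
    apply (Rmult_eq_reg_r (/ A x)); [|now apply Rinv_neq_0_compat].
    transitivity kappa; [|field; exact NA].
    unfold Rdiv in E. rewrite E //; [ring|]. clear x Hx NA E. intros x Hx.
    destruct (H x Hx) as [_ [HA [_ [_ [_ [HB [NA [_ [_ [_ E3]]]]]]]]]].
    auto_derive; [repeat split; trivial; eexists; eassumption|].
    rewrite (is_derive_unique _ _ _ HA) (is_derive_unique _ _ _ HB).
    transitivity ((A x * B1 x - A1 x * B x) / A x ^ 2); [field; exact NA|].
    rewrite E3. field. exact NA. }
  exists c1, c2, c3, c4, kappa, (b x0 - kappa * f x0).
  split; [rewrite ED; now apply Rinv_neq_0_compat|]. intros x Hx q.
  assert (N := Nq x Hx). fold q in N. split; [exact N|].
  split; [rewrite -(Ef x Hx); unfold q; field; exact N|]. split; [now apply Ea|].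
  split; [rewrite (EA x Hx) ED; fold q; field; now split|].
  split; [rewrite (Es x Hx) (EA x Hx); fold q; replace s with (- c3 * m)
    by (unfold c3; field; exact Nm); field; now split|].
  split; [|now apply EB].
  assert (E := constant_slope (fun x => b x - kappa * f x) x0 d 0 x). cbv beta in E.
  assert (E' : b x - kappa * f x = b x0 - kappa * f x0 + 0 * (x - x0)); [|lra].
  apply E; trivial. clear E. intros t Ht.
  destruct (H t Ht) as [Hf [_ [_ [_ [Hb _]]]]].
  auto_derive; [repeat split; trivial; eexists; eassumption|].
  rewrite (is_derive_unique _ _ _ Hf) (is_derive_unique _ _ _ Hb) (EB t Ht). ring.
Qed.

Lemma smooth1_of_smooth2 O f x0 d y :
  smooth2 O f -> (forall x, Rabs (x - x0) < d -> O x y) ->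
  smooth1 (x0 - d) (x0 + d) (fun x => f x y).
Proof.
  intros Hf HO n x Hx. apply (ex_derive_ext (fun t => pds2 (repeat v1 n) f t y)).
  - induction n as [|n IH]; intros t; [reflexivity|]. simpl. apply Derive_ext. exact IH.
  - assert (Hx' : Rabs (x - x0) < d) by (apply Rabs_lt_between'; lra).
    exact (proj2 (Hf (repeat v1 n) x y (HO x Hx')) v1).
Qed.

(** On a box inside [U] the dependence on [w] and on [y] is integrated along axis-parallel segments
    from the base values; the dependence on [x] is read off at [(y0, z0)] from [mobius_integration],
    with [f = F1], [a = F2_y], [b = F2]. *)
Lemma symmetry_has_G13_form U F1 F2 F3 :
  is_point_transformation U F1 F2 F3 -> preserves_solutions U F1 F2 F3 ->
  locally_G13_form U F1 F2 F3.
Proof.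
  intros HT HP x0 y0 z0 H0. assert (HT' := HT). destruct HT' as [HU [S1 [S2 [S3 _]]]].
  destruct (HU x0 y0 z0 H0) as [d [Hd HB]]. exists d. split; [exact Hd|].
  assert (Iy : Rabs (y0 - y0) < d) by now rewrite Rminus_diag Rabs_R0.
  assert (Iz : Rabs (z0 - z0) < d) by now rewrite Rminus_diag Rabs_R0.
  assert (HF1 := fun x y z => F1_depends_on_x U F1 F2 F3 x y z HT HP).
  assert (HF2 := fun x y z => F2_independent_of_w U F1 F2 F3 x y z HT HP).
  assert (HE := fun x y z => determining_equations_1 U F1 F2 F3 x y z HT HP).
  assert (HD := fun F SF i x y z => is_derive_pd3 U F i x y z SF).
  assert (L1 : forall x y, Rabs (x - x0) < d -> Rabs (y - y0) < d ->
     locally x (fun t => Rabs (t - x0) < d)).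
  { intros x y Hx Hy. apply (locally_Rabs _ _ (d - Rabs (x - x0))); [lra|].
    intros t Ht. assert (T := Rabs_triang (t - x) (x - x0)).
    replace (t - x + (x - x0)) with (t - x0) in T by ring. lra. }
  assert (EF1 : forall x y z, Rabs (x - x0) < d -> Rabs (y - y0) < d -> Rabs (z - z0) < d ->
     F1 x y z = F1 x y0 z0).
  { intros x y z Hx Hy Hz.
    rewrite (constant_slope (fun t => F1 x y t) z0 d 0 z) //.
    - rewrite (constant_slope (fun t => F1 x t z0) y0 d 0 y) //; [ring|].
      intros t Ht. assert (Ut := HB x t z0 Hx Ht Iz).
      rewrite -(proj1 (HF1 x t z0 Ut)). exact (HD F1 S1 u2 x t z0 Ut).
    - intros t Ht. assert (Ut := HB x y t Hx Hy Ht).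
      rewrite -(proj2 (HF1 x y t Ut)). exact (HD F1 S1 u3 x y t Ut). }
  assert (EG : forall x y, Rabs (x - x0) < d -> Rabs (y - y0) < d ->
     pd3 u2 F2 x y z0 = pd3 u2 F2 x y0 z0).
  { intros x y Hx Hy. rewrite (constant_slope (fun t => pd3 u2 F2 x t z0) y0 d 0 y) //; [ring|].
    intros t Ht. assert (Ut := HB x t z0 Hx Ht Iz).
    rewrite -(proj1 (proj2 (HE x t z0 Ut))).
    exact (HD _ (smooth3_pd3 U u2 F2 S2) u2 x t z0 Ut). }
  assert (EF2 : forall x y z, Rabs (x - x0) < d -> Rabs (y - y0) < d -> Rabs (z - z0) < d ->
     F2 x y z = F2 x y0 z0 + pd3 u2 F2 x y0 z0 * (y - y0)).
  { intros x y z Hx Hy Hz.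
    rewrite (constant_slope (fun t => F2 x y t) z0 d 0 z) //.
    - rewrite (constant_slope (fun t => F2 x t z0) y0 d (pd3 u2 F2 x y0 z0) y) //; [ring|].
      intros t Ht. assert (Ut := HB x t z0 Hx Ht Iz).
      rewrite -(EG x t Hx Ht). exact (HD F2 S2 u2 x t z0 Ut).
    - intros t Ht. assert (Ut := HB x y t Hx Hy Ht).
      rewrite -(proj1 (HF2 x y t Ut)). exact (HD F2 S2 u3 x y t Ut). }
  destruct (mobius_integration (fun x => F1 x y0 z0) (fun x => pd3 u1 F1 x y0 z0)
    (fun x => pd3 u1 (pd3 u1 F1) x y0 z0) (fun x => pd3 u2 F2 x y0 z0)
    (fun x => pd3 u1 (pd3 u2 F2) x y0 z0) (fun x => pd3 u1 (pd3 u1 (pd3 u2 F2)) x y0 z0)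
    (fun x => F2 x y0 z0) (fun x => pd3 u1 F2 x y0 z0)
    (fun x => pd3 u1 (pd3 u1 F2) x y0 z0) x0 d Hd)
    as [c1 [c2 [c3 [c4 [ka [ga [ND Int]]]]]]].
  { intros x Hx. assert (Ux := HB x y0 z0 Hx Iy Iz).
    assert (S22 := smooth3_pd3 U u2 F2 S2).
    destruct (determining_equations_2 U F1 F2 F3 x y0 z0 HT HP Ux) as [E1 E2].
    split; [exact (HD F1 S1 u1 x y0 z0 Ux)|].
    split; [exact (HD _ (smooth3_pd3 U u1 F1 S1) u1 x y0 z0 Ux)|].
    split; [exact (HD _ S22 u1 x y0 z0 Ux)|].
    split; [exact (HD _ (smooth3_pd3 U u1 _ S22) u1 x y0 z0 Ux)|].
    split; [exact (HD F2 S2 u1 x y0 z0 Ux)|].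
    split; [exact (HD _ (smooth3_pd3 U u1 F2 S2) u1 x y0 z0 Ux)|].
    split; [apply (F1_x_neq0 U F1 F2 F3 x y0 z0 HT HP Ux)|].
    split; [apply (HF2 x y0 z0 Ux)|].
    split; [rewrite (pd3_comm U F2 u1 u2) //|].
    split; [apply (determining_equations_3 U F1 F2 F3 x y0 z0 HT HP Ux)|exact E1]. }
  cbv beta zeta in Int.
  set (D := c1 * c4 - c2 * c3) in *.
  (* The value of [c3 * c6 - c4 * c5] for the constants chosen below, as verified in [EK]. *)
  pose (K := - ka * D - c3 * y0).
  (* [W1] and [W0] are the constants of the two integrations in [y]: [F3_y] and [F3] at [(y0, z0)],
     corrected by the lower limits of the polynomials and by the term linear in [w]. A second
     variable lets [alg] prove smoothness; they are used at [y = y0]. *)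
  pose (W1 := fun x y => pd3 u2 F3 x y z0
    + (c3 * y0 ^ 2 / 2 + K * y0) / (D * ((c3 * x + c4) * (c3 * x + c4)))).
  pose (W0 := fun x y => F3 x y z0
    + (c3 * y0 ^ 3 / 6 + K * y0 ^ 2 / 2) / (D * ((c3 * x + c4) * (c3 * x + c4)))
    + - z0 / (D * (c3 * x + c4)) + - W1 x y * y0).
  assert (SW : smooth2 (box x0 y0 d) W1 /\ smooth2 (box x0 y0 d) W0).
  { assert (Ob : open2 (fun x y => box x0 y0 d x y)) by apply open2_box.
    assert (Q : alg (box x0 y0 d) (fun x _ => c3 * x + c4)).
    { apply alg_plus; [apply alg_mult; [apply alg_const|apply alg_fst]|apply alg_const]. }
    assert (NQ : forall x y, box x0 y0 d x y -> c3 * x + c4 <> 0)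
      by (intros x y [Hx _]; apply (Int x Hx)).
    assert (NDQ : forall x y, box x0 y0 d x y -> D * (c3 * x + c4) <> 0)
      by (intros x y Hb; apply Rmult_integral_contrapositive_currified; [exact ND|eauto]).
    assert (NDQ2 : forall x y, box x0 y0 d x y -> D * ((c3 * x + c4) * (c3 * x + c4)) <> 0).
    { intros x y Hb. repeat apply Rmult_integral_contrapositive_currified;
      [exact ND|eauto|eauto]. }
    assert (SF : forall F, smooth3 U F -> alg (box x0 y0 d) (fun x y => F x y z0)).
    { intros F HF. apply (alg_comp _ U F (fun _ _ => z0)); trivial.
      - apply smooth2_alg; [apply open2_box|apply alg_const].
      - intros x y [Hx Hy]. now apply HB. }
    assert (A1 : alg (box x0 y0 d) W1).
    { apply alg_plus; [apply (SF (pd3 u2 F3)); now apply smooth3_pd3|].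
      apply alg_div; [apply alg_const| |exact NDQ2].
      apply alg_mult; [apply alg_const|now apply alg_mult]. }
    split; (apply smooth2_alg; [apply open2_box|]); trivial.
    apply alg_plus; [apply alg_plus; [apply alg_plus; [now apply SF|]|]|].
    - apply alg_div; [apply alg_const| |exact NDQ2].
      apply alg_mult; [apply alg_const|now apply alg_mult].
    - apply alg_div; [apply alg_const| |exact NDQ]. now apply alg_mult; [apply alg_const|].
    - apply alg_mult; [now apply alg_opp|apply alg_const]. }
  (* [F2 = b + a * (y - y0)] with [b = ka * f + ga], brought over the denominator [q], yields [c5]
     and [c6]. *)
  exists c1, c2, c3, c4, (ka * c1 + ga * c3), (ka * c2 + ga * c4 - y0).
  split; [exact ND|].
  exists (fun x => W0 x y0), (fun x => W1 x y0).
  split; [apply (smooth1_of_smooth2 (box x0 y0 d)); [apply SW|now split]|].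
  split; [apply (smooth1_of_smooth2 (box x0 y0 d)); [apply SW|now split]|].
  intros x y z _ Hx Hy Hz.
  destruct (Int x Hx) as [Nq [If [Ia [IA [Ia1 [Ib IB]]]]]].
  unfold G13_form. cbv zeta. fold D. set (q := c3 * x + c4) in *.
  split; [exact Nq|]. split; [now rewrite EF1|].
  split.
  { rewrite EF2 // Ia Ib If. unfold q. field. exact Nq. }
  assert (EA : forall t, Rabs (t - y0) < d -> pd3 u1 F1 x t z0 = D / q ^ 2).
  { intros t Ht. rewrite -IA. apply Derive_ext_loc.
    generalize (L1 x t Hx Ht). apply filter_imp. intros s Hs. now apply EF1. }
  assert (EB : forall t, Rabs (t - y0) < d ->
     pd3 u1 F2 x t z0 = ka * (D / q ^ 2) + - c3 / q ^ 2 * (t - y0)).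
  { intros t Ht. apply is_derive_unique.
    apply (is_derive_ext_loc (fun s => F2 s y0 z0 + pd3 u2 F2 s y0 z0 * (t - y0))).
    - generalize (L1 x t Hx Ht). apply filter_imp. intros s Hs. symmetry. now apply EF2.
    - assert (Ux := HB x y0 z0 Hx Iy Iz).
      assert (D1 := HD F2 S2 u1 x y0 z0 Ux).
      assert (D2 := HD _ (smooth3_pd3 U u2 F2 S2) u1 x y0 z0 Ux). cbv beta iota in D1, D2.
      rewrite IB IA in D1. rewrite Ia1 in D2.
      apply (is_derive_plus (fun s => F2 s y0 z0) (fun s => pd3 u2 F2 s y0 z0 * (t - y0))
        x _ _ D1).
      apply (is_derive_scal_l (fun s => pd3 u2 F2 s y0 z0) x _ (t - y0) D2). }
  assert (EW : forall t r, Rabs (t - y0) < d -> Rabs (r - z0) < d ->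
     pd3 u3 F3 x t r = / (D * q)).
  { assert (E0 : pd3 u3 F3 x y0 z0 = / (D * q)).
    { assert (Ux := HB x y0 z0 Hx Iy Iz). destruct (HE x y0 z0 Ux) as [E _].
      rewrite Ia IA in E. apply (Rmult_eq_reg_r (D / q ^ 2)).
      - rewrite E. field. now split.
      - unfold Rdiv. apply Rmult_integral_contrapositive_currified; trivial.
        apply Rinv_neq_0_compat. now apply pow_nonzero. }
    intros t r Ht Hr. rewrite -E0.
    rewrite (constant_slope (fun s => pd3 u3 F3 x t s) z0 d 0 r) //.
    - rewrite (constant_slope (fun s => pd3 u3 F3 x s z0) y0 d 0 t) //; [ring|].
      intros s Hs. assert (Us := HB x s z0 Hx Hs Iz).
      destruct (HE x s z0 Us) as [_ [_ [_ [E _]]]]. rewrite -E.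
      exact (HD _ (smooth3_pd3 U u3 F3 S3) u2 x s z0 Us).
    - intros s Hs. assert (Us := HB x t s Hx Ht Hs).
      destruct (HE x t s Us) as [_ [_ [E _]]]. rewrite -E.
      exact (HD _ (smooth3_pd3 U u3 F3 S3) u3 x t s Us). }
  (* [F3_yy = F2_x F2_y^2 / F1_x] is affine in [y]; two integrations produce the cubic. *)
  assert (Eyy : forall t, Rabs (t - y0) < d ->
     pd3 u2 (pd3 u2 F3) x t z0 = - (c3 * t + K) / (D * q ^ 2)).
  { intros t Ht. assert (Ut := HB x t z0 Hx Ht Iz).
    destruct (HE x t z0 Ut) as [_ [_ [_ [_ E]]]].
    rewrite (EA t Ht) (EB t Ht) (EG x t Hx Ht) Ia in E.
    apply (Rmult_eq_reg_r (D / q ^ 2)).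
    - rewrite E. unfold K. field. now split.
    - unfold Rdiv. apply Rmult_integral_contrapositive_currified; trivial.
      apply Rinv_neq_0_compat. now apply pow_nonzero. }
  rewrite (constant_slope (fun r => F3 x y r) z0 d (/ (D * q)) z) //.
  2: { intros r Hr. rewrite -(EW y r Hy Hr). exact (HD F3 S3 u3 x y r (HB x y r Hx Hy Hr)). }
  assert (Fy : forall t, Rabs (t - y0) < d ->
     pd3 u2 F3 x t z0 = - (c3 * t ^ 2 / 2 + K * t) / (D * q ^ 2) + W1 x y0).
  { intros t Ht.
    assert (C := constant_slope
      (fun t => pd3 u2 F3 x t z0 + (c3 * t ^ 2 / 2 + K * t) / (D * q ^ 2)) y0 d 0 t).
    cbv beta in C. unfold W1. fold q.
    assert (E : pd3 u2 F3 x t z0 + (c3 * t ^ 2 / 2 + K * t) / (D * q ^ 2) =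
       pd3 u2 F3 x y0 z0 + (c3 * y0 ^ 2 / 2 + K * y0) / (D * q ^ 2)).
    { rewrite C //; [ring|]. clear C t Ht. intros t Ht.
      assert (D2 := HD _ (smooth3_pd3 U u2 F3 S3) u2 x t z0 (HB x t z0 Hx Ht Iz)).
      cbv beta iota in D2. rewrite (Eyy t Ht) in D2.
      auto_derive; [repeat split; trivial; eexists; eassumption|].
      rewrite (is_derive_unique _ _ _ D2). field. now split. }
    replace (q ^ 2) with (q * q) in E by ring. replace (q ^ 2) with (q * q) by ring.
    unfold Rdiv in *. lra. }
  assert (FF : F3 x y z0 + (c3 * y ^ 3 / 6 + K * y ^ 2 / 2) / (D * q ^ 2) =
     F3 x y0 z0 + (c3 * y0 ^ 3 / 6 + K * y0 ^ 2 / 2) / (D * q ^ 2) + W1 x y0 * (y - y0)).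
  { apply (constant_slope (fun t => F3 x t z0 + (c3 * t ^ 3 / 6 + K * t ^ 2 / 2) / (D * q ^ 2))
      y0 d (W1 x y0) y); trivial. intros t Ht.
    assert (D2 := HD F3 S3 u2 x t z0 (HB x t z0 Hx Ht Iz)).
    cbv beta iota in D2. rewrite (Fy t Ht) in D2.
    auto_derive; [repeat split; trivial; eexists; eassumption|].
    rewrite (is_derive_unique _ _ _ D2). field. now split. }
  assert (EK : c3 * (ka * c2 + ga * c4 - y0) - c4 * (ka * c1 + ga * c3) = K)
    by (unfold K, D; ring).
  rewrite EK.
  replace (F3 x y z0) with (F3 x y0 z0 + (c3 * y0 ^ 3 / 6 + K * y0 ^ 2 / 2) / (D * q ^ 2)
    + W1 x y0 * (y - y0) - (c3 * y ^ 3 / 6 + K * y ^ 2 / 2) / (D * q ^ 2)) by lra.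
  unfold W0. fold q. set (w1 := W1 x y0). field. now split.
Qed.

(** * The transformations of the stated form are symmetries *)

(* [rho = D / q] is the denominator of the inverse Moebius transformation. *)
Lemma transformed_is_solution c1 c2 c3 c4 c5 c6 (W0 W1 : R -> R) O w B wt s t :
  let D := c1 * c4 - c2 * c3 in let K := c3 * c6 - c4 * c5 in
  let rho := fun s => c1 - c3 * s in let q := fun s => D / rho s in
  let phi := fun s => (c4 * s - c2) / rho s in
  let psi := fun s t => q s * t - c5 * phi s - c6 in
  D <> 0 -> open2 B -> B s t -> is_solution O w ->
  (forall s t, B s t -> rho s <> 0 /\ O (phi s) (psi s t) /\
     wt s t = w (phi s) (psi s t) / (D * q s) - c3 / (D * q s ^ 2) * (psi s t ^ 3 / 6)
       - K / (D * q s ^ 2) * (psi s t ^ 2 / 2) + W1 (phi s) * psi s t + W0 (phi s)) ->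
  pds2 (v1 :: v2 :: v2 :: nil) wt s t
    + pds2 (v2 :: v2 :: nil) wt s t * pds2 (v2 :: v2 :: v2 :: nil) wt s t = 0.
Proof.
  intros D K rho q phi psi ND HB Hst [HO [Hw Ew]] H.
  assert (Nq : forall s t, B s t -> q s <> 0).
  { intros a b Hab. unfold q, Rdiv. apply Rmult_integral_contrapositive_currified; trivial.
    apply Rinv_neq_0_compat. apply (H a b Hab). }
  assert (Dpsi : forall a b, is_derive (fun b => psi a b) b (q a)).
  { intros a b. unfold psi. auto_derive; trivial. ring. }
  assert (Dv2 : forall f a b, smooth2 O f -> B a b ->
     is_derive (fun b => f (phi a) (psi a b)) b (pd2 v2 f (phi a) (psi a b) * q a)).
  { intros f a b Hf Hab. replace (pd2 v2 f (phi a) (psi a b) * q a) with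
      (pd2 v1 f (phi a) (psi a b) * 0 + pd2 v2 f (phi a) (psi a b) * q a) by ring.
    apply (smooth2_is_derive_curve O f (fun _ => phi a) (fun b => psi a b)); trivial.
    - apply (H a b Hab). - apply: is_derive_const. }
  set (w2 := pd2 v2 w). set (w22 := pd2 v2 (pd2 v2 w)).
  assert (Sw2 : smooth2 O w2) by now apply smooth2_pd2.
  assert (Sw22 : smooth2 O w22) by now apply smooth2_pd2.
  assert (E1 : forall a b, B a b -> pd2 v2 wt a b =
     w2 (phi a) (psi a b) / D - c3 / (D * q a) * (psi a b ^ 2 / 2)
     - K / (D * q a) * psi a b + W1 (phi a) * q a).
  { intros a b Hab. rewrite (pd2_ext B v2 _ _ a b HB Hab (fun x y H' => proj2 (proj2 (H x y H')))).
    apply is_derive_unique.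
    assert (D1 := Dv2 w a b Hw Hab). assert (D2 := Dpsi a b). assert (N := Nq a b Hab).
    set (u := fun b => w (phi a) (psi a b)) in *. set (p := fun b => psi a b) in *.
    apply (is_derive_ext (fun b => u b / (D * q a) - c3 / (D * q a ^ 2) * (p b ^ 3 / 6)
       - K / (D * q a ^ 2) * (p b ^ 2 / 2) + W1 (phi a) * p b + W0 (phi a))); [reflexivity|].
    auto_derive; [repeat split; trivial; eexists; eassumption|].
    change (fun x => u x) with u. change (fun x => p x) with p.
    rewrite (is_derive_unique _ _ _ D1) (is_derive_unique _ _ _ D2).
    unfold p, w2. simpl. field. now split. }
  (* The second derivative in [t] removes [W1] and [W0] before anything is differentiated in [s]. *)
  assert (E2 : forall a b, B a b -> pd2 v2 (pd2 v2 wt) a b =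
     (q a * w22 (phi a) (psi a b) - c3 * psi a b - K) / D).
  { intros a b Hab. rewrite (pd2_ext B v2 _ _ a b HB Hab E1).
    apply is_derive_unique.
    assert (D1 := Dv2 w2 a b Sw2 Hab). assert (D2 := Dpsi a b). assert (N := Nq a b Hab).
    set (u := fun b => w2 (phi a) (psi a b)) in *. set (p := fun b => psi a b) in *.
    apply (is_derive_ext (fun b => u b / D - c3 / (D * q a) * (p b ^ 2 / 2)
       - K / (D * q a) * p b + W1 (phi a) * q a)); [reflexivity|].
    auto_derive; [repeat split; trivial; eexists; eassumption|].
    change (fun x => u x) with u. change (fun x => p x) with p.
    rewrite (is_derive_unique _ _ _ D1) (is_derive_unique _ _ _ D2).
    unfold p, w22, w2. simpl. field. now split. }
  change (pd2 v1 (pd2 v2 (pd2 v2 wt)) s t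
    + pd2 v2 (pd2 v2 wt) s t * pd2 v2 (pd2 v2 (pd2 v2 wt)) s t = 0).
  rewrite (E2 s t Hst) (pd2_ext B v1 _ _ s t HB Hst E2) (pd2_ext B v2 _ _ s t HB Hst E2).
  destruct (H s t Hst) as [Nr [HOst _]]. assert (N := Nq s t Hst).
  specialize (Ew _ _ HOst).
  change (pd2 v1 w22 (phi s) (psi s t) + w22 (phi s) (psi s t) * pd2 v2 w22 (phi s) (psi s t) = 0)
    in Ew.
  assert (F2 : pd2 v2 (fun a b => (q a * w22 (phi a) (psi a b) - c3 * psi a b - K) / D) s t =
     (q s ^ 2 * pd2 v2 w22 (phi s) (psi s t) - c3 * q s) / D).
  { apply is_derive_unique. assert (D1 := Dv2 w22 s t Sw22 Hst). assert (D2 := Dpsi s t).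
    set (u := fun b => w22 (phi s) (psi s b)) in *. set (p := fun b => psi s b) in *.
    apply (is_derive_ext (fun b => (q s * u b - c3 * p b - K) / D)); [reflexivity|].
    auto_derive; [repeat split; trivial; eexists; eassumption|].
    change (fun x => u x) with u. change (fun x => p x) with p.
    rewrite (is_derive_unique _ _ _ D1) (is_derive_unique _ _ _ D2).
    field. exact ND. }
  assert (Dphi : is_derive phi s (D / rho s ^ 2)).
  { unfold phi, rho in *. auto_derive; [exact Nr|]. unfold D. field. exact Nr. }
  assert (Dq : is_derive q s (D * c3 / rho s ^ 2)).
  { unfold q, rho in *. auto_derive; [exact Nr|]. field. exact Nr. }
  assert (Dpsi1 : is_derive (fun a => psi a t) s ((c3 * t - c5) * (D / rho s ^ 2))).
  { unfold psi. auto_derive; [repeat split; trivial; eexists; eassumption|].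
    change (fun x => q x) with q. change (fun x => phi x) with phi.
    rewrite (is_derive_unique _ _ _ Dphi) (is_derive_unique _ _ _ Dq). field. exact Nr. }
  assert (F1 : pd2 v1 (fun a b => (q a * w22 (phi a) (psi a b) - c3 * psi a b - K) / D) s t =
     (D * c3 / rho s ^ 2 * w22 (phi s) (psi s t)
      + q s * (pd2 v1 w22 (phi s) (psi s t) * (D / rho s ^ 2)
               + pd2 v2 w22 (phi s) (psi s t) * ((c3 * t - c5) * (D / rho s ^ 2)))
      - c3 * ((c3 * t - c5) * (D / rho s ^ 2))) / D).
  { apply is_derive_unique.
    assert (D1 := smooth2_is_derive_curve O w22 phi (fun a => psi a t) s _ _ HO Sw22 HOst
      Dphi Dpsi1).
    set (u := fun a => w22 (phi a) (psi a t)) in *. set (p := fun a => psi a t) in *.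
    apply (is_derive_ext (fun a => (q a * u a - c3 * p a - K) / D)); [reflexivity|].
    auto_derive; [repeat split; trivial; eexists; eassumption|].
    change (fun x => u x) with u. change (fun x => p x) with p. change (fun x => q x) with q.
    rewrite (is_derive_unique _ _ _ D1) (is_derive_unique _ _ _ Dpsi1)
      (is_derive_unique _ _ _ Dq). unfold u, p. field. now split. }
  rewrite F1 F2.
  assert (P1 : pd2 v1 w22 (phi s) (psi s t)
               = - (w22 (phi s) (psi s t) * pd2 v2 w22 (phi s) (psi s t))) by lra.
  rewrite P1.
  (* A consequence of [c3 * phi s + c4 = q s]. Thus [wt_22 = q (w_22 - (c3 t - c5)) / D], and the
     shift [c3 t - c5] is the ratio of the [s]-derivatives of [psi] and [phi], so the transport
     terms match. *)
  assert (EK : c3 * psi s t + K = q s * (c3 * t - c5)).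
  { unfold psi, q, phi, K, D. unfold rho in *. field. exact Nr. }
  replace (q s * w22 (phi s) (psi s t) - c3 * psi s t - K) with
    (q s * w22 (phi s) (psi s t) - q s * (c3 * t - c5)) by lra.
  unfold q. field. now split.
Qed.

Lemma smooth1_continuous x0 d f : 0 < d -> smooth1 (x0 - d) (x0 + d) f -> continuous f x0.
Proof.
  intros Hd H. assert (E := H O x0). simpl in E. apply: ex_derive_continuous. apply E. lra.
Qed.

Lemma continuous_locally_near (f : R * R -> R) p l d :
  continuous f p -> f p = l -> 0 < d -> locally p (fun u => Rabs (f u - l) < d).
Proof. intros C <- Hd. exact (C _ (locally_ball (f p) (mkposreal d Hd))). Qed.

(** [(phi, psi, zeta)] is the inverse transformation at the points [(s, t, wt s t)]; by continuity
    it stays where the local form is valid. The points of the graph of [w] supplied by the image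
    condition might lie elsewhere in [U], but injectivity identifies them with [(phi, psi, zeta)],
    which expresses [wt] through [w]. *)
Lemma G13_form_preserves_solutions U F1 F2 F3 :
  is_point_transformation U F1 F2 F3 -> locally_G13_form U F1 F2 F3 ->
  preserves_solutions U F1 F2 F3.
Proof.
  intros [HU [_ [_ [_ [Inj _]]]]] HF O w HS Gr Ot wt HOt Swt Im.
  split; [exact HOt|split; [exact Swt|]]. intros s t Hst.
  destruct (Im s t Hst) as [x0 [y0 [Hx0 [Es [Et Ew]]]]].
  set (z0 := w x0 y0) in *. assert (U0 := Gr x0 y0 Hx0). fold z0 in U0.
  destruct (HF x0 y0 z0 U0) 
    as [d [Hd [c1 [c2 [c3 [c4 [c5 [c6 [ND [W0 [W1 [SW0 [SW1 Form]]]]]]]]]]]]].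
  pose (D := c1 * c4 - c2 * c3). pose (K := c3 * c6 - c4 * c5).
  pose (rho := fun s => c1 - c3 * s). pose (q := fun s => D / rho s).
  pose (phi := fun s => (c4 * s - c2) / rho s).
  pose (psi := fun s t => q s * t - c5 * phi s - c6).
  pose (zeta := fun s t => D * q s * (wt s t + c3 / (D * q s ^ 2) * (psi s t ^ 3 / 6)
    + K / (D * q s ^ 2) * (psi s t ^ 2 / 2) - W1 (phi s) * psi s t - W0 (phi s))).
  assert (Z : forall a, Rabs (a - a) < d) by (intros a; now rewrite Rminus_diag Rabs_R0).
  destruct (Form x0 y0 z0 U0 (Z _) (Z _) (Z _)) as [Nq0 [G1 [G2 G3]]].
  fold D in G3, ND. fold K in G3. rewrite Es in G1. rewrite Et in G2. rewrite Ew in G3.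
  assert (R0 : rho s = D / (c3 * x0 + c4)) by (unfold rho, D; rewrite G1; field; exact Nq0).
  assert (Nr0 : rho s <> 0).
  { rewrite R0. unfold Rdiv. apply Rmult_integral_contrapositive_currified; trivial.
    now apply Rinv_neq_0_compat. }
  assert (Q0 : q s = c3 * x0 + c4) by (unfold q; rewrite R0; field; now split).
  assert (Phi0 : phi s = x0).
  { unfold phi. rewrite R0 G1. unfold D. field. now split. }
  assert (Psi0 : psi s t = y0) by (unfold psi; rewrite Q0 Phi0 G2; field; exact Nq0).
  assert (Zeta0 : zeta s t = z0).
  { unfold zeta. rewrite Q0 Phi0 Psi0 G3. field. now split. }
  pose (Om := fun a b => Ot a b /\ rho a <> 0).
  assert (Q : alg Ot (fun a _ => rho a)).
  { apply alg_minus; [apply alg_const|apply alg_mult; [apply alg_const|apply alg_fst]]. }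
  assert (HOm : open2 Om)
    by (apply (open2_nonzero Ot (fun a _ => rho a)); trivial; now apply smooth2_alg).
  assert (Hm : Om s t) by now split.
  assert (Qm : alg Om (fun a _ => rho a)).
  { apply alg_minus; [apply alg_const|apply alg_mult; [apply alg_const|apply alg_fst]]. }
  assert (NQm : forall a b, Om a b -> rho a <> 0) by now intros ? ? [].
  assert (Aphi : alg Om (fun a _ => phi a)).
  { apply alg_div; trivial.
    apply alg_minus; [apply alg_mult; [apply alg_const|apply alg_fst]|apply alg_const]. }
  assert (Aq : alg Om (fun a _ => q a)) by (apply alg_div; trivial; apply alg_const).
  assert (Apsi : alg Om psi).
  { apply alg_minus; [apply alg_minus|apply alg_const].
    - apply alg_mult; [exact Aq|apply alg_snd].
    - apply alg_mult; [apply alg_const|exact Aphi]. }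
  assert (Nqm : forall a b, Om a b -> D * q a ^ 2 <> 0).
  { intros a b Hab. apply Rmult_integral_contrapositive_currified; trivial. apply pow_nonzero.
    unfold q, Rdiv. apply Rmult_integral_contrapositive_currified; trivial.
    apply Rinv_neq_0_compat. exact (NQm a b Hab). }
  assert (Adq : alg Om (fun a _ => D * q a ^ 2)).
  { apply alg_mult; [apply alg_const|]. apply alg_mult; trivial. apply alg_mult; trivial.
    apply alg_const. }
  assert (Swm : alg Om wt) by (apply alg_smooth, (smooth2_subset Ot); trivial; now intros ? ? []).
  assert (Az : alg Om (fun a b => wt a b + c3 / (D * q a ^ 2) * (psi a b ^ 3 / 6)
    + K / (D * q a ^ 2) * (psi a b ^ 2 / 2))).
  { apply alg_plus; [apply alg_plus; [exact Swm|]|]; apply alg_mult.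
    - apply alg_div; trivial. apply alg_const.
    - apply alg_div; [|apply alg_const|intros; lra].
      repeat (apply alg_mult; trivial); apply alg_const.
    - apply alg_div; trivial. apply alg_const.
    - apply alg_div; [|apply alg_const|intros; lra].
      repeat (apply alg_mult; trivial); apply alg_const. }
  assert (Cphi := alg_continuous Om _ s t Aphi Hm).
  assert (Cpsi := alg_continuous Om _ s t Apsi Hm).
  assert (CW : forall W, smooth1 (x0 - d) (x0 + d) W ->
     continuous (fun p : R * R => W (phi (fst p))) (s, t)).
  { intros W SW. apply (continuous_comp (fun p : R * R => phi (fst p)) W); trivial.
    simpl. rewrite Phi0. now apply (smooth1_continuous x0 d). }
  assert (Czeta : continuous (fun p : R * R => zeta (fst p) (snd p)) (s, t)).
  { apply (continuous_mult (fun p : R * R => D * q (fst p))).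
    - exact (alg_continuous Om (fun a _ => D * q a) s t (alg_mult _ _ _ (alg_const _ _) Aq) Hm).
    - apply (continuous_minus (fun p : R * R => wt (fst p) (snd p)
        + c3 / (D * q (fst p) ^ 2) * (psi (fst p) (snd p) ^ 3 / 6)
        + K / (D * q (fst p) ^ 2) * (psi (fst p) (snd p) ^ 2 / 2)
        - W1 (phi (fst p)) * psi (fst p) (snd p))); [|now apply CW].
      apply (continuous_minus (fun p : R * R => wt (fst p) (snd p)
        + c3 / (D * q (fst p) ^ 2) * (psi (fst p) (snd p) ^ 3 / 6)
        + K / (D * q (fst p) ^ 2) * (psi (fst p) (snd p) ^ 2 / 2))).
      + exact (alg_continuous Om _ s t Az Hm).
      + apply (continuous_mult (fun p : R * R => W1 (phi (fst p)))); trivial. now apply CW. }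
  assert (LU : locally (s, t) (fun p : R * R =>
     U (phi (fst p)) (psi (fst p) (snd p)) (zeta (fst p) (snd p)))).
  { assert (P : filterlim (fun p : R * R => (phi (fst p), psi (fst p) (snd p),
       zeta (fst p) (snd p))) (locally (s, t)) (locally (phi s, psi s t, zeta s t)))
      by (apply: filterlim_locally_pair; [apply: filterlim_locally_pair|]; assumption).
    rewrite Phi0 Psi0 Zeta0 in P. exact (P _ (open3_locally U _ _ _ HU U0)). }
  destruct (locally_box _ _ _ (filter_and _ _ (open2_locally Om s t HOm Hm)
    (filter_and _ _ LU (filter_and _ _ (continuous_locally_near _ _ x0 d Cphi Phi0 Hd)
    (filter_and _ _ (continuous_locally_near _ _ y0 d Cpsi Psi0 Hd)
      (continuous_locally_near _ _ z0 d Czeta Zeta0 Hd)))))) as [e [He B]].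
  apply (transformed_is_solution c1 c2 c3 c4 c5 c6 W0 W1 O w (box s t e)); trivial.
  - apply open2_box.
  - split; now rewrite Rminus_diag Rabs_R0.
  - intros a b [Ha Hb]. destruct (B a b Ha Hb) as [[HOa Nr] [Ua [B1 [B2 B3]]]].
    simpl in HOa, Nr, Ua, B1, B2, B3.
    change (rho a <> 0 /\ O (phi a) (psi a b) /\
     wt a b = w (phi a) (psi a b) / (D * q a) - c3 / (D * q a ^ 2) * (psi a b ^ 3 / 6)
       - K / (D * q a ^ 2) * (psi a b ^ 2 / 2) + W1 (phi a) * psi a b + W0 (phi a)).
    destruct (Form _ _ _ Ua B1 B2 B3) as [Nq [E1 [E2 E3]]]. fold D K in E3.
    assert (Eq : c3 * phi a + c4 = q a).
    { unfold phi, q, D, rho. field. exact Nr. }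
    rewrite Eq in Nq, E1, E2, E3.
    assert (I1 : F1 (phi a) (psi a b) (zeta a b) = a).
    { rewrite E1. unfold q, phi. unfold rho in *. unfold D in *. field. now split. }
    assert (I2 : F2 (phi a) (psi a b) (zeta a b) = b).
    { rewrite E2. unfold psi. field. exact Nq. }
    assert (I3 : F3 (phi a) (psi a b) (zeta a b) = wt a b).
    { rewrite E3. unfold zeta. field. now split. }
    destruct (Im a b HOa) as [x [y [Hxy [J1 [J2 J3]]]]].
    destruct (Inj _ _ _ _ _ _ Ua (Gr x y Hxy)) as [K1 [K2 K3]]; [congruence..|].
    split; [exact Nr|]. rewrite K1 K2. split; [exact Hxy|].
    rewrite -K3 -K1 -K2 -I3 E3. ring.
Qed.

(* A point transformation belongs to the point-symmetry pseudogroup G_{1.3}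
   of  w_122 + w_22 w_222 = 0  iff it is (locally) of the stated form. *)
Theorem theorem2 (U : R -> R -> R -> Prop) (F1 F2 F3 : R -> R -> R -> R) :
  is_point_transformation U F1 F2 F3 ->
  (is_point_symmetry U F1 F2 F3 <-> locally_G13_form U F1 F2 F3).
Proof.
  intros HT. split.
  - intros [_ HP]. now apply symmetry_has_G13_form.
  - intros HF. split; [exact HT|]. now apply G13_form_preserves_solutions.
Qed.
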